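(* Let $\mathbf{K}\subset\mathbb{R}^m$ be closed with nonempty interior, let $\mu$ be a finite Borel measure with $\operatorname{supp}(\mu)=\mathbf{K}$, and let $f(x,z)=\sum_{\beta\in N(m,d)}f_\beta(x)z^\beta$ with $f_\beta:\mathbb{R}^n\to\mathbb{R}$. For $r\in\mathbb{N}$ and $x\in\mathbb{R}^n$ define $$f_{\mathbf{K}}^{(r)}(x):=\sup_{h\in\Sigma[z]_r}\left\{\int_{\mathbf{K}}f(x,z)h(z)\,d\mu(z)\;:\;\int_{\mathbf{K}}h(z)\,d\mu(z)=1\right\}.$$ Fix $x\in\mathbb{R}^n$ such that $\max_{z\in\mathbf{K}}f(x,z)$ exists, and suppose that $(\mathbf{K},\mu)$ satisfies one of the following conditions: (1) $\mathbf{K}$ is closed with nonempty interior and there is $M>0$ such that $\int_{\mathbf{K}}z_i^{2k}\,d\mu(z)\le(2k)!\,M$ for all $i\in\{1,\dots,m\}$ and all $k\in\mathbb{N}$; (2) $\mathbf{K}$ is compact with nonempty interior and $\mu$ is a finite Borel measure with $\operatorname{supp}(\mu)=\mathbf{K}$; (3) $\mathbf{K}$ is compact and satisfies an interior cone condition, and $\mu$ is the Lebesgue measure on $\mathbf{K}$; (4) $\mathbf{K}$ is a convex body and $\mu$ is the Lebesgue measure on $\mathbf{K}$; (5) $\mathbf{K}=[-1,1]^m$ and $d\mu(z)=\prod_{i=1}^m(1-z_i^2)^{-1/2}\,dz$. Then $$\lim_{r\to\infty}f_{\mathbf{K}}^{(r)}(x)=\max_{z\in\mathbf{K}}f(x,z),$$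 so that in the limit $r\to\infty$ the constraint $f_{\mathbf{K}}^{(r)}(x)\le 0$ reduces to the robust counterpart constraint $\max_{z\in\mathbf{K}}f(x,z)\le 0$. Moreover, the rate of convergence is as follows: the gap $\max_{z\in\mathbf{K}}f(x,z)-f_{\mathbf{K}}^{(r)}(x)$ is $o(1)$ in cases (1) and (2), $O(1/\sqrt r)$ in case (3), $O(1/r)$ in case (4), and of order $\Theta(1/r^2)$ in case (5), meaning that it is $O(1/r^2)$ for every such $f$ and that this order cannot be improved in general.
   Context: For $z\in\mathbb{R}^m$ and $\alpha\in\mathbb{N}_0^m$, $z^\alpha=\prod_{i=1}^m z_i^{\alpha_i}$, and $N(m,d)=\{\alpha\in\mathbb{N}_0^m:\sum_{i=1}^m\alpha_i\le d\}$. $\Sigma[z]_r$ denotes the set of all sum-of-squares polynomials in $z=(z_1,\dots,z_m)$ of degree at most $2r$. $\operatorname{supp}(\mu)$ is the smallest closed set $S$ with $\mu(\mathbb{R}^m\setminus S)=0$. A compact set $\mathbf{K}\subset\mathbb{R}^m$ satisfies an interior cone condition if there exist $\theta\in(0,\pi/2)$ and $\rho>0$ such that for every $z\in\mathbf{K}$ there is a unit vector $\xi(z)$ with $\{z+\lambda y:\ \|y\|=1,\ y^T\xi(z)\ge\cos\theta,\ \lambda\in[0,\rho]\}\subset\mathbf{K}$. A convex body is a compact convex set with nonempty interior. The constants in the $O(\cdot)$ statements may depend on $\mathbf{K}$ and on the polynomial $z\mapsto f(x,z)$, but not on $r$. *)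

(* Defs.v *)
(* Built on MathComp, MathComp-Analysis and Multinomials; mpoly is imported
   without its notations, which clash with those of MathComp-Analysis. *)
From HB Require Import structures.
From mathcomp Require Import all_boot all_order all_algebra.
From mathcomp Require Import -(notations) mpoly.
From mathcomp Require Import all_classical all_reals all_analysis.
From mathcomp Require Import measurable_realfun.
Set Implicit Arguments. Unset Strict Implicit. Unset Printing Implicit Defensive.
Import Order.TTheory GRing.Theory Num.Theory.
Import numFieldNormedType.Exports.
Local Open Scope classical_set_scope.
Local Open Scope ring_scope.
(* R^m is 'rV[R]_m; its topology is the product topology, so open sets are the
   usual ones, although its library norm is the sup norm. *)
Notation borelrV R m := (g_sigma_algebraType (@open 'rV[R]_m)).

Section borel_rV.
Context {R : realType}.

Lemma open_rV_bigcup_rat m (U : set 'rV[R]_m) : open U ->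
  U = \bigcup_(qk in [set qk : 'rV[rat]_m * nat |
        ball (map_mx ratr qk.1 : 'rV[R]_m) qk.2.+1%:R^-1 `<=` U])
      ball (map_mx ratr qk.1 : 'rV[R]_m) qk.2.+1%:R^-1.
Proof.
move=> oU; apply/seteqP; split => [v Uv|v [qk /= qkU]]; last exact: qkU.
have /nbhs_ballP[e /= e0 eU] := open_nbhs_nbhs (conj oU Uv).
have [k ke] : exists k : nat, (k.+1%:R^-1 : R) < e / 2.
  have e20 : 0 < e / 2 by rewrite divr_gt0.
  have [k _ /(_ k (leqnn _)) H] := near_infty_natSinv_lt (PosNum e20).
  by exists k.
have k0 : (0:R) < k.+1%:R^-1 by rewrite invr_gt0 ltr0n.
have Q i : exists q : rat, ball (v 0 i) k.+1%:R^-1 (ratr q : R).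
  have ne : ball (v 0 i) k.+1%:R^-1 !=set0 by exists (v 0 i); exact: ballxx.
  have [x [bx [q _ qE]]] := dense_rat ne (ball_open _ _).
  by exists q; rewrite qE.
have [q qv] := choice Q.
have vq : ball v k.+1%:R^-1 (map_mx ratr (\row_i q i) : 'rV[R]_m).
  by split => // i j; rewrite ord1 !mxE; exact: qv.
exists (\row_i q i, k) => /=; last exact: ball_sym.
move=> w qw; apply: eU; apply: (@le_ball _ _ _ (k.+1%:R^-1 + k.+1%:R^-1)).
  by rewrite [leRHS](splitr e) lerD// ltW.
exact: ball_triangle vq qw.
Qed.

Lemma measurable_fun_borelrV d (T : measurableType d) m (f : T -> borelrV R m) :
  (forall i, measurable_fun setT (fun t => (f t : 'rV[R]_m) 0 i)) ->
  measurable_fun setT f.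
Proof.
move=> mf; apply: (@measurability _ _ _ _ setT f (@open 'rV[R]_m)) => //.
move=> _ [U oU <-]; rewrite setTI (open_rV_bigcup_rat oU) preimage_bigcup.
rewrite bigcup_mkcond; apply: countable_bigcupT_measurable => [|[q k]].
  exact: countableP.
case: ifPn => _ //=.
have -> : f @^-1` ball (map_mx ratr q : 'rV[R]_m) k.+1%:R^-1 =
    \bigcap_(i in [set: 'I_m])
      (fun t => (f t : 'rV[R]_m) 0 i) @^-1` ball (ratr (q 0 i) : R) k.+1%:R^-1.
  apply/seteqP; split => [t [_ qt] i _ /=|t qt].
    by have := qt 0 i; rewrite mxE.
  split=> [|i j]; first by rewrite invr_gt0 ltr0n.
  by rewrite ord1 mxE; exact: qt.
apply: fin_bigcap_measurable => [|i _]; first exact: finite_finset.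
rewrite -[X in measurable X]setTI.
by apply: mf => //; exact: measurable_ball.
Qed.

Lemma measurable_fun_rV_continuous m (g : 'rV[R]_m -> R) : continuous g ->
  measurable_fun setT (g : borelrV R m -> R).
Proof.
move=> cg; apply: (measurability _ (RGenOpens.measurableE R)).
move=> _ [_ [a [b ->]] <-]; rewrite setTI; apply: sub_sigma_algebra.
by move/continuousP: cg; apply; exact: interval_open.
Qed.

Definition consrV m (p : R * 'rV[R]_m) : 'rV[R]_m.+1 :=
  row_mx (const_mx p.1 : 'rV_1) p.2.

Definition unconsrV m (v : 'rV[R]_m.+1) : R * 'rV[R]_m :=
  (v 0 0, rsubmx (v : 'rV_(1 + m))).

Lemma consrVK m : cancel (@consrV m) (@unconsrV m).
Proof.
move=> [t v]; rewrite /unconsrV /consrV /= row_mxKr; congr pair.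
transitivity (row_mx (const_mx t : 'rV_1) v 0 (lshift m 0)).
  by congr (row_mx _ _ _ _); exact/val_inj.
by rewrite row_mxEl mxE.
Qed.

Lemma measurable_consrV m :
  measurable_fun setT
    (@consrV m : measurableTypeR R * borelrV R m -> borelrV R m.+1).
Proof.
apply: measurable_fun_borelrV => i.
case: (@split_ordP 1 m i) => j ->.
  rewrite [X in measurable_fun _ X](_ : _ = fst); first exact: measurable_fst.
  by apply/funext => p; exact: etrans (@row_mxEl _ 1 1 m _ _ _ _) (mxE _ _ _ _).
rewrite [X in measurable_fun _ X](_ : _ =
    (fun v : borelrV R m => (v : 'rV_m) 0 j) \o snd); last first.
  by apply/funext => p; exact: (@row_mxEr _ 1 1 m).
apply: measurableT_comp; last exact: measurable_snd.
by apply: measurable_fun_rV_continuous => ?; exact: coord_continuous.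
Qed.

Lemma measurable_unconsrV m :
  measurable_fun setT
    (@unconsrV m : borelrV R m.+1 -> measurableTypeR R * borelrV R m).
Proof.
apply/measurable_fun_pairP; split.
  by apply: measurable_fun_rV_continuous => ?; exact: coord_continuous.
apply: measurable_fun_borelrV => j.
rewrite [X in measurable_fun _ X](_ : _ =
    (fun v : borelrV R m.+1 => (v : 'rV_m.+1) 0 (rshift 1 j))).
  by apply: measurable_fun_rV_continuous => ?; exact: coord_continuous.
by apply/funext => v; rewrite /= mxE.
Qed.

Section lebesgue_rV_step.
Variables (m : nat) (mu : {sigma_finite_measure set (borelrV R m) -> \bar R}).

Definition lebesgue_rV_step : set (borelrV R m.+1) -> \bar R :=
  pushforward ((@lebesgue_measure R) \x mu)%E
  (@consrV m : measurableTypeR R * borelrV R m -> borelrV R m.+1).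

Let step0 : lebesgue_rV_step set0 = 0%E.
Proof. by rewrite /lebesgue_rV_step /pushforward preimage_set0 measure0. Qed.

Let step_ge0 A : (0 <= lebesgue_rV_step A)%E.
Proof. exact: (measure_ge0 ((@lebesgue_measure R) \x mu)%E). Qed.

Let step_sigma_additive : semi_sigma_additive lebesgue_rV_step.
Proof.
exact: (@measure_semi_sigma_additive _ _ _
  (measure_function_pushforward__canonical__measure_function_Measure
   ((@lebesgue_measure R) \x mu)%E (@measurable_consrV m))).
Qed.

HB.instance Definition _ := isMeasure.Build _ _ _ lebesgue_rV_step
  step0 step_ge0 step_sigma_additive.

Let step_sigma_finite : sigma_finite setT lebesgue_rV_step.
Proof.
have /sigma_finiteP[F [FT ndF Foo]] := sigma_finiteT (@lebesgue_measure R).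
have /sigma_finiteP[G [GT ndG Goo]] := sigma_finiteT mu.
exists (fun k => @unconsrV m @^-1` (F k `*` G k)) => [|k].
  rewrite -preimage_bigcup (_ : \bigcup_k _ = setT) ?preimage_setT//.
  apply/seteqP; split => // -[t v] _.
  have [i _ Fit] : (\bigcup_k F k) t by rewrite -FT.
  have [j _ Gjv] : (\bigcup_k G k) v by rewrite -GT.
  exists (maxn i j) => //; split => /=.
  - by move: t Fit; exact/subsetPset/ndF/leq_maxl.
  - by move: v Gjv; exact/subsetPset/ndG/leq_maxr.
have [[mF Fk] [mG Gk]] := (Foo k, Goo k).
have mFG : measurable (F k `*` G k) by exact: measurableX.
split; first by rewrite -[X in measurable X]setTI; exact: measurable_unconsrV.
rewrite /lebesgue_rV_step /pushforward -comp_preimage.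
rewrite (_ : _ \o _ = id); last by apply/funext => p; exact: consrVK.
by rewrite preimage_id product_measure1E// lte_mul_pinfty// ge0_fin_numE.
Qed.

HB.instance Definition _ := @Measure_isSigmaFinite.Build _ _ _ lebesgue_rV_step
  step_sigma_finite.

End lebesgue_rV_step.

(* m-dimensional Lebesgue measure on the Borel sets: the m-fold product of the
   one-dimensional one, transported along R * 'rV_m ~ 'rV_m.+1. *)
Fixpoint lebesgue_rV m : {sigma_finite_measure set (borelrV R m) -> \bar R} :=
  if m is m'.+1 then lebesgue_rV_step (lebesgue_rV m')
  else \d_(0 : borelrV R 0).


Lemma lebesgue_rV_box m (A : 'I_m -> set R) :
  (forall i, measurable (A i : set (measurableTypeR R))) ->
  lebesgue_rV m [set v | forall i, A i ((v : 'rV[R]_m) 0 i)] =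
  (\prod_(i < m) lebesgue_measure (A i : set (measurableTypeR R)))%E.
Proof.
elim: m A => [|m IH] A mA.
  rewrite big_ord0 /= diracE mem_set//.
  by case.
rewrite big_ord_recl -(IH (fun i => A (lift ord0 i))) => [|i]; last exact: mA.
rewrite /= /lebesgue_rV_step /pushforward -product_measure1E//; last first.
  rewrite (_ : [set v | _] = \bigcap_(i in [set: 'I_m])
    (fun v : borelrV R m => (v : 'rV[R]_m) 0 i) @^-1` A (lift ord0 i)).
    apply: fin_bigcap_measurable => [|i _]; first exact: finite_finset.
    rewrite -[X in measurable X]setTI; apply: measurable_fun_rV_continuous => //.
      by move=> ?; exact: coord_continuous.
    exact: mA.
  by apply/seteqP; split => v /= vA i; [move=> _ | ]; exact: vA.
congr (_ _); apply/seteqP; split => -[t v] /=.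
  move=> Atv; split => [|i].
    have := Atv ord0; congr (A _ _).
    exact: (congr1 fst (consrVK (t, v))).
  have := Atv (lift ord0 i); congr (A _ _).
  rewrite (_ : lift ord0 i = rshift 1 i); last exact/val_inj.
  exact: (@row_mxEr _ 1 1 m).
move=> [At Av] i; case: (unliftP ord0 i) => [j ->|->].
  have := Av j; congr (A _ _); apply/esym.
  rewrite (_ : lift ord0 j = rshift 1 j); last exact/val_inj.
  exact: (@row_mxEr _ 1 1 m).
have := At; congr (A _ _); apply/esym.
exact: (congr1 fst (consrVK (t, v))).
Qed.

End borel_rV.

Section definitions.
Context {R : realType} {m : nat}.
Implicit Types (K : set 'rV[R]_m)
  (mu : {finite_measure set (borelrV R m) -> \bar R}) (g : 'rV[R]_m -> R).

Definition is_support mu K :=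
  [/\ closed K, mu (~` K) = 0%E &
      forall S : set 'rV[R]_m, closed S -> mu (~` S) = 0%E -> K `<=` S].

Definition mevalrV (p : mpoly m R) (z : 'rV[R]_m) : R :=
  meval (fun i => z 0 i) p.

(* msize is the total degree plus one. *)
Definition sos r : set (mpoly m R) :=
  [set h | (exists s : seq (mpoly m R), h = \sum_(p <- s) p ^+ 2) /\
           (msize h <= (2 * r).+1)%N].

(* bmultinom m d.+1 is the finite type of multi-indices of degree at most d. *)
Definition param_poly n d (f : bmultinom m d.+1 -> 'rV[R]_n -> R)
    (x : 'rV[R]_n) (z : 'rV[R]_m) : R :=
  \sum_(b : bmultinom m d.+1) f b x * \prod_(i < m) z 0 i ^+ b i.

Definition sos_bound K mu g (r : nat) : \bar R :=
  ereal_sup [set (\int[mu]_(z in K) (g z * mevalrV h z)%:E)%E |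
    h in [set h | sos r h /\ (\int[mu]_(z in K) (mevalrV h z)%:E = 1)%E]].

Definition is_max_on K g (M : R) :=
  (exists2 z, K z & g z = M) /\ (forall z, K z -> g z <= M).

(* fine only discards infinite values, which do not occur for large r as soon
   as sos_bound converges to M%:E. *)
Definition gap K mu g (M : R) (r : nat) : R^o :=
  fine (M%:E - sos_bound K mu g r)%E.

Definition dotrV (u v : 'rV[R]_m) : R := (u *m v^T) 0 0.

(* The Euclidean norm, as opposed to the library norm `|u|. *)
Definition enorm (u : 'rV[R]_m) : R := Num.sqrt (dotrV u u).

Definition interior_cone K :=
  exists theta rho : R, [/\ 0 < theta < pi / 2, 0 < rho &
    forall z, K z -> exists2 xi : 'rV[R]_m, enorm xi = 1 &
      forall (y : 'rV[R]_m) (l : R), enorm y = 1 -> cos theta <= dotrV y xi ->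
        0 <= l <= rho -> K (z + l *: y)].

Definition convex_body K :=
  [/\ compact K, convex_set (K : set (convex_lmodType 'rV[R]_m)) &
      K° !=set0].

Definition lebesgue_on K mu :=
  forall A : set (borelrV R m), measurable A -> mu A = lebesgue_rV m (A `&` K).

(* The density vanishes, by the convention 0^-1 = 0, on the null set where
   some coordinate of z is 1 or -1. *)
Definition chebyshev_on K mu :=
  forall A : set (borelrV R m), measurable A ->
  mu A = (\int[lebesgue_rV m]_(z in A `&` K)
    (\prod_(i < m) (Num.sqrt (1 - (z : 'rV[R]_m) 0 i ^+ 2))^-1)%:E)%E.

Definition cond_moments K mu :=
  [/\ closed K, K° !=set0 & exists2 M : R, 0 < M &
    forall (i : 'I_m) (k : nat),
    (\int[mu]_(z in K) ((z : 'rV[R]_m) 0 i ^+ (2 * k))%:E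
      <= ((2 * k)`!%:R * M)%:E)%E].

Definition cond_compact K mu := [/\ compact K, K° !=set0 & is_support mu K].

Definition cond_cone K mu :=
  [/\ compact K, interior_cone K & lebesgue_on K mu].

Definition cond_convex K mu := convex_body K /\ lebesgue_on K mu.

Definition cond_chebyshev K mu :=
  K = [set z | forall i, -1 <= z 0 i <= 1] /\ chebyshev_on K mu.

End definitions.

(* Main.v *)
(* Write L for integration against mu over K and let f attain its maximum M at
   a. A sum of squares h with L((M - f) h) <= e L(h) shows that the gap is at
   most e, so each rate comes from a well-chosen h.

   Convex bodies: f >= M - Q on K, where Q >= 0 is minus the linear part of f at
   a plus a multiple of |z - a|^2; take h = (1 - U)^(2s) with U = Q / B normalised
   to [0, 1/2]. The dilation by 1/2 towards a maps K into itself and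
   at least halves U, so L((1-U)^s) <= 2^m L((1-U)^(2s)), and Bernoulli's
   inequality bounds the mean of U under h by 2^m / s.
   Interior cones: the same h with U proportional to |z - a|^2, both integrals
   being compared with Gaussian ones of order s^(-m/2).
   Chebyshev measure: by Gauss-Chebyshev quadrature, L becomes an average over
   the grid of points cos((2j+1) pi / 2n), and h is the square of the product
   vanishing at all grid points but the block of d+1 nodes nearest to a in each
   coordinate. For f = z_0 the largest node is at distance of order 1/n^2 from 1,
   which gives the matching lower bound.

   Convergence under the moment condition (which compactness implies): if all
   bounds were at most L0 < M, then W = L0 - f would satisfy L(W p^2) >= 0 for
   all polynomials p. Approximating cosines by Taylor polynomials, which the
   moment growth makes dominated, L(W (p g)^2) >= 0 persists when g is multiplied
   by cos(t(z_i - a_i)) with t small; as cos(y / sqrt n)^(2n) --> exp(-y^2), the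
   Gaussian integrals of W centred at a are nonnegative, and Laplace's method
   contradicts W(a) < 0. *)
Require Import Defs.
From HB Require Import structures.
From mathcomp Require Import all_boot all_order all_algebra.
From mathcomp Require Import -(notations) mpoly.
From mathcomp Require Import all_classical all_reals all_analysis.
From mathcomp Require Import measurable_realfun.
From mathcomp Require Import ring lra zify.
Set Implicit Arguments. Unset Strict Implicit. Unset Printing Implicit Defensive.
Import Order.TTheory GRing.Theory Num.Theory.
Import numFieldNormedType.Exports.
Local Open Scope classical_set_scope.
Local Open Scope ring_scope.

(** * Polynomial functions and the sum-of-squares bound *)

Section polynomial_functions.
Context {R : realType} {m : nat}.
Implicit Types (p q : mpoly m R) (z : 'rV[R]_m).

(** The rates differ by how the first-order term of [f] at [a] is controlled. In the angles, with
    z_i = cos u_i, the cube becomes all of R^m, so that even a maximum on the boundary is quadratic.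
    On a convex body the linear term is nonpositive on [K - a] and can be built into the weight.
    Under the cone condition no dilation of [K] is available: the linear term is split by the
    arithmetic-geometric mean inequality, which costs half of the exponent. Under the moment
    condition the Taylor polynomials of a Gaussian cannot be used directly: their natural majorant
    exp(|z|^2) need not be integrable when the moments grow like (2k)!. Those of a cosine are
    bounded by exp(t |z_i - a_i|), which is harmless for small t. The cosines are inserted one at a
    time; the earlier ones are already bounded by 1, so each passage to the limit involves a single
    exponential. *)

Lemma mevalrVC c z : mevalrV (mpolyC m c) z = c.
Proof. exact: mevalC. Qed.

Lemma mevalrV1 z : mevalrV (1 : mpoly m R) z = 1.
Proof. exact: meval1. Qed.

Lemma mevalrVD p q z : mevalrV (p + q) z = mevalrV p z + mevalrV q z.
Proof. exact: mevalD. Qed.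

Lemma mevalrVB p q z : mevalrV (p - q) z = mevalrV p z - mevalrV q z.
Proof. exact: mevalB. Qed.

Lemma mevalrVM p q z : mevalrV (p * q) z = mevalrV p z * mevalrV q z.
Proof. exact: mevalM. Qed.

Lemma mevalrVZ c p z : mevalrV (c *: p) z = c * mevalrV p z.
Proof. exact: mevalZ. Qed.

Lemma mevalrVXn p k z : mevalrV (p ^+ k) z = mevalrV p z ^+ k.
Proof. by elim: k => [|k IH]; rewrite ?mevalrV1// !exprS mevalrVM IH. Qed.

Lemma mevalrVX i z : mevalrV (mpolyX R (mnm1 i)) z = z 0 i.
Proof. exact: mevalXU. Qed.

Lemma mevalrV_sum I (r : seq I) (P : pred I) (F : I -> mpoly m R) z :
  mevalrV (\sum_(i <- r | P i) F i) z = \sum_(i <- r | P i) mevalrV (F i) z.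
Proof. exact: raddf_sum. Qed.

Lemma mevalrV_prod I (r : seq I) (P : pred I) (F : I -> mpoly m R) z :
  mevalrV (\prod_(i <- r | P i) F i) z = \prod_(i <- r | P i) mevalrV (F i) z.
Proof.
by rewrite /mevalrV (big_morph _ (mevalM _) (meval1 _)).
Qed.

Lemma continuous_sum_seq (U : topologicalType) I (s : seq I) (P : pred I)
    (F : I -> U -> R) : (forall i, continuous (F i)) ->
  continuous (fun x => \sum_(i <- s | P i) F i x).
Proof.
move=> cF x; elim: s => [|i s IH].
  by under eq_fun do rewrite big_nil; exact: cvg_cst.
under eq_fun do rewrite big_cons.
by case: (P i) => //; apply: cvgD => //; exact: cF.
Qed.

Lemma continuous_prod_seq (U : topologicalType) I (s : seq I) (P : pred I)
    (F : I -> U -> R) : (forall i, continuous (F i)) ->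
  continuous (fun x => \prod_(i <- s | P i) F i x).
Proof.
move=> cF x; elim: s => [|i s IH].
  by under eq_fun do rewrite big_nil; exact: cvg_cst.
under eq_fun do rewrite big_cons.
by case: (P i) => //; apply: cvgM => //; exact: cF.
Qed.

Lemma continuous_mevalrV p : continuous (mevalrV p).
Proof.
rewrite (_ : mevalrV p = fun z => \sum_(e <- msupp p)
    mcoeff e p * \prod_i z 0 i ^+ e i); last first.
  by apply/funext => z; rewrite /mevalrV mevalE.
apply: continuous_sum_seq => e z; apply: continuousM; first exact: cst_continuous.
apply: continuous_prod_seq => i w.
have := @continuous_comp _ _ _ (fun z : 'rV[R]_m => z 0 i)
  (fun x => x ^+ e i) w.
by apply; [exact: coord_continuous|exact: exprn_continuous].
Qed.

Lemma measurable_mevalrV p (D : set (borelrV R m)) :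
  measurable_fun D (mevalrV p : borelrV R m -> R).
Proof.
apply: measurable_funTS; apply: measurable_fun_rV_continuous.
exact: continuous_mevalrV.
Qed.

Lemma closed_measurable_rV (K : set 'rV[R]_m) : closed K ->
  measurable (K : set (borelrV R m)).
Proof.
move=> cK; rewrite -[K]setCK; apply: measurableC.
by apply: sub_sigma_algebra; exact: closed_openC.
Qed.

Definition mpoly_param n d (f : bmultinom m d.+1 -> 'rV[R]_n -> R) x :
  mpoly m R := \sum_(b : bmultinom m d.+1) f b x *: mpolyX R b.

Lemma param_polyE n d (f : bmultinom m d.+1 -> 'rV[R]_n -> R) x :
  param_poly f x = mevalrV (mpoly_param f x).
Proof.
apply/funext => z; rewrite /mpoly_param mevalrV_sum; apply: eq_bigr => b _.
by rewrite mevalrVZ; congr (_ * _); rewrite /mevalrV mevalX.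
Qed.

Definition mdeg_le k p := (msize p <= k.+1)%N.

Lemma mdeg_leC k c : mdeg_le k (mpolyC m c).
Proof. by rewrite /mdeg_le msizeC; case: eqP. Qed.

Lemma mdeg_le1 k : mdeg_le k 1.
Proof. exact: mdeg_leC. Qed.

Lemma mdeg_leW k l p : (k <= l)%N -> mdeg_le k p -> mdeg_le l p.
Proof. by move=> kl /leq_trans; apply. Qed.

Lemma mdeg_leD k p q : mdeg_le k p -> mdeg_le k q -> mdeg_le k (p + q).
Proof.
rewrite /mdeg_le => pk qk; apply: leq_trans (msizeD_le _ _) _.
by rewrite geq_max pk.
Qed.

Lemma mdeg_leB k p q : mdeg_le k p -> mdeg_le k q -> mdeg_le k (p - q).
Proof. by move=> pk qk; apply: mdeg_leD => //; rewrite /mdeg_le msizeN. Qed.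

Lemma mdeg_leZ k c p : mdeg_le k p -> mdeg_le k (c *: p).
Proof. exact/leq_trans/msizeZ_le. Qed.

Lemma mdeg_leM k l p q : mdeg_le k p -> mdeg_le l q -> mdeg_le (k + l) (p * q).
Proof.
rewrite /mdeg_le => pk ql.
have [->|p0] := eqVneq p 0; first by rewrite mul0r mmeasure0.
have [->|q0] := eqVneq q 0; first by rewrite mulr0 mmeasure0.
rewrite msizeM//; have := leq_add pk ql; rewrite addSn addnS.
by case: (_ + _)%N.
Qed.

Lemma mdeg_leXn k j p : mdeg_le k p -> mdeg_le (k * j) (p ^+ j).
Proof.
move=> pk; elim: j => [|j IH]; first exact: mdeg_leC.
by rewrite exprS mulnS; exact: mdeg_leM.
Qed.

Lemma mdeg_leX i : mdeg_le 1 (mpolyX R (mnm1 i)).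
Proof. by rewrite /mdeg_le msizeX mdeg1. Qed.

Lemma mdeg_le_sum k I (r : seq I) (P : pred I) (F : I -> mpoly m R) :
  (forall i, P i -> mdeg_le k (F i)) -> mdeg_le k (\sum_(i <- r | P i) F i).
Proof.
move=> Fk; elim/big_rec : _ => [|i p Pi]; first by rewrite /mdeg_le mmeasure0.
exact/mdeg_leD/Fk.
Qed.

Lemma mdeg_le_prod I (r : seq I) (P : pred I) (k : I -> nat)
    (F : I -> mpoly m R) : (forall i, P i -> mdeg_le (k i) (F i)) ->
  mdeg_le (\sum_(i <- r | P i) k i) (\prod_(i <- r | P i) F i).
Proof.
move=> Fk; elim/big_rec2 : _ => [|i p n Pi]; first exact: mdeg_le1.
exact/mdeg_leM/Fk.
Qed.

Lemma sos_sqr r p : mdeg_le r p -> sos r (p ^+ 2).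
Proof.
move=> pr; split; first by exists [:: p]; rewrite big_seq1.
by have := mdeg_leXn 2 pr; rewrite /mdeg_le mulnC.
Qed.

Lemma sos_ge0 r p z : sos r p -> 0 <= mevalrV p z.
Proof.
move=> [[s ->] _]; rewrite mevalrV_sum; apply: sumr_ge0 => q _.
by rewrite mevalrVXn sqr_ge0.
Qed.

Lemma sosZ r c p : 0 <= c -> sos r p -> sos r (c *: p).
Proof.
move=> c0 [[s ->] sr]; split; last exact: leq_trans (msizeZ_le _ _) sr.
exists [seq Num.sqrt c *: q | q <- s]; rewrite big_map scaler_sumr.
by apply: eq_bigr => q _; rewrite exprZn sqr_sqrtr.
Qed.

Lemma sosW r s p : (r <= s)%N -> sos r p -> sos s p.
Proof.
by move=> rs [? pr]; split => //; apply: leq_trans pr _; rewrite ltnS leq_mul2l.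
Qed.

Lemma sosD r p q : sos r p -> sos r q -> sos r (p + q).
Proof.
move=> [[s ->] pr] [[t ->] qr]; split; last exact: mdeg_leD.
by exists (s ++ t); rewrite big_cat.
Qed.

Lemma sos1 r : sos r (1 : mpoly m R).
Proof. by rewrite -[1](expr1n _ 2); apply: sos_sqr; exact: mdeg_leC. Qed.

End polynomial_functions.

(** * Bounding the gap from above by one weight and from below by all of them *)

Section sos_bounds.
Context {R : realType} {m : nat}.
Variables (K : set 'rV[R]_m)
  (mu : {finite_measure set (borelrV R m) -> \bar R}).
Implicit Types p q h : mpoly m R.

Definition mpoly_integrable :=
  forall p, mu.-integrable (K : set (borelrV R m)) (EFin \o mevalrV p).

Definition mint p : R := \int[mu]_(z in (K : set (borelrV R m))) mevalrV p z.

Hypothesis mK : measurable (K : set (borelrV R m)).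
Hypothesis intK : mpoly_integrable.

Lemma mintD p q : mint (p + q) = mint p + mint q.
Proof.
rewrite /mint -RintegralD//.
by apply: eq_Rintegral => z _; rewrite mevalrVD.
Qed.

Lemma mintZ c p : mint (c *: p) = c * mint p.
Proof.
rewrite /mint -RintegralZl//.
by apply: eq_Rintegral => z _; rewrite mevalrVZ.
Qed.

Lemma mint0 : mint 0 = 0.
Proof. by rewrite -(scale0r 0) mintZ mul0r. Qed.

Lemma mintB p q : mint (p - q) = mint p - mint q.
Proof. by rewrite mintD -scaleN1r mintZ mulN1r. Qed.

Lemma mint_sum I (r : seq I) (P : pred I) (F : I -> mpoly m R) :
  mint (\sum_(i <- r | P i) F i) = \sum_(i <- r | P i) mint (F i).
Proof.
by elim/big_rec2 : _ => [|i p q _ <-]; rewrite ?mint0// mintD.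
Qed.

Lemma mint_ge0 p : (forall z, K z -> 0 <= mevalrV p z) -> 0 <= mint p.
Proof. by move=> p0; apply: Rintegral_ge0 => z; exact: p0. Qed.

Lemma ler_mint p q : (forall z, K z -> mevalrV p z <= mevalrV q z) ->
  mint p <= mint q.
Proof. by move=> pq; apply: le_Rintegral => // z; exact: pq. Qed.

Lemma integral_mevalrV p :
  (\int[mu]_(z in (K : set (borelrV R m))) (mevalrV p z)%:E = (mint p)%:E)%E.
Proof. by rewrite /mint /Rintegral fineK//; apply: integrable_fin_num => //; exact: intK. Qed.

Lemma integral_mul_mevalrV p h :
  (\int[mu]_(z in (K : set (borelrV R m))) (mevalrV p z * mevalrV h z)%:E
   = (mint (p * h))%:E)%E.
Proof.
by rewrite -integral_mevalrV; apply: eq_integral => z _; rewrite mevalrVM.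
Qed.

(** Dividing by the integral turns [h] into an admissible weight, so weights never have to be
    normalised later. *)
Lemma sos_bound_ge p r h : sos r h -> 0 < mint h ->
  ((mint (p * h) / mint h)%:E <= sos_bound K mu (mevalrV p) r)%E.
Proof.
move=> hr h0; apply: ereal_sup_ubound; exists ((mint h)^-1 *: h) => /=.
  split; first by apply: sosZ => //; rewrite invr_ge0 ltW.
  by rewrite integral_mevalrV mintZ mulVf// gt_eqF.
by rewrite integral_mul_mevalrV -scalerAr mintZ mulrC.
Qed.

Lemma sos_bound_le p M r : (forall z, K z -> mevalrV p z <= M) ->
  (sos_bound K mu (mevalrV p) r <= M%:E)%E.
Proof.
move=> pM; apply: ge_ereal_sup => _ [h [hr /= h1] <-].
move: h1; rewrite integral_mevalrV => -[h1].
rewrite integral_mul_mevalrV lee_fin -[leRHS]mulr1 -h1 -mintZ.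
apply: ler_mint => z Kz; rewrite mevalrVM mevalrVZ.
by rewrite ler_wpM2r ?pM//; exact: sos_ge0 hr.
Qed.

Lemma sos_bound_nondecreasing p :
  {homo sos_bound K mu (mevalrV p) : r s / (r <= s)%N >-> (r <= s)%E}.
Proof.
move=> r s rs; apply: le_ereal_sup => _ [h [hr h1] <-]; exists h => //.
by split => //; exact: sosW hr.
Qed.

Hypothesis mint1_gt0 : 0 < mint 1.

(** The constant weight 1 bounds the supremum from below. Hence [fine] in [gap] discards nothing,
    for any [r]. *)
Lemma sos_bound_fin_num p M r : (forall z, K z -> mevalrV p z <= M) ->
  sos_bound K mu (mevalrV p) r \is a fin_num.
Proof.
move=> pM; apply/fin_real; rewrite (le_lt_trans (sos_bound_le _ pM)) ?ltry//.
by rewrite andbT (lt_le_trans _ (sos_bound_ge p (sos1 r) mint1_gt0)) ?ltNyr.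
Qed.

Lemma gap_ge0 p M r : (forall z, K z -> mevalrV p z <= M) ->
  0 <= gap K mu (mevalrV p) M r.
Proof.
move=> pM; rewrite /gap fine_ge0// suber_ge0 ?sos_bound_le//.
exact: sos_bound_fin_num pM.
Qed.

Lemma gap_le p M r h e : (forall z, K z -> mevalrV p z <= M) ->
  sos r h -> 0 < mint h -> mint ((mpolyC m M - p) * h) <= e * mint h ->
  gap K mu (mevalrV p) M r <= e.
Proof.
move=> pM hr h0; rewrite mulrBl mintB mul_mpolyC mintZ => hM.
have fin := sos_bound_fin_num r pM.
rewrite /gap fineB//= lerBlDr -lerBlDl -lee_fin fineK//.
apply: le_trans (sos_bound_ge p hr h0).
by rewrite lee_fin ler_pdivlMr// mulrBl; lra.
Qed.

Lemma gap_ge p M r e : (forall z, K z -> mevalrV p z <= M) ->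
  (forall h, sos r h -> e * mint h <= mint ((mpolyC m M - p) * h)) ->
  e <= gap K mu (mevalrV p) M r.
Proof.
move=> pM H; have fin := sos_bound_fin_num r pM.
rewrite /gap fineB//= lerBrDr -lerBrDl -lee_fin fineK//.
apply: ge_ereal_sup => _ [h [hr /= h1] <-].
move: h1; rewrite integral_mevalrV integral_mul_mevalrV => -[h1].
have := H h hr; rewrite mulrBl mintB mul_mpolyC mintZ h1 !mulr1.
by rewrite lee_fin => ?; lra.
Qed.

End sos_bounds.

(** * Changes of variables and product integrals on row vectors *)

Section lebesgue_integration.
Context {R : realType}.
Local Open Scope ereal_scope.
Local Notation leb := (@lebesgue_measure R).

Lemma consrVl m (p : R * 'rV[R]_m) (k : 'I_1) : consrV p 0%R (lshift m k) = p.1.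
Proof. by rewrite /consrV (@row_mxEl _ 1 1 m) mxE. Qed.

Lemma consrVr m (p : R * 'rV[R]_m) k : consrV p 0%R (rshift 1 k) = p.2 0%R k.
Proof. by rewrite /consrV (@row_mxEr _ 1 1 m). Qed.

Lemma ge0_integral_lebesgue_rVS m (G : borelrV R m.+1 -> \bar R) :
  measurable_fun setT G -> (forall z, 0 <= G z) ->
  \int[lebesgue_rV m.+1]_z G z =
  \int[leb]_t \int[lebesgue_rV m]_v G (consrV (t, v)).
Proof.
move=> mG G0.
rewrite [LHS](_ : _ = \int[pushforward (leb \x lebesgue_rV m)
  (@consrV R m : measurableTypeR R * borelrV R m -> borelrV R m.+1)]_z G z)//.
rewrite ge0_integral_pushforward//=; last exact: measurable_consrV.
rewrite preimage_setT fubini_tonelli1//.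
exact: (measurableT_comp mG (@measurable_consrV R m)).
Qed.

Let affine (c b : R) : measurableTypeR R -> measurableTypeR R :=
  fun t => (c * t + b)%R.

Let measurable_affine c b : measurable_fun setT (affine c b).
Proof.
by apply: measurable_funD => //; apply: measurable_funM.
Qed.

(** Both sides are measures in [A], so by uniqueness of Lebesgue measure it is enough to compare
    them on half-open intervals. *)
Lemma lebesgue_measure_affine (c b : R) (A : set (measurableTypeR R)) :
  (0 < c)%R -> measurable A ->
  leb A = c%:E * leb ((fun t => (c * t + b)%R) @^-1` A).
Proof.
move=> c0 mA; have c0' := ltW c0.
pose nu := mscale (NngNum c0') (pushforward leb (affine c b)).
pose mp := measure_function_pushforward__canonical__measure_function_Measure
  leb (measurable_affine c b).
pose mnu := mscale (NngNum c0') mp.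
rewrite [RHS](_ : _ = mnu A)//.
apply: lebesgue_measure_unique => // _ [[x y]] _ <-.
rewrite [RHS](_ : _ = c%:E * leb (affine c b @^-1` `]x, y]%classic))//.
rewrite (_ : _ @^-1` _ = `](x - b) / c, (y - b) / c]%classic)%R; last first.
  apply/seteqP; split => t /=; rewrite /affine !in_itv/= => /andP[].
    by rewrite ltr_pdivrMr// ler_pdivlMr// ltrBlDr lerBrDr mulrC => -> ->.
  by rewrite ltr_pdivrMr// ler_pdivlMr// ltrBlDr lerBrDr mulrC => -> ->.
rewrite !lebesgue_measure_itv/= !lte_fin ltr_pM2r ?invr_gt0// ltrD2r.
case: ifPn => _; last by rewrite mule0.
rewrite -!EFinB -EFinM; congr EFin; field.
exact: lt0r_neq0.
Qed.

Lemma ge0_integral_affine (c b : R) (G : measurableTypeR R -> \bar R) :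
  (0 < c)%R -> measurable_fun setT G -> (forall t, 0 <= G t) ->
  \int[leb]_t G t = c%:E * \int[leb]_t G (c * t + b)%R.
Proof.
move=> c0 mG G0; have c0' := ltW c0.
pose mp := measure_function_pushforward__canonical__measure_function_Measure
  leb (measurable_affine c b).
transitivity (\int[mscale (NngNum c0') mp]_t G t).
  apply: eq_measure_integral => A mA _.
  exact: (lebesgue_measure_affine b c0 mA).
rewrite ge0_integral_mscale//=; congr (_ * _).
rewrite [LHS](_ : _ = \int[pushforward leb (affine c b)]_t G t)//.
by rewrite ge0_integral_pushforward.
Qed.

Lemma measurable_rV_affine m (c : R) (b : 'rV[R]_m) :
  measurable_fun setT (fun z : borelrV R m =>
    (c *: (z : 'rV[R]_m) + b)%R : borelrV R m).
Proof.
apply: measurable_fun_borelrV => i; under eq_fun do rewrite !mxE.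
apply: measurable_funD => //; apply: measurable_funM => //.
by apply: measurable_fun_rV_continuous => z; exact: coord_continuous.
Qed.

(** Induction on the dimension by Tonelli, one factor [c] per coordinate; in dimension 0 the measure
    is a Dirac mass on a single point. With [c = 2^-1] this gives the factor 2^m of the convex
    case. *)
Lemma ge0_integral_rV_affine m (c : R) (b : 'rV[R]_m)
    (G : borelrV R m -> \bar R) :
  (0 < c)%R -> measurable_fun setT G -> (forall z, 0 <= G z) ->
  \int[lebesgue_rV m]_z G z =
  (c ^+ m)%:E * \int[lebesgue_rV m]_z G (c *: (z : 'rV[R]_m) + b)%R.
Proof.
move=> c0; elim: m b G => [|m IH] b G mG G0.
  have mGb := measurableT_comp mG (measurable_rV_affine c b).
  rewrite expr0 mul1e /= !integral_dirac//=.
  by congr (_ * G _); apply/rowP; case.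
have mGb := measurableT_comp mG (measurable_rV_affine c b).
rewrite !ge0_integral_lebesgue_rVS//.
set F := fun t => \int[lebesgue_rV m]_v G (consrV (t, v)).
have mGc := measurableT_comp mG (@measurable_consrV R m).
have mF : measurable_fun setT (F : measurableTypeR R -> _).
  exact: (measurable_fun_fubini_tonelli_F _ mGc (fun x => G0 _)).
rewrite (ge0_integral_affine (b 0%R 0%R) c0 mF) => [|t]; last first.
  exact: integral_ge0.
rewrite exprS EFinM -muleA; congr (_ * _); rewrite -ge0_integralZl//=.
- apply: eq_integral => t _; rewrite /F (IH (rsubmx (b : 'rV_(1 + m)))%R)//.
  + congr (_ * _); apply: eq_integral => v _; congr G.
    apply/rowP => j; rewrite [RHS]mxE [X in (_ = X + _)%R]mxE.
    case: (@split_ordP 1 m j) => k ->.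
      rewrite !consrVl/=; congr (_ + b _ _)%R.
      by apply/val_inj; rewrite /= ord1.
    by rewrite !consrVr/= !mxE.
  + exact: (measurableT_comp mGc (pair1_measurable _)).
- exact: (measurable_fun_fubini_tonelli_F _
    (measurableT_comp mGb (@measurable_consrV R m)) (fun x => G0 _)).
- by move=> t _; apply: integral_ge0.
- by rewrite lee_fin exprn_ge0// ltW.
Qed.

End lebesgue_integration.

Section product_integrals.
Context {R : realType}.
Local Open Scope ereal_scope.
Local Notation leb := (@lebesgue_measure R).

Lemma measurable_coord_rV m (i : 'I_m) (g : measurableTypeR R -> R) :
  measurable_fun setT g ->
  measurable_fun setT (fun z : borelrV R m => g ((z : 'rV[R]_m) 0%R i)).
Proof.
move=> mg; apply: (measurableT_comp mg).
by apply: measurable_fun_rV_continuous => z; exact: coord_continuous.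
Qed.

Lemma measurable_prod_coord_rV m (g : 'I_m -> measurableTypeR R -> R) :
  (forall i, measurable_fun setT (g i)) ->
  measurable_fun setT
    (fun z : borelrV R m => \prod_i g i ((z : 'rV[R]_m) 0%R i))%R.
Proof.
move=> mg; apply: measurable_prod => i _.
exact: measurable_coord_rV.
Qed.

Lemma prod_coord_consrV m (g : 'I_m.+1 -> R -> R) (t : R) (v : 'rV[R]_m) :
  (\prod_i g i ((consrV (t, v) : 'rV[R]_m.+1) 0 i) =
   g ord0 t * \prod_i g (lift ord0 i) (v 0 i))%R.
Proof.
rewrite big_ord_recl; congr (g _ _ * _)%R.
  rewrite (_ : ord0 = lshift m (0 : 'I_1)%R); last exact/val_inj.
  exact: consrVl.
apply: eq_bigr => i _; congr (g _ _).
rewrite (_ : lift ord0 i = rshift 1 i); last exact/val_inj.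
exact: consrVr.
Qed.

Lemma ge0_integral_prod_rV m (g : 'I_m -> measurableTypeR R -> R) :
  (forall i, measurable_fun setT (g i)) -> (forall i t, (0 <= g i t)%R) ->
  \int[lebesgue_rV m]_z (\prod_i g i ((z : 'rV[R]_m) 0 i))%:E =
  \prod_i \int[leb]_t (g i t)%:E.
Proof.
elim: m g => [|m IH] g mg g0.
  rewrite /= integral_dirac//= ?big_ord0; last first.
    by apply/measurable_EFinP; exact: (measurable_prod_coord_rV mg).
  by rewrite diracT mul1e.
have mG := measurable_prod_coord_rV mg.
rewrite ge0_integral_lebesgue_rVS; [|exact/measurable_EFinP|]; last first.
  by move=> z; rewrite lee_fin prodr_ge0.
rewrite big_ord_recl -IH//; set I := \int[lebesgue_rV m]_z _.
have I0 : 0 <= I by apply: integral_ge0 => z _; rewrite lee_fin prodr_ge0.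
rewrite -ge0_integralZr//=; [|exact/measurable_EFinP|]; last first.
  by move=> t _; rewrite lee_fin.
apply: eq_integral => t _; rewrite -ge0_integralZl_EFin//=.
- by apply: eq_integral => v _; rewrite prod_coord_consrV EFinM.
- by move=> z _; rewrite lee_fin prodr_ge0.
- apply/measurable_EFinP.
  exact: (measurable_prod_coord_rV (fun i => mg (lift ord0 i))).
Qed.

Lemma integrable_prod_rV m (g : 'I_m -> measurableTypeR R -> R) :
  (forall i, leb.-integrable setT (EFin \o g i)) ->
  (lebesgue_rV m).-integrable setT
    (fun z : borelrV R m => (\prod_i g i ((z : 'rV[R]_m) 0 i))%:E).
Proof.
move=> ig; have mg i : measurable_fun setT (g i).
  by apply/measurable_EFinP; case/integrableP: (ig i).
apply/integrableP; split.
  by apply/measurable_EFinP; exact: (measurable_prod_coord_rV mg).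
under eq_integral do rewrite abse_EFin normr_prod.
rewrite (ge0_integral_prod_rV (g := fun i t => `|g i t|%R))//; last first.
  by move=> i; exact: measurableT_comp.
rewrite ltey_eq; apply/orP; left.
elim/big_ind : _ => //= [x y|i _]; first exact: fin_numM.
have /integrableP[_ h] := ig i.
by rewrite ge0_fin_numE ?integral_ge0//.
Qed.

(** The signed version, through Fubini, is needed because odd powers change sign under the Chebyshev
    weight. *)
Lemma integral_prod_rV m (g : 'I_m -> measurableTypeR R -> R) :
  (forall i, leb.-integrable setT (EFin \o g i)) ->
  \int[lebesgue_rV m]_z (\prod_i g i ((z : 'rV[R]_m) 0 i))%:E =
  (\prod_i \int[leb]_t g i t)%R%:E.
Proof.
elim: m g => [|m IH] g ig.
  rewrite /= integral_dirac//= ?big_ord0; last first.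
    by apply/measurable_EFinP; apply: measurable_prod_coord_rV; case.
  by rewrite diracT mul1e.
have mg i : measurable_fun setT (g i).
  by apply/measurable_EFinP; case/integrableP: (ig i).
have iG := integrable_prod_rV ig.
rewrite [LHS](_ : _ = \int[pushforward (leb \x lebesgue_rV m)
  (@consrV R m : measurableTypeR R * borelrV R m -> borelrV R m.+1)]_z
    (\prod_i g i ((z : 'rV[R]_m.+1) 0 i))%:E)//.
have mG : measurable_fun setT (EFin \o
    fun z : borelrV R m.+1 => \prod_i g i ((z : 'rV[R]_m.+1) 0 i))%R.
  by apply/measurable_EFinP; exact: (measurable_prod_coord_rV mg).
have iGc : (leb \x lebesgue_rV m).-integrable setT
    ((EFin \o fun z : borelrV R m.+1 =>
       \prod_i g i ((z : 'rV[R]_m.+1) 0 i)) \o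
    (@consrV R m : measurableTypeR R * borelrV R m -> borelrV R m.+1))%R.
  have /integrableP[_ lty] := iG; apply/integrableP; split.
    exact: (measurableT_comp mG (@measurable_consrV R m)).
  move: lty.
  rewrite [X in X < _](_ : _ = \int[pushforward (leb \x lebesgue_rV m)
    (@consrV R m : measurableTypeR R * borelrV R m -> borelrV R m.+1)]_z
      `|(\prod_i g i ((z : 'rV[R]_m.+1) 0 i))%:E|)//.
  rewrite ge0_integral_pushforward//=; first exact: measurable_consrV.
  apply/measurable_EFinP; apply: measurableT_comp => //.
  exact/measurable_EFinP.
rewrite integral_pushforward//=; last exact: measurable_consrV.
rewrite preimage_setT -integral12_prod_meas1//= /fubini_F/=.
rewrite big_ord_recl EFinM.
have ig' i : leb.-integrable setT (EFin \o g (lift ord0 i)) by exact: ig.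
transitivity (\int[leb]_t ((g ord0 t)%:E *
    (\prod_i \int[leb]_t g (lift ord0 i) t)%R%:E)).
  apply: eq_integral => t _; rewrite -IH//.
  under eq_integral do rewrite prod_coord_consrV EFinM.
  by rewrite integralZl//; exact: (integrable_prod_rV ig').
rewrite integralZr//; last exact: ig.
by rewrite /Rintegral fineK//; apply: integrable_fin_num => //; exact: ig.
Qed.

End product_integrals.

(** * Gauss-Chebyshev quadrature *)

Section chebyshev_weight.
Context {R : realType}.
Local Notation leb := (@lebesgue_measure R).

Definition chebw (t : R) : R := (Num.sqrt (1 - t ^+ 2))^-1.

Lemma chebw_ge0 t : 0 <= chebw t.
Proof. by rewrite invr_ge0 sqrtr_ge0. Qed.

(** Cutoff angles: the weight is singular at -1 and 1, so integrals are first taken over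
    [- cos (e n), cos (e n)], that is, over angles in [e n, pi - e n]. *)
Let e (n : nat) : R := n.+1%:R^-1.

Let e_gt0 n : 0 < e n. Proof. by rewrite invr_gt0. Qed.

Let e_le1 n : e n <= 1. Proof. by rewrite invf_le1// ler1n. Qed.

Let e_ltpi n : e n < pi.
Proof. by apply: le_lt_trans (e_le1 n) (lt_le_trans _ (pi_ge2 R)); lra. Qed.

Let e_itv n : e n \in `[0, pi].
Proof. by rewrite in_itv/= (ltW (e_gt0 n)) ltW. Qed.

Let cos_e_lt1 n : cos (e n) < 1.
Proof. by rewrite -[ltRHS]cos0 ltr_cos ?e_itv// in_itv/= lexx pi_ge0. Qed.

Let cos_e_gt0 n : 0 < cos (e n).
Proof.
have := e_le1 n; rewrite le_eqVlt => /predU1P[->|en]; first exact: cos1_gt0.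
apply: cos_gt0_pihalf; rewrite (lt_le_trans en (pihalf_ge1 R)) andbT.
by apply: lt_trans (e_gt0 n); rewrite oppr_lt0 divr_gt0 ?pi_gt0.
Qed.

Let cvg_e : e n @[n --> \oo] --> (0 : R).
Proof. exact: cvg_harmonic. Qed.

Let nd_e n1 n2 : (n1 <= n2)%N -> cos (e n1) <= cos (e n2).
Proof.
move=> n12; have : e n2 <= e n1 by rewrite lef_pV2 ?posrE// ler_nat ltnS.
rewrite le_eqVlt => /predU1P[->//|?]; apply: ltW.
by rewrite ltr_cos ?e_itv.
Qed.

Let itv_oo_cos_bigcup :
  `]-1, 1[%classic = \bigcup_n `[- cos (e n), cos (e n)]%classic.
Proof.
apply/seteqP; split => [t|t [n _]]; rewrite /= !in_itv/=; last first.
  move=> /andP[a b]; rewrite (le_lt_trans b (cos_e_lt1 n)) andbT.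
  by apply: lt_le_trans a; rewrite ltrN2.
rewrite -ltr_norml => t1.
have : cos (e n) @[n --> \oo] --> cos 0.
  by apply: continuous_cvg; [exact: continuous_cos|exact: cvg_e].
rewrite cos0 => /cvgr_gt/(_ _ t1)[n _ /(_ n (leqnn n)) /= nt].
by exists n => //=; rewrite in_itv/= -ler_norml ltW.
Qed.

Lemma continuous_acos_chebw (g : R -> R) (t : R) : continuous g ->
  -1 < t < 1 -> {for t, continuous (fun t => g (acos t) * chebw t)}.
Proof.
move=> cg t1; apply: continuousM.
  apply: (@continuous_comp _ _ _ (@acos R) g); last exact: cg.
  exact: continuous_acos.
have w0 : 0 < 1 - t ^+ 2.
  by rewrite subr_gt0 -real_normK ?num_real// exprn_ilt1// ltr_norml.
rewrite /chebw; apply: cvgV; first by rewrite gt_eqF// sqrtr_gt0.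
apply: (@continuous_comp _ _ _ (fun t : R => 1 - t ^+ 2) Num.sqrt).
  by apply: continuousB; [exact: cst_continuous|exact: exprn_continuous].
exact: sqrt_continuous.
Qed.

(** The substitution t = cos x: on ]-1, 1[ the function - G (acos t) is a primitive of the
    integrand. The fundamental theorem applies on the cutoff intervals, and monotone convergence,
    for which [g] must be nonnegative, removes the cutoff. *)
Lemma ge0_integral_acos_chebw (g G : R -> R) : continuous g ->
  (forall x, 0 <= g x) -> (forall x : R, is_derive x 1 G (g x)) ->
  (\int[leb]_(t in `](-1)%R, 1%R[) (g (acos t) * chebw t)%:E = (G pi - G 0)%:E)%E.
Proof.
move=> cg g0 dG.
have in1 n (t : R) : - cos (e n) <= t <= cos (e n) -> -1 < t < 1.
  move=> /andP[a b]; rewrite (le_lt_trans b (cos_e_lt1 n)) andbT.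
  by apply: lt_le_trans a; rewrite ltrN2.
have cG : continuous G.
  by move=> x; apply/differentiable_continuous/derivable1_diffP.
have FTC n : (\int[leb]_(t in `[(- cos (e n))%R, cos (e n)])
    (g (acos t) * chebw t)%:E = (G (pi - e n) - G (e n))%:E)%E.
  have dF (t : R) : -1 < t < 1 ->
      is_derive t 1 (fun t => - G (acos t)) (g (acos t) * chebw t).
    move=> t1; have da := is_derive1_acos t1.
    apply: is_derive_eq; rewrite /chebw; lra.
  have cF (t : R) : -1 < t < 1 -> {for t, continuous (fun t => - G (acos t))}.
    by move=> /dF ?; apply/differentiable_continuous/derivable1_diffP.
  rewrite (@continuous_FTC2 _ _ (fun t => - G (acos t))).
  - rewrite acosN; last by rewrite cos_geN1 cos_le1.
    by rewrite cosK// -EFinB; congr EFin; lra.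
  - by rewrite gtrN.
  - apply/continuous_in_subspaceT => t /[!inE]/=; rewrite in_itv/= => tn.
    by apply: continuous_acos_chebw => //; exact: in1 tn.
  - split.
    + move=> t; rewrite in_itv/= => /andP[a b].
      by have := dF t (in1 n t _); rewrite !ltW// => /(_ isT) [].
    + apply/cvg_at_right_filter/cF/(in1 n).
      by rewrite lexx ge0_cp ?ltW.
    + apply/cvg_at_left_filter/cF/(in1 n).
      by rewrite lexx ge0_cp ?ltW.
  - move=> t; rewrite in_itv/= => /andP[a b].
    have := dF t (in1 n t _); rewrite !ltW// => /(_ isT) ?.
    by rewrite derive1E derive_val.
rewrite itv_oo_cos_bigcup.
pose I n : set (measurableTypeR R) := `[(- cos (e n))%R, cos (e n)]%classic.
have mI n : measurable (I n) by exact: measurable_itv.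
have nd : nondecreasing_seq I.
  move=> n1 n2 n12; apply/subsetPset => t; rewrite /I /= !in_itv/=.
  have := nd_e n12 => n12' /andP[a b]; rewrite (le_trans b n12') andbT.
  by apply: le_trans a; rewrite lerN2.
have := @ge0_nondecreasing_set_cvg_integral _ (measurableTypeR R) _ I
  (fun t => (g (acos t) * chebw t)%:E) leb nd mI.
have mf n : measurable_fun (I n)
   (fun t => (g (acos t) * chebw t)%:E).
  apply/measurable_EFinP; apply: (@measurable_funS _ _ _ _ (`]-1, 1[%classic : set (measurableTypeR R))) => //.
    by move=> t /=; rewrite !in_itv/=; exact: in1.
  apply: open_continuous_measurable_fun => // t /[!inE]/=; rewrite in_itv/=.
  exact: continuous_acos_chebw.
move=> /(_ mf) cvI.
apply: (cvg_unique _ (cvI _)) => //.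
  by move=> n t _; rewrite lee_fin mulr_ge0// chebw_ge0.
rewrite (_ : (fun n => _) = fun n => (G (pi - e n) - G (e n))%:E); last first.
  by apply/funext => n; exact: FTC.
apply: cvg_EFin; first exact: nearW.
apply: cvgB; apply: continuous_cvg; [exact: cG| |exact: cG|exact: cvg_e].
by rewrite -[X in _ --> X]subr0; apply: cvgB; [exact: cvg_cst|exact: cvg_e].
Qed.

End chebyshev_weight.

Section gauss_chebyshev.
Context {R : realType}.
Local Notation leb := (@lebesgue_measure R).

(** The zeros of cos (n x) in [0, pi]; their cosines are the roots of the Chebyshev polynomial of
    degree [n]. *)
Definition gctheta (n j : nat) : R := j.*2.+1%:R * (pi / n.*2%:R).

Definition gcnode (n j : nat) : R := cos (gctheta n j).

Lemma cosMcos (x y : R) : cos x * cos y = (cos (x + y) + cos (x - y)) / 2.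
Proof. by rewrite cosD cosB; field. Qed.

(** With b = l pi / 2n, the product 2 sin b cos ((2j+1) b) equals sin ((2j+2) b) - sin (2j b), so
    the sum telescopes to sin (l pi) = 0. The bounds on [l] put b in ]0, pi[, where sin b is
    nonzero. *)
Lemma sum_cos_gctheta n l : (0 < l < n.*2)%N ->
  \sum_(j < n) cos (l%:R * gctheta n j) = 0.
Proof.
move=> /andP[l0 ln]; have n0 : (0 < n.*2)%N by apply: leq_trans ln.
have n20 : (n.*2%:R : R) != 0 by rewrite pnatr_eq0 -lt0n.
pose b : R := l%:R * (pi / n.*2%:R).
have sb : sin b != 0.
  rewrite gt_eqF// sin_gt0_pi// /b mulr_gt0 ?ltr0n ?divr_gt0 ?pi_gt0 ?ltr0n//=.
  by rewrite mulrCA gtr_pMr ?pi_gt0// ltr_pdivrMr ?ltr0n// mul1r ltr_nat.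
apply: (mulfI (mulf_neq0 (_ : 2 != 0 :> R) sb)) => //; rewrite mulr0 mulr_sumr.
pose S (j : nat) : R := sin (j.*2%:R * b).
rewrite (eq_bigr (fun j : 'I_n => S j.+1 - S j)) => [|j _].
  rewrite -(big_mkord predT (fun j => S j.+1 - S j)) telescope_sumr//.
  rewrite /S double0 mul0r sin0 subr0 (_ : _ * b = 0 + pi *+ l); last first.
    by rewrite /b -mulr_natr; field.
  by rewrite (alternatingn (@sinDpi R)) sin0 mulr0.
have -> : l%:R * gctheta n j = j.*2.+1%:R * b by rewrite /gctheta /b mulrCA.
rewrite /S doubleS (_ : j.*2.+2%:R * b = j.*2.+1%:R * b + b); last first.
  by rewrite [in LHS]mulrSr mulrDl mul1r.
rewrite (_ : j.*2%:R * b = j.*2.+1%:R * b - b); last first.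
  by rewrite [in RHS]mulrSr mulrDl mul1r addrK.
by rewrite sinD sinB; ring.
Qed.

Definition chebint (f : R -> R) : R :=
  \int[leb]_(t in `]-1, 1[) (f (acos t) * chebw t).

Lemma integral_chebw :
  (\int[leb]_(t in `](-1)%R, 1%R[) (chebw t)%:E = (pi : R)%:E)%E.
Proof.
have := @ge0_integral_acos_chebw R (cst 1) id (@cst_continuous _ _ _).
rewrite subr0 => <- //; apply: eq_integral => t _.
by rewrite mul1r.
Qed.

Lemma measurable_acos_chebw (f : R -> R) : continuous f ->
  measurable_fun (`]-1, 1[%classic : set (measurableTypeR R))
    (fun t => f (acos t) * chebw t).
Proof.
move=> cf; apply: open_continuous_measurable_fun => // t /[!inE]/=.
by rewrite in_itv/=; exact: continuous_acos_chebw.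
Qed.

Lemma integrable_acos_chebw (f : R -> R) : continuous f ->
  (forall x, `|f x| <= 1) ->
  leb.-integrable `]-1, 1[ (EFin \o fun t => f (acos t) * chebw t).
Proof.
move=> cf f1; apply: (@le_integrable _ _ _ leb _ _ _ (EFin \o chebw)) => //.
- by apply/measurable_EFinP; exact: measurable_acos_chebw.
- move=> t _ /=; rewrite lee_fin normrM (ger0_norm (chebw_ge0 t)).
  by rewrite ler_piMl ?chebw_ge0.
apply/integrableP; split.
  apply/measurable_EFinP.
  have := @measurable_acos_chebw (cst 1) (@cst_continuous _ _ _).
  by apply: eq_measurable_fun => t _; rewrite mul1r.
under eq_integral do rewrite /= ger0_norm ?chebw_ge0//.
by rewrite integral_chebw ltry.
Qed.

Lemma continuous_cosM (c : R) : continuous (fun x : R => cos (c * x)).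
Proof.
move=> x; apply: (@continuous_comp _ _ _ (fun x => c * x) cos).
  by apply: cvgM; [exact: cvg_cst|exact: cvg_id].
exact: continuous_cos.
Qed.

(** A family stable under the product formula for cosines: each power of cos x can be traded for a
    shift of [l], down to pure cosines. *)
Let cosXcos (k l : nat) (x : R) := cos x ^+ k * cos (l%:R * x).

Let continuous_cosXcos k l : continuous (cosXcos k l).
Proof.
move=> x; apply: cvgM; last exact: continuous_cosM.
apply: (@continuous_comp _ _ _ cos (fun x => x ^+ k)).
  exact: continuous_cos.
exact: exprn_continuous.
Qed.

Let cosXcos_le1 k l x : `|cosXcos k l x| <= 1.
Proof.
rewrite normrM normrX mulr_ile1 ?exprn_ge0// ?cos_max//.
by rewrite exprn_ile1// cos_max.
Qed.

Let cosXcosS0 k x : cosXcos k.+1 0 x = cosXcos k 1 x.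
Proof. by rewrite /cosXcos mul0r mul1r cos0 mulr1 exprSr. Qed.

Let cosXcosSS k l x :
  cosXcos k.+1 l.+1 x = 2^-1 * (cosXcos k l.+2 x + cosXcos k l x).
Proof.
rewrite /cosXcos exprSr -mulrA cosMcos.
rewrite (_ : x + _ = l.+2%:R * x); last by rewrite -[l.+2%:R]natr1; ring.
rewrite (_ : x - _ = - (l%:R * x)); last by rewrite -[l.+1%:R]natr1; ring.
by rewrite cosN; field.
Qed.

Let chebint_cosX0 l : chebint (cosXcos 0 l.+1) = 0.
Proof.
(* The 1 makes the integrand nonnegative, as the substitution rule requires; its own integral is
   subtracted at the end. *)
pose g x : R := 1 + cos (l.+1%:R * x).
pose G x : R := x + sin (l.+1%:R * x) / l.+1%:R.
have cg : continuous g.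
  by move=> x; apply: cvgD; [exact: cvg_cst|exact: continuous_cosM].
have g0 x : 0 <= g x by rewrite /g -lerBlDl sub0r cos_geN1.
have dG (x : R) : is_derive x 1 G (g x).
  have l0 : (l.+1%:R : R) != 0 by rewrite pnatr_eq0.
  rewrite /G; apply: is_derive_eq; rewrite /g /GRing.scale/=; field.
  by rewrite nat1r.
have := ge0_integral_acos_chebw cg g0 dG.
rewrite /G mulr0 sin0 mul0r addr0 subr0 mulr_natl.
rewrite -[pi *+ _]add0r (alternatingn (@sinDpi R)) sin0 mulr0 mul0r addr0.
move=> /(congr1 fine) /=.
have I0 := integrable_acos_chebw (@continuous_cosXcos 0 0) (cosXcos_le1 0 0).
have Il := integrable_acos_chebw (@continuous_cosXcos 0 l.+1) (cosXcos_le1 0 l.+1).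
under eq_integral => t _.
  rewrite (_ : _ * _ = cosXcos 0 0 (acos t) * chebw t +
                       cosXcos 0 l.+1 (acos t) * chebw t); last first.
    by rewrite /g /cosXcos !expr0 !mul1r mul0r cos0 mulrDl.
  over.
rewrite -[LHS]/(Rintegral _ _ _) RintegralD//.
under eq_Rintegral do rewrite /cosXcos mul0r cos0 expr0 !mul1r.
rewrite {1}/Rintegral integral_chebw /= -[X in _ + X]/(chebint _).
by move=> /(congr1 (+%R (- pi))); rewrite addKr addNr.
Qed.

Let chebintS0 k : chebint (cosXcos k.+1 0) = chebint (cosXcos k 1).
Proof. by rewrite /chebint; under eq_Rintegral do rewrite cosXcosS0. Qed.

Let chebintSS k l : chebint (cosXcos k.+1 l.+1) =
  2^-1 * (chebint (cosXcos k l.+2) + chebint (cosXcos k l)).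
Proof.
have I2 := integrable_acos_chebw (@continuous_cosXcos k l.+2) (cosXcos_le1 k l.+2).
have I1 := integrable_acos_chebw (@continuous_cosXcos k l) (cosXcos_le1 k l).
rewrite /chebint -RintegralD// -RintegralZl//; last first.
  exact: (integrableD _ I2 I1).
by under eq_Rintegral do rewrite cosXcosSS -mulrA mulrDl.
Qed.

Let gcsum n k l : R := pi / n%:R * \sum_(j < n) cosXcos k l (gctheta n j).

(** Integral and quadrature sum obey the same recurrences in [k], which never increase [k + l]. At
    [k = 0] both give [pi] when [l = 0], and both vanish when 0 < l < 2n. *)
Let chebint_gcsum n k l : (k + l < n.*2)%N ->
  chebint (cosXcos k l) = gcsum n k l.
Proof.
move=> kln; have n0 : n%:R != 0 :> R by case: n kln.
elim: k l kln => [|k IH] [|l] kln.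
- rewrite /chebint; under eq_Rintegral do
    rewrite /cosXcos mul0r cos0 expr0 !mul1r.
  rewrite /Rintegral integral_chebw /= /gcsum.
  under eq_bigr do rewrite /cosXcos mul0r cos0 expr0 !mul1r.
  by rewrite sumr_const card_ord divfK.
- rewrite chebint_cosX0 /gcsum; under eq_bigr do rewrite /cosXcos expr0 mul1r.
  by rewrite sum_cos_gctheta ?mulr0.
- rewrite chebintS0 IH; last by move: kln; rewrite addn0 addn1.
  rewrite /gcsum.
  by under [in RHS]eq_bigr do rewrite cosXcosS0.
- rewrite chebintSS !IH; [|lia|lia].
  rewrite /gcsum -mulrDr mulrCA -big_split mulr_sumr/=; congr (_ * _).
  by apply: eq_bigr => j _; rewrite cosXcosSS.
Qed.

Lemma integral_chebw_exprn n k : (k < n.*2)%N ->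
  \int[leb]_(t in `]-1, 1[) (t ^+ k * chebw t) =
  pi / n%:R * \sum_(j < n) gcnode n j ^+ k.
Proof.
move=> kn; have := @chebint_gcsum n k 0; rewrite addn0 => /(_ kn).
rewrite /chebint /gcsum => H; transitivity (chebint (cosXcos k 0)).
  apply: eq_Rintegral => t /[!inE]/=; rewrite in_itv/= => /andP[a b].
  by rewrite /cosXcos mul0r cos0 mulr1 acosK// in_itv/= !ltW.
rewrite /chebint H; congr (_ * _); apply: eq_bigr => j _.
by rewrite /cosXcos mul0r cos0 mulr1.
Qed.

Lemma integrable_chebw_exprn k :
  leb.-integrable `]-1, 1[ (EFin \o fun t => t ^+ k * chebw t).
Proof.
have := integrable_acos_chebw (@continuous_cosXcos k 0) (cosXcos_le1 k 0).
apply: eq_integrable => // t /[!inE]/=; rewrite in_itv/= => /andP[a b].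
by rewrite /cosXcos mul0r cos0 mulr1 acosK// in_itv/= !ltW.
Qed.

End gauss_chebyshev.

Section bounded_polynomials.
Context {R : realType} {m : nat}.
Implicit Types (K : set 'rV[R]_m) (p : mpoly m R).

Lemma mevalrV_bounded B p : exists C, forall z : 'rV[R]_m,
  (forall i, `|z 0 i| <= B) -> `|mevalrV p z| <= C.
Proof.
exists (\sum_(e <- msupp p) `|mcoeff e p| * \prod_i B ^+ e i) => z zB.
rewrite /mevalrV mevalE (le_trans (ler_norm_sum _ _ _))// ler_sum// => e _.
rewrite normrM ler_wpM2l// normr_prod ler_prod// => i _.
by rewrite normrX exprn_ge0//= lerXn2r// nnegrE// (le_trans _ (zB i)).
Qed.

Lemma compact_coord_bounded K : compact K ->
  exists2 B, 0 < B & forall z, K z -> forall i, `|z 0 i| <= B.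
Proof.
move=> cK; have cB i : exists B, forall z, K z -> `|z 0 i| <= B.
  have : compact ((fun z : 'rV[R]_m => z 0 i) @` K).
    apply: continuous_compact => //; apply: continuous_subspaceT => z.
    exact: coord_continuous.
  move=> /compact_bounded[B [_ KB]]; exists (B + 1) => z Kz.
  by apply: (KB (B + 1)); [rewrite ltrDl|exists z].
have [B KB] := choice cB; exists (1 + \sum_i `|B i|) => [|z Kz i].
  by rewrite ltr_wpDr// sumr_ge0.
rewrite (le_trans (KB i z Kz))// (bigD1 i)//= addrCA.
by rewrite (le_trans (ler_norm _))// lerDl addr_ge0// sumr_ge0.
Qed.

Lemma bounded_mpoly_integrable K (mu : {finite_measure set (borelrV R m) -> \bar R})
    B : measurable (K : set (borelrV R m)) ->
  (forall z, K z -> forall i, `|z 0 i| <= B) -> mpoly_integrable K mu.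
Proof.
move=> mK KB p; apply: measurable_bounded_integrable => //.
- by rewrite -ge0_fin_numE// fin_num_measure.
- exact: measurable_mevalrV.
- have [C pC] := mevalrV_bounded B p.
  exists C; split; first exact: num_real.
  by move=> x Cx z Kz; apply: le_trans (pC _ (KB z Kz)) (ltW Cx).
Qed.

End bounded_polynomials.

Section density.
Context d (T : measurableType d) (R : realType).
Variables (mu : {finite_measure set T -> \bar R})
  (nu : {sigma_finite_measure set T -> \bar R}) (w : T -> \bar R).
Hypothesis mw : measurable_fun setT w.
Hypothesis w0 : forall x, (0 <= w x)%E.
Hypothesis muE : forall A, measurable A -> mu A = (\int[nu]_(x in A) w x)%E.

(** The Radon-Nikodym derivative of [mu] and the density [w] have the same integral over every
    measurable set, hence agree almost everywhere; the change of variables for the former passes to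
    [w], for signed [f] as well. *)
Lemma integral_density (E : set T) (f : T -> \bar R) : measurable E ->
  mu.-integrable E f ->
  (\int[mu]_(x in E) f x = \int[nu]_(x in E) (f x * w x))%E.
Proof.
move=> mE iF.
have numu : mu `<< nu.
  apply/null_content_dominatesP => A mA A0; rewrite muE//.
  apply: null_set_integral => //.
  exact: measurable_funTS.
have iw : nu.-integrable setT w.
  apply/integrableP; split => //; under eq_integral do rewrite gee0_abs//.
  by rewrite -muE// -ge0_fin_numE// fin_num_measure.
rewrite -(Radon_Nikodym_change_of_variables numu)//.
apply: ae_eq_integral => //.
- apply: emeasurable_funM; first exact: measurable_int iF.
  apply: measurable_funTS; apply: measurable_int.
  exact: Radon_Nikodym_integrable.
- apply: emeasurable_funM; first exact: measurable_int iF.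
  exact: measurable_funTS.
- apply: ae_eqe_mul2l; apply: integral_ae_eq => //.
  + by apply: (integrableS measurableT) => //; exact: Radon_Nikodym_integrable.
  + exact: measurable_funTS.
  + by move=> A AE mA; rewrite -Radon_Nikodym_integral//= -muE.
Qed.

End density.

(** * Tensor-product quadrature on the cube *)

Section chebyshev_quadrature.
Context {R : realType} {m : nat}.
Variables (K : set 'rV[R]_m)
  (mu : {finite_measure set (borelrV R m) -> \bar R}).
Hypothesis Kmu : cond_chebyshev K mu.
Local Notation leb := (@lebesgue_measure R).

Lemma chebyshev_coord_bound z : K z -> forall i, `|z 0 i| <= 1.
Proof. by rewrite Kmu.1 => /= zK i; rewrite ler_norml. Qed.

Lemma chebyshev_measurable : measurable (K : set (borelrV R m)).
Proof.
have -> : K = \bigcap_(i in [set: 'I_m])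
    (fun z : borelrV R m => (z : 'rV[R]_m) 0 i) @^-1` `[-1, 1]%classic.
  rewrite Kmu.1; apply/seteqP; split => z /= zK i.
    by move=> _; rewrite /= in_itv/=; exact: zK.
  by have := zK i I; rewrite /= in_itv.
apply: fin_bigcap_measurable => [|i _]; first exact: finite_finset.
rewrite -[X in measurable X]setTI; apply: measurable_fun_rV_continuous => //.
by move=> ?; exact: coord_continuous.
Qed.

Lemma chebyshev_integrable : mpoly_integrable K mu.
Proof.
exact: bounded_mpoly_integrable chebyshev_measurable chebyshev_coord_bound.
Qed.

Let g k : measurableTypeR R -> R :=
  (fun t => t ^+ k * chebw t) \_ (`]-1, 1[%classic : set (measurableTypeR R)).

(** Open and closed interval may be interchanged: at -1 and 1 the weight is [0^-1], which is 0. *)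
Let gE k t : -1 <= t <= 1 -> g k t = t ^+ k * chebw t.
Proof.
rewrite /g patchE; case: ifPn => // + /andP[a b].
rewrite notin_setE/= in_itv/= => /negP; rewrite negb_and -!leNgt => t1.
suff t2 : t ^+ 2 = 1 by rewrite /chebw t2 subrr sqrtr0 invr0 mulr0.
case/orP: t1 => t1.
  by have /eqP-> : t == -1 by [rewrite eq_le t1 a]; rewrite sqrrN expr1n.
by have /eqP-> : t == 1 by [rewrite eq_le b t1]; rewrite expr1n.
Qed.

Let g0 k t : ~ (-1 <= t <= 1) -> g k t = 0.
Proof.
move=> t1; rewrite /g patchE memNset//= in_itv/= => /andP[a b].
by apply: t1; rewrite !ltW.
Qed.

Let integrable_g k : leb.-integrable setT (EFin \o g k).
Proof.
have := @integrable_chebw_exprn R k; rewrite integrable_mkcond//.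
by rewrite restrict_EFin.
Qed.

Lemma mint_chebyshev_X (e : multinom m) : mint K mu (mpolyX R e) =
  \prod_i \int[leb]_(t in `]-1, 1[) (t ^+ e i * chebw t).
Proof.
pose w : borelrV R m -> \bar R :=
  fun z => (\prod_i g 0 ((z : 'rV[R]_m) 0 i))%:E.
have mK := chebyshev_measurable.
have mg k : measurable_fun setT (g k).
  by apply/measurable_EFinP; case/integrableP: (integrable_g k).
have gge0 t : 0 <= g 0 t.
  have [t1|t1] := pselect (-1 <= t <= 1); last by rewrite g0.
  by rewrite gE// mulr_ge0// chebw_ge0.
have mw : measurable_fun setT w.
  by apply/measurable_EFinP; exact: (measurable_prod_coord_rV (fun=> mg 0%N)).
have w0 z : (0 <= w z)%E by rewrite lee_fin prodr_ge0.
have notK (h : 'I_m -> R -> R) (z : 'rV[R]_m) :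
    (forall i t, ~ (-1 <= t <= 1) -> h i t = 0) ->
    ~ K z -> \prod_i h i (z 0 i) = 0.
  move=> h0; rewrite Kmu.1 /= => /existsNP[i zi].
  by rewrite (bigD1 i)//= h0 ?mul0r.
have inK z i : K z -> -1 <= z 0 i <= 1 by rewrite Kmu.1; exact.
have muE A : measurable A -> mu A = (\int[lebesgue_rV m]_(z in A) w z)%E.
  move=> mA; rewrite Kmu.2// integral_mkcondr; apply: eq_integral => z _.
  rewrite patchE /w; have [Kz|Kz] := pselect (K z).
    rewrite mem_set//; congr EFin.
    by apply: eq_bigr => i _; rewrite gE ?mul1r//; exact: inK.
  by rewrite memNset// (notK (fun=> g 0%N))// => i t; exact: g0.
have iK := chebyshev_integrable.
rewrite /mint /Rintegral (integral_density mw w0 muE mK (iK _)) integral_mkcond.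
rewrite (eq_integral (fun z : borelrV R m =>
    (\prod_i g (e i) ((z : 'rV[R]_m) 0 i))%:E)); last first.
  move=> z _; rewrite patchE /w; have [Kz|Kz] := pselect (K z).
    rewrite mem_set// /= /mevalrV mevalX -EFinM -big_split/=; congr EFin.
    by apply: eq_bigr => i _; rewrite !gE ?mul1r//; exact: inK.
  by rewrite memNset// (notK (fun i => g (e i)))// => i t; exact: g0.
rewrite (integral_prod_rV (g := fun i => g (e i)))//=; apply: eq_bigr => i _.
by rewrite [RHS]Rintegral_mkcond.
Qed.

Definition gcpoint n (j : {ffun 'I_m -> 'I_n}) : 'rV[R]_m :=
  \row_i gcnode n (j i).

(** Exactness only constrains the degree in each variable separately; the total degree may be about
    [m] times larger. The upper bound relies on this. *)
Lemma mint_chebyshev n p :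
  (forall e, e \in msupp p -> forall i, (e i < n.*2)%N) ->
  mint K mu p = (pi / n%:R) ^+ m *
    \sum_(j : {ffun 'I_m -> 'I_n}) mevalrV p (gcpoint j).
Proof.
move=> pn; have mK := chebyshev_measurable; have iK := chebyshev_integrable.
rewrite {1}(mpolyE p) mint_sum//.
transitivity (\sum_(e <- msupp p) (pi / n%:R) ^+ m *
    \sum_(j : {ffun 'I_m -> 'I_n})
      mcoeff e p * \prod_i gcpoint j 0 i ^+ e i); last first.
  rewrite -mulr_sumr exchange_big/=; congr (_ * _).
apply: eq_big_seq => e ep; rewrite mintZ// mint_chebyshev_X -mulr_sumr mulrCA.
congr (_ * _).
under eq_bigr => i _ do rewrite (@integral_chebw_exprn _ n) ?pn//.
rewrite big_split/= prodr_const card_ord bigA_distr_bigA/=; congr (_ * _).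
by apply: eq_bigr => j _; apply: eq_bigr => i _; rewrite mxE.
Qed.

End chebyshev_quadrature.

(** * The Chebyshev measure on the cube: both bounds *)

Section cosine_bounds.
Context {R : realType}.
Implicit Types x y : R.

Lemma norm_sin_le x : `|sin x| <= `|x|.
Proof.
wlog x0 : x / 0 <= x => [H|].
  have [/H//|/ltW x0] := leP 0 x.
  by rewrite -normrN -sinN -(normrN x) H// oppr_ge0.
have [c _] : exists2 c, c \in `[0, x] & sin x - sin 0 = cos c * (x - 0).
  apply: MVT_segment => //.
  exact/continuous_subspaceT/continuous_sin.
rewrite sin0 !subr0 => ->; rewrite normrM ler_piMl//.
exact: cos_max.
Qed.

Lemma onem_cosE x : 1 - cos x = 2 * sin (x / 2) ^+ 2.
Proof.
rewrite {1}(_ : x = (x / 2) *+ 2); last by rewrite -mulr_natr divfK.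
by rewrite cos_mulr2n cos2sin2; ring.
Qed.

Lemma onem_cos_le x : 1 - cos x <= x ^+ 2 / 2.
Proof.
rewrite onem_cosE -(real_normK (num_real (sin _))).
apply: le_trans (_ : 2 * `|x / 2| ^+ 2 <= _).
  by rewrite ler_pM2l// lerXn2r ?nnegrE// norm_sin_le.
by rewrite real_normK ?num_real// le_eqVlt; apply/orP; left; apply/eqP; field.
Qed.

Lemma cos_lipschitz x y : `|cos (x + y) - cos x| <= `|y|.
Proof.
have -> : cos (x + y) - cos x = - 2 * (sin (x + y / 2) * sin (y / 2)).
  have -> : cos (x + y) = cos ((x + y / 2) + y / 2) by congr cos; field.
  have -> : cos x = cos ((x + y / 2) - y / 2) by congr cos; field.
  by rewrite cosD cosB; ring.
rewrite normrM normrN normrM (ger0_norm (_ : 0 <= 2))//.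
apply: (@le_trans _ _ (2 * (1 * `|y / 2|))).
  by rewrite ler_pM2l// ler_pM// ?sin_max// norm_sin_le.
by rewrite mul1r normrM (ger0_norm (_ : 0 <= 2^-1))// mulrCA divff// mulr1.
Qed.

Lemma cos_second_difference x y :
  `|cos (x + y) + cos (x - y) - 2 * cos x| <= `|y| ^+ 2.
Proof.
rewrite (_ : _ - _ = - 2 * cos x * (1 - cos y)); last by rewrite cosD cosB; ring.
rewrite real_normK ?num_real// !normrM normrN (ger0_norm (_ : 0 <= 2))//.
rewrite (ger0_norm (_ : 0 <= 1 - cos y)) ?subr_ge0 ?cos_le1//.
apply: (@le_trans _ _ (2 * 1 * (y ^+ 2 / 2))); last first.
  by rewrite mulr1 mulrCA divff// mulr1.
rewrite ler_pM// ?mulr_ge0 ?subr_ge0 ?cos_le1 ?onem_cos_le//.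
by rewrite ler_pM2l// cos_max.
Qed.

Lemma norm_sinMn n x : `|sin (n%:R * x)| <= n%:R * `|sin x|.
Proof.
elim: n => [|n IH]; first by rewrite !mul0r sin0 normr0.
rewrite -natr1 !mulrDl !mul1r sinD (le_trans (ler_normD _ _))// !normrM.
rewrite lerD//; first by rewrite (le_trans _ IH)// ler_piMr// cos_max.
by rewrite ler_piMl// cos_max.
Qed.

Lemma onem_cosMn n x : 1 - cos (n%:R * x) <= n%:R ^+ 2 * (1 - cos x).
Proof.
rewrite !onem_cosE [leRHS]mulrCA ler_pM2l// -mulrA.
rewrite -(real_normK (num_real (sin (_ * _)))) -(real_normK (num_real (sin (x / 2)))).
by rewrite -exprMn lerXn2r ?nnegrE ?mulr_ge0// norm_sinMn.
Qed.

End cosine_bounds.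

(** * Polynomials as functions of the angles *)

Section second_differences.
Context {R : realType} {m : nat}.
Implicit Types (F G : ('I_m -> R) -> R) (u v : 'I_m -> R).

(** A substitute for two bounded derivatives. The three estimates are kept together because the
    second difference of a product involves the values and first differences of both factors. *)
Definition second_difference_bound F := exists2 C, 0 <= C &
  forall u v D, (forall i, `|v i| <= D) -> 0 <= D ->
    [/\ `|F u| <= C,
        `|F (fun i => u i + v i) - F u| <= C * D &
        `|F (fun i => u i + v i) + F (fun i => u i - v i) - 2 * F u|
          <= C * D ^+ 2].

Lemma second_difference_cst c : second_difference_bound (fun=> c).
Proof.
exists `|c| => // u v D _ D0; split => //; first by rewrite subrr normr0 mulr_ge0.
rewrite (_ : _ - _ = 0); last by ring.
by rewrite normr0 mulr_ge0// exprn_ge0.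
Qed.

Lemma second_difference_cos i : second_difference_bound (fun u => cos (u i)).
Proof.
exists 1 => // u v D vD D0; split; first exact: cos_max.
  by rewrite mul1r (le_trans (cos_lipschitz _ _)).
by rewrite mul1r (le_trans (cos_second_difference _ _))// lerXn2r// nnegrE.
Qed.

Lemma second_differenceD F G : second_difference_bound F ->
  second_difference_bound G -> second_difference_bound (fun u => F u + G u).
Proof.
move=> [C C0 FC] [C' C'0 GC]; exists (C + C'); first exact: addr_ge0.
move=> u v D vD D0; have [f1 f2 f3] := FC u v D vD D0.
have [g1 g2 g3] := GC u v D vD D0; split.
- exact: le_trans (ler_normD _ _) (lerD f1 g1).
- rewrite mulrDl opprD addrACA.
  exact: le_trans (ler_normD _ _) (lerD f2 g2).
- rewrite [leRHS]mulrDl (_ : _ - _ =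
    (F (fun i => u i + v i) + F (fun i => u i - v i) - 2 * F u) +
    (G (fun i => u i + v i) + G (fun i => u i - v i) - 2 * G u)).
    exact: le_trans (ler_normD _ _) (lerD f3 g3).
  by ring.
Qed.

(** The constant 4 comes from the second difference: two products of first differences and two terms
    with a second difference, each at most C C' D^2. *)
Lemma second_differenceM F G : second_difference_bound F ->
  second_difference_bound G -> second_difference_bound (fun u => F u * G u).
Proof.
move=> [C C0 FC] [C' C'0 GC]; exists (4 * (C * C')); first by rewrite !mulr_ge0.
move=> u v D vD D0; have [f1 f2 f3] := FC u v D vD D0.
have [g1 g2 g3] := GC u v D vD D0.
have vD' i : `|- v i| <= D by rewrite normrN.
have [_ f4 _] := FC u (fun i => - v i) D vD' D0.
have [g5 g4 _] := GC u (fun i => - v i) D vD' D0.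
have [_ _ _] := GC (fun i => u i + v i) v D vD D0.
have [g6 _ _] := GC (fun i => u i + v i) v D vD D0.
have CC0 : 0 <= C * C' by exact: mulr_ge0.
set a := F u in f1 f2 f3 f4 *; set b := G u in g1 g2 g3 g4 *.
set ap := F (fun i => u i + v i) in f2 f3 *.
set am := F (fun i => u i - v i) in f3 f4 *.
set bp := G (fun i => u i + v i) in g2 g3 g6 *.
set bm := G (fun i => u i - v i) in g3 g4 *.
split.
- by rewrite normrM (le_trans (ler_pM _ _ f1 g1))//; lra.
- rewrite (_ : _ - _ = (ap - a) * bp + a * (bp - b)); last by ring.
  apply: le_trans (ler_normD _ _) _; rewrite !normrM.
  apply: le_trans (lerD (ler_pM _ _ f2 g6) (ler_pM _ _ f1 g2)) _ => //.
  have : 0 <= C * C' * D by exact: mulr_ge0.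
  by lra.
- rewrite (_ : _ - _ = (ap - a) * (bp - b) + (am - a) * (bm - b) +
    (a * (bp + bm - 2 * b) + b * (ap + am - 2 * a))); last by ring.
  have H1 : `|(ap - a) * (bp - b)| <= C * D * (C' * D) by rewrite normrM ler_pM.
  have H2 : `|(am - a) * (bm - b)| <= C * D * (C' * D) by rewrite normrM ler_pM.
  have H3 : `|a * (bp + bm - 2 * b)| <= C * (C' * D ^+ 2).
    by rewrite normrM ler_pM.
  have H4 : `|b * (ap + am - 2 * a)| <= C' * (C * D ^+ 2).
    by rewrite normrM ler_pM.
  apply: le_trans (ler_normD _ _) _.
  apply: le_trans (lerD (ler_normD _ _) (ler_normD _ _)) _.
  apply: le_trans (lerD (lerD H1 H2) (lerD H3 H4)) _.
  by rewrite le_eqVlt; apply/orP; left; apply/eqP; ring.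
Qed.

Lemma second_difference_mevalrV (p : mpoly m R) :
  second_difference_bound (fun u => mevalrV p (\row_i cos (u i))).
Proof.
rewrite (_ : (fun u => _) = fun u => \sum_(e <- msupp p)
    mcoeff e p * \prod_i cos (u i) ^+ e i); last first.
  apply/funext => u; rewrite /mevalrV mevalE; apply: eq_bigr => e _.
  by congr (_ * _); apply: eq_bigr => i _; rewrite mxE.
elim: (msupp p) => [|e s IH].
  by under eq_fun do rewrite big_nil; exact: second_difference_cst.
under eq_fun do rewrite big_cons; apply: second_differenceD => //.
apply: second_differenceM; first exact: second_difference_cst.
elim: (index_enum _) => [|i t IHt].
  by under eq_fun do rewrite big_nil; exact: second_difference_cst.
under eq_fun do rewrite big_cons; apply: second_differenceM => //.
elim: (e i) => [|k IHk].
  by under eq_fun do rewrite expr0; exact: second_difference_cst.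
under eq_fun do rewrite exprS; apply: second_differenceM => //.
exact: second_difference_cos.
Qed.

(* At a maximum of [u |-> p (cos u)] the bound on second differences plays the
   role of a vanishing gradient: F (u + v) >= 2 F u - C D^2 - F (u - v). *)
Lemma cos_max_quadratic (p : mpoly m R) u M : mevalrV p (\row_i cos (u i)) = M ->
  (forall w : 'I_m -> R, mevalrV p (\row_i cos (w i)) <= M) ->
  exists2 C, 0 <= C & forall w D, 0 <= D -> (forall i, `|w i - u i| <= D) ->
    M - mevalrV p (\row_i cos (w i)) <= C * D ^+ 2.
Proof.
move=> uM pM; have [C C0 H] := second_difference_mevalrV p.
exists C => // w D D0 wD.
have [_ _] := H u (fun i => w i - u i) D wD D0.
have -> : \row_i cos (u i + (w i - u i)) = \row_i cos (w i) :> 'rV[R]_m.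
  by apply/rowP => i; rewrite !mxE addrC subrK.
have := pM (fun i => u i - (w i - u i)); rewrite uM.
set x := mevalrV p _; set y := mevalrV p _; rewrite ler_norml => ? /andP[].
by lra.
Qed.

End second_differences.

(** * Degree in a single variable *)

Section variable_degree.
Context {R : realType} {m : nat}.
Implicit Types p q : mpoly m R.

Definition vdeg_le (i : 'I_m) k p := forall e, e \in msupp p -> (e i <= k)%N.

Lemma vdeg_leC i k c : vdeg_le i k (mpolyC m c).
Proof. by move=> e; rewrite msuppC; case: ifP => // _; rewrite inE => /eqP->; rewrite mnm0E. Qed.

Lemma vdeg_leB i k p q : vdeg_le i k p -> vdeg_le i k q -> vdeg_le i k (p - q).
Proof.
move=> pk qk e /msuppB_le; rewrite mem_cat => /orP[/pk//|/qk//].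
Qed.

Lemma vdeg_leM i k l p q : vdeg_le i k p -> vdeg_le i l q ->
  vdeg_le i (k + l) (p * q).
Proof.
move=> pk ql e /msuppM_le/allpairsP[[e1 e2] [/= /pk H1 /ql H2 ->]].
by rewrite mnmDE leq_add.
Qed.

Lemma vdeg_le_prod i I (r : seq I) (P : pred I) (k : I -> nat)
    (F : I -> mpoly m R) :
  (forall j, P j -> vdeg_le i (k j) (F j)) ->
  vdeg_le i (\sum_(j <- r | P j) k j) (\prod_(j <- r | P j) F j).
Proof.
move=> Fk; elim/big_rec2 : _ => [|j p n Pj]; first exact: vdeg_leC.
exact/vdeg_leM/Fk.
Qed.

Lemma mdeg_le_vdeg i k p : mdeg_le k p -> vdeg_le i k p.
Proof.
move=> pk e ep; have := leq_trans (msize_mdeg_lt ep) pk; rewrite ltnS.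
by apply: leq_trans; rewrite mdegE (bigD1 i)//= leq_addr.
Qed.

Lemma vdeg_leX i j : vdeg_le i (i == j) (mpolyX R (mnm1 j)).
Proof.
by move=> e; rewrite msuppX inE => /eqP->; rewrite mnmE eq_sym.
Qed.

End variable_degree.

(** * Location of the quadrature nodes *)

Section gauss_nodes.
Context {R : realType}.

Lemma gctheta_itv n j : (j < n)%N -> gctheta n j \in `[0, pi : R].
Proof.
move=> jn; have n0 : (0 : R) < n.*2%:R by rewrite ltr0n double_gt0 (leq_ltn_trans _ jn).
have pn0 : (0 : R) <= pi / n.*2%:R by rewrite divr_ge0 ?pi_ge0.
rewrite in_itv/= /gctheta mulr_ge0//= mulrCA ler_piMr ?pi_ge0//.
by rewrite ler_pdivrMr// mul1r ler_nat ltn_double.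
Qed.

Lemma gcnode_inj n i j : (i < n)%N -> (j < n)%N ->
  gcnode n i = gcnode n j :> R -> i = j.
Proof.
move=> im jn /cos_inj; rewrite !gctheta_itv// => /(_ isT isT).
have n0 : (n.*2%:R : R) != 0 by rewrite pnatr_eq0 -lt0n double_gt0 (leq_ltn_trans _ jn).
have pin0 : pi / n.*2%:R != 0 :> R by rewrite mulf_neq0 ?invr_eq0// gt_eqF ?pi_gt0.
by move=> /(mulIf pin0)/eqP; rewrite eqr_nat => /eqP [] /double_inj.
Qed.

Lemma near_gctheta n k (x : R) : (0 < k <= n)%N -> 0 <= x <= pi ->
  exists2 s, (s + k <= n)%N & forall j, (s <= j < s + k)%N ->
    `|gctheta n j - x| <= k%:R * (pi / n%:R).
Proof.
move=> /andP[k0 kn] /andP[x0 xpi].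
have n0 : (0 : R) < n%:R by rewrite ltr0n (leq_trans k0).
(* The position of [x] in units of pi / n, in which node [j] sits at j + 1/2. *)
pose a : R := x * n%:R / pi.
have a0 : 0 <= a by rewrite !mulr_ge0// invr_ge0 pi_ge0.
have npi : pi != 0 :> R by rewrite gt_eqF ?pi_gt0.
have nn : n%:R != 0 :> R by rewrite gt_eqF.
have xE : x = a * (pi / n%:R) by rewrite /a mulrA divfK// mulfK.
have P : exists s, a <= (s + k)%:R.
  exists (n - k)%N; rewrite subnK// /a ler_pdivrMr ?pi_gt0// mulrC.
  by rewrite ler_pM2l.
(* By minimality s + k - 1 < a <= s + k unless s = 0; in either case the block of [k] nodes starting
   at [s] stays within [k] units of [a]. *)
case: (ex_minnP P) => s sa smin; exists s => [|j /andP[sj jk]].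
  have : (s <= n - k)%N; last by lia.
  by apply: smin; rewrite subnK// /a ler_pdivrMr ?pi_gt0// mulrC ler_pM2l.
have -> : gctheta n j = (j%:R + 2^-1) * (pi / n%:R) :> R.
  have j2 : (j.*2.+1%:R : R) = 2 * j%:R + 1 by rewrite -addn1 natrD -mul2n natrM.
  have n2 : (n.*2%:R : R) = 2 * n%:R by rewrite -mul2n natrM.
  rewrite /gctheta j2 n2 [_ / (2 * _)](_ : _ = 2^-1 * (pi / n%:R)).
    by rewrite mulrA mulrDl mul1r mulrAC divff// mul1r.
  by rewrite invfM mulrCA.
have pn0 : (0 : R) <= pi / n%:R by rewrite divr_ge0 ?pi_ge0.
rewrite xE -mulrBl normrM (ger0_norm pn0) ler_wpM2r// ler_norml.
have {jk} : (j.+1%:R : R) <= (s + k)%:R by rewrite ler_nat.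
have {sj} : (s%:R : R) <= j%:R by rewrite ler_nat.
move: sa; rewrite natrD -natr1 => sa sj jk.
case: s smin sa sj jk => [|s] smin sa sj jk; first by apply/andP; split; lra.
have : (s + k)%:R < a.
  by rewrite ltNge; apply/negP => /smin; rewrite ltnn.
by rewrite natrD -natr1 in sa sj jk * => ?; apply/andP; split; lra.
Qed.

End gauss_nodes.

(** The largest node has angle y = pi / 2n, and 1 = 1 - cos (n y) <= n^2 (1 - cos y). *)
Lemma onem_gcnode_ge {R : realType} n j : (j < n)%N ->
  (n%:R ^+ 2)^-1 <= 1 - gcnode n j :> R.
Proof.
move=> jn; have n0 : (0 : R) < n%:R by rewrite ltr0n (leq_ltn_trans _ jn).
pose y : R := pi / n.*2%:R.
have n2 : (n.*2%:R : R) = 2 * n%:R by rewrite -mul2n natrM.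
have ny : n%:R * y = pi / 2 by rewrite /y n2 invfM; field; rewrite gt_eqF.
have y0 : 0 < y by rewrite divr_gt0 ?pi_gt0// ltr0n double_gt0 (leq_ltn_trans _ jn).
have := onem_cosMn n y; rewrite ny cos_pihalf subr0 => cn.
have jy : y <= gctheta n j by rewrite /gctheta ler_peMl ?(ltW y0)// ler1n.
have := @gctheta_itv R _ _ jn => tin.
have : cos (gctheta n j) <= cos y.
  move: jy; rewrite le_eqVlt => /predU1P[->//|jy]; apply: ltW.
  rewrite ltr_cos// in_itv/= (ltW y0); move: tin; rewrite in_itv/= => /andP[_].
  by apply: le_trans; exact: ltW.
rewrite /gcnode -[_^-1]mul1r ler_pdivrMr ?exprn_gt0// mulrC => cj.
by apply: le_trans cn _; rewrite ler_pM2l ?exprn_gt0// lerB.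
Qed.

(** * The two bounds on the gap for the Chebyshev measure *)

Section chebyshev_gap.
Context {R : realType} {m : nat}.
Variables (K : set 'rV[R]_m)
  (mu : {finite_measure set (borelrV R m) -> \bar R}).
Hypothesis Kmu : cond_chebyshev K mu.

Lemma chebyshev_cos_in (w : 'I_m -> R) : K (\row_i cos (w i)).
Proof. by rewrite Kmu.1 /= => i; rewrite mxE cos_geN1 cos_le1. Qed.

Lemma mint1_chebyshev_gt0 : 0 < mint K mu 1.
Proof.
rewrite (@mint_chebyshev _ _ _ _ Kmu 1) => [|e]; last first.
  by rewrite msupp1 inE => /eqP-> i; rewrite mnm0E.
under eq_bigr do rewrite mevalrV1.
rewrite sumr_const card_ffun !card_ord exp1n divr1 mulr1.
by rewrite exprn_gt0// pi_gt0.
Qed.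

Lemma mint_chebyshev_vdeg n p : (0 < n)%N ->
  (forall i, vdeg_le i (n.*2).-1 p) ->
  mint K mu p = (pi / n%:R) ^+ m *
    \sum_(j : {ffun 'I_m -> 'I_n}) mevalrV p (gcpoint j).
Proof.
move=> n0 pn; apply: mint_chebyshev => // e ep i.
by have := pn i e ep; case: n n0 {pn}.
Qed.

(** With n = r + 1 nodes per coordinate the quadrature is exact for (1 - z_i0) h, of degree at most
    2r + 1 = 2n - 1, and at every grid point 1 - z_i0 >= 1 / (r+1)^2. The 4 comes from r + 1 <=
    2r. *)
Lemma gap_chebyshev_ge i0 r : (0 < r)%N ->
  (4 * r%:R ^+ 2)^-1 <= gap K mu (mevalrV (mpolyX R (mnm1 i0))) 1 r.
Proof.
move=> r0; apply: (gap_ge (chebyshev_measurable Kmu) (chebyshev_integrable Kmu)).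
- exact: mint1_chebyshev_gt0.
- move=> z Kz; rewrite mevalrVX.
  by have := chebyshev_coord_bound Kmu Kz i0; rewrite ler_norml => /andP[].
move=> h [[s hE] hr]; have hs : sos r h by split => //; exists s.
have pos : 0 <= (pi / r.+1%:R : R) ^+ m by rewrite exprn_ge0// divr_ge0// pi_ge0.
rewrite (@mint_chebyshev_vdeg r.+1)//; last first.
  by move=> i; apply: mdeg_le_vdeg; apply: leq_trans hr _; lia.
rewrite (@mint_chebyshev_vdeg r.+1)//; last first.
  move=> i; apply: mdeg_le_vdeg; rewrite (_ : _.-1 = 1 + 2 * r)%N; last by lia.
  by apply: mdeg_leM => //; apply: mdeg_leB; [exact: mdeg_leC|exact: mdeg_leX].
rewrite mulrCA ler_wpM2l// mulr_sumr ler_sum// => j _.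
rewrite mevalrVM ler_wpM2r ?(sos_ge0 _ hs)// mevalrVB mevalrVC mevalrVX mxE.
apply: le_trans (onem_gcnode_ge (ltn_ord _)).
rewrite lef_pV2 ?posrE ?mulr_gt0 ?exprn_gt0 ?ltr0n//.
by rewrite (_ : 4 = 2 ^+ 2 :> R) -?exprMn ?lerXn2r ?nnegrE ?mulr_ge0// -?natrM ?ler_nat ?expr2 ?mulrn_eq0; [lia|ring].
Qed.

Lemma gap_chebyshev_le d G M a : (0 < m)%N -> mdeg_le d G ->
  (forall z, K z -> mevalrV G z <= M) -> K a -> mevalrV G a = M ->
  exists C, forall r, (m * d.+1 <= r)%N -> (0 < r)%N ->
    gap K mu (mevalrV G) M r <= C * (r%:R ^+ 2)^-1.
Proof.
(* Sparing [k] nodes per coordinate lowers the degree of [h] in each variable to 2 (n - k), which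
   leaves room for the degree [d] of [G] below the exactness bound 2n. *)
move=> m0 Gd GM Ka Ga; pose k := d.+1; pose al i := acos (a 0 i).
have a1 i : -1 <= a 0 i <= 1 by move: Ka; rewrite Kmu.1; exact.
have alE : \row_i cos (al i) = a.
  by apply/rowP => i; rewrite mxE /al acosK// in_itv/= a1.
have [||C C0 HC] := @cos_max_quadratic _ _ G al M.
- by rewrite alE.
- by move=> w; apply: GM; exact: chebyshev_cos_in.
exists (C * (k%:R * (pi * 2 * m%:R)) ^+ 2) => r mr r0.
(* The square root of [h] has [m] factors of degree at most [n], hence total degree at most [r]. *)
pose n := (r %/ m)%N.
have kn : (0 < k <= n)%N by rewrite /= leq_divRL// mulnC.
have n0 : (0 < n)%N by case/andP: kn; exact: leq_trans.
have near i : exists s, (s + k <= n)%N /\ forall j, (s <= j < s + k)%N ->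
    `|gctheta n j - al i| <= k%:R * (pi / n%:R).
  have [|s sk H] := near_gctheta kn (_ : 0 <= al i <= pi).
    by rewrite acos_ge0// acos_lepi.
  by exists s.
have [s sn] := choice near.
pose far i := iota 0 (s i) ++ iota (s i + k) (n - (s i + k)).
pose P i := \prod_(j <- far i) (mpolyX R (mnm1 i) - mpolyC m (gcnode n j)).
pose h : mpoly m R := (\prod_i P i) ^+ 2.
have far_size i : size (far i) = (n - k)%N.
  by rewrite size_cat !size_iota; have := (sn i).1; lia.
have Pdeg i : mdeg_le (n - k) (P i).
  have := @mdeg_le_prod R m _ (far i) predT (fun=> 1%N)
    (fun j => mpolyX R (mnm1 i) - mpolyC m (gcnode n j)).
  rewrite sum1_size far_size; apply => j _.
  by apply: mdeg_leB; [exact: mdeg_leX|exact: mdeg_leC].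
have hr : sos r h.
  apply: sos_sqr; have := @mdeg_le_prod R m _ (index_enum 'I_m) predT _ _
    (fun i _ => Pdeg i).
  apply: mdeg_leW; rewrite sum_nat_const card_ord.
  apply: leq_trans (leq_mul (leqnn m) (leq_subr k n)) _.
  by rewrite mulnC leq_divM.
have Pvdeg i i' : vdeg_le i (if i' == i then n - k else 0)%N (P i').
  have [->|i'i] := eqVneq i' i; first exact: mdeg_le_vdeg.
  have := @vdeg_le_prod R m i _ (far i') predT (fun=> 0%N)
    (fun j => mpolyX R (mnm1 i') - mpolyC m (gcnode n j)).
  rewrite big1_seq//; apply => j _; apply: vdeg_leB; last exact: vdeg_leC.
  by have := @vdeg_leX R m i i'; rewrite eq_sym (negbTE i'i).
have hvdeg i : vdeg_le i ((n - k) + (n - k)) h.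
  have H := @vdeg_le_prod R m i _ (index_enum 'I_m) predT _ _
    (fun i' _ => Pvdeg i i').
  rewrite (bigD1 i)//= eqxx big1 ?addn0 in H; last first.
    by move=> i' /negbTE ->.
  by rewrite /h expr2; exact: vdeg_leM.
have hEval z : mevalrV h z =
    \prod_i \prod_(j <- far i) (z 0 i - gcnode n j) ^+ 2.
  rewrite /h mevalrVXn mevalrV_prod -prodrXl; apply: eq_bigr => i _.
  rewrite mevalrV_prod -prodrXl; apply: eq_bigr => j _.
  by rewrite mevalrVB mevalrVX mevalrVC.
have pos : 0 < (pi / n%:R : R) ^+ m.
  by rewrite exprn_gt0// divr_gt0 ?ltr0n// pi_gt0.
have hq : mint K mu h = (pi / n%:R) ^+ m *
    \sum_(j : {ffun 'I_m -> 'I_n}) mevalrV h (gcpoint j).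
  apply: mint_chebyshev_vdeg => // i e eh; apply: leq_trans (hvdeg i e eh) _.
  by case/andP: kn; lia.
have far_mem i (j : 'I_n) : ((j : nat) \in far i) = ~~ (s i <= j < s i + k)%N.
  rewrite mem_cat !mem_iota; have := (sn i).1; have := ltn_ord j.
  by case: leqP; case: leqP => /=; lia.
have h0 : 0 < mint K mu h.
  have sk i : (s i < n)%N by have := (sn i).1; rewrite /k; lia.
  (* The corner of the block of spared nodes, where [h] does not vanish. *)
  pose j0 := [ffun i => Ordinal (sk i)].
  rewrite hq mulr_gt0// (bigD1 j0)//= ltr_pwDl//; last first.
    by apply: sumr_ge0 => j _; exact: sos_ge0 hr.
  rewrite hEval; apply: prodr_gt0 => i _; rewrite big_seq; apply: prodr_gt0 => j jf.
  rewrite lt_neqAle sqr_ge0 andbT eq_sym sqrf_eq0 subr_eq0 mxE ffunE /=.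
  have jn : (j < n)%N.
    by move: jf; rewrite mem_cat !mem_iota; have := (sn i).1; lia.
  apply/negP => /eqP/(gcnode_inj (sk i) jn) sj.
  have := far_mem i (Ordinal (sk i)); rewrite /= {1}sj jf.
  by rewrite leqnn -addn1 leq_add2l.
have pn : 0 <= (pi / n%:R : R) by rewrite divr_ge0// pi_ge0.
have D0 : 0 <= k%:R * (pi / n%:R) :> R by rewrite mulr_ge0.
apply: le_trans (_ : C * (k%:R * (pi / n%:R)) ^+ 2 <= _).
  apply: (gap_le (chebyshev_measurable Kmu) (chebyshev_integrable Kmu)
    mint1_chebyshev_gt0 GM hr h0).
  rewrite hq [leRHS]mulrCA (@mint_chebyshev_vdeg n)//; last first.
    move=> i e ep; have Mv : vdeg_le i d (mpolyC m M - G).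
      by apply: vdeg_leB; [exact: vdeg_leC|exact: mdeg_le_vdeg].
    have := vdeg_leM Mv (hvdeg i) ep => H; apply: leq_trans H _.
    by case/andP: kn; rewrite /k; lia.
  rewrite ler_wpM2l ?(ltW pos)// mulr_sumr ler_sum// => j _.
  rewrite mevalrVM mevalrVB mevalrVC.
  (* A grid point with one coordinate outside its block is a root of [h]; all the others are close
     to [a] in every angle. *)
  have [jn|] := boolP [forall i, ~~ ((j i : nat) \in far i)]; last first.
    rewrite negb_forall => /existsP[i]; rewrite negbK => jfar.
    suff -> : mevalrV h (gcpoint j) = 0 by rewrite !mulr0.
    rewrite hEval (bigD1 i)//= (big_rem _ jfar)/= mxE subrr expr0n.
    by rewrite !mul0r.
  rewrite ler_wpM2r ?(sos_ge0 _ hr)//.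
  have -> : gcpoint j = \row_i cos (gctheta n (j i)) :> 'rV[R]_m.
    by apply/rowP => i; rewrite !mxE.
  apply: HC => // i; apply: (sn i).2.
  by move/forallP: jn => /(_ i); rewrite far_mem negbK.
(* From r < m (n + 1) <= 2 m n one gets 1/n <= 2m/r, the source of the factor 2m in the constant. *)
rewrite -[leRHS]mulrA ler_wpM2l// -exprVn -exprMn lerXn2r ?nnegrE//.
  by rewrite !mulr_ge0// ?invr_ge0// pi_ge0.
rewrite -!mulrA ler_wpM2l// ler_wpM2l ?pi_ge0// mulrA.
rewrite ler_pdivlMr ?ltr0n// mulrC ler_pdivrMr ?ltr0n// -!natrM ler_nat.
by have := ltn_ceil r m0; rewrite -/n; nia.
Qed.

End chebyshev_gap.

(** * Concentration for the Lebesgue measure *)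

Lemma divn2_bounds r : (1 < r)%N -> (r <= 4 * (r %/ 2))%N /\ (2 * (r %/ 2) <= r)%N.
Proof. by move=> r1; split; lia. Qed.

(** * First-order expansion of a polynomial with quadratic remainder *)

Section first_order.
Context {R : realType} {m : nat}.
Variables (a : 'rV[R]_m) (B : R).
Implicit Types (F : 'rV[R]_m -> R) (y : 'rV[R]_m).

Definition sqnorm y : R := \sum_i y 0 i ^+ 2.

Lemma sqnorm_ge0 y : 0 <= sqnorm y.
Proof. by apply: sumr_ge0 => i _; exact: sqr_ge0. Qed.

Lemma coord_sqnorm y i : y 0 i ^+ 2 <= sqnorm y.
Proof. by rewrite /sqnorm (bigD1 i)//= lerDl sumr_ge0// => j _; exact: sqr_ge0. Qed.

Lemma coordM_sqnorm y i j : `|y 0 i * y 0 j| <= sqnorm y.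
Proof.
have [hi hj] := (coord_sqnorm y i, coord_sqnorm y j).
have := sqr_ge0 (y 0 i - y 0 j); have := sqr_ge0 (y 0 i + y 0 j).
by rewrite !expr2 in hi hj *; rewrite ler_norml => ? ?; apply/andP; split; lra.
Qed.

(** [l] stands for the gradient at [a]. Leaving it existential gives a class stable under sums and
    under multiplication by a coordinate, from which all polynomials are reached without
    differentiating. *)
Definition first_order_expansion F := exists l : 'I_m -> R, exists2 C, 0 <= C &
  forall y, (forall i, `|y 0 i| <= B) ->
    `|F (a + y) - F a - \sum_i l i * y 0 i| <= C * sqnorm y.

Lemma first_order_cst c : first_order_expansion (fun=> c).
Proof.
exists (fun=> 0), 0 => // y _.
by rewrite big1 ?subrr ?subr0 ?normr0 ?mul0r// => i _; rewrite mul0r.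
Qed.

Lemma first_orderD F G : first_order_expansion F -> first_order_expansion G ->
  first_order_expansion (fun z => F z + G z).
Proof.
move=> [l [C C0 FC]] [l' [C' C'0 GC]].
exists (fun i => l i + l' i), (C + C'); first exact: addr_ge0.
move=> y yB; rewrite mulrDl; apply: le_trans (lerD (FC y yB) (GC y yB)).
apply: le_trans (ler_normD _ _); rewrite le_eqVlt; apply/orP; left; apply/eqP.
congr `|_|; under eq_bigr do rewrite mulrDl; rewrite big_split/=; ring.
Qed.

Lemma first_order_coordM F i : 0 <= B -> first_order_expansion F ->
  first_order_expansion (fun z => z 0 i * F z).
Proof.
move=> B0 [l [C C0 FC]].
exists (fun j => a 0 i * l j + F a * (j == i)%:R).
exists ((`|a 0 i| + B) * C + \sum_j `|l j|).
  by rewrite addr_ge0 ?mulr_ge0 ?addr_ge0// sumr_ge0.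
move=> y yB; rewrite mxE.
under eq_bigr do rewrite mulrDl -!mulrA.
have yi : \sum_j (j == i)%:R * y 0 j = y 0 i.
  by rewrite (bigD1 i)//= eqxx mul1r big1 ?addr0// => j /negbTE->; rewrite mul0r.
rewrite big_split/= -!mulr_sumr yi.
set L := \sum_j l j * y 0 j.
have -> : (a 0 i + y 0 i) * F (a + y) - a 0 i * F a -
    (a 0 i * L + F a * y 0 i) =
    (a 0 i + y 0 i) * (F (a + y) - F a - L) + y 0 i * L by ring.
rewrite [leRHS]mulrDl; apply: le_trans (ler_normD _ _) _; apply: lerD.
  rewrite normrM -mulrA ler_pM//; last exact: FC.
  by rewrite (le_trans (ler_normD _ _))// lerD2l.
rewrite /L mulr_sumr (le_trans (ler_norm_sum _ _ _))// mulr_suml ler_sum// => j _.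
by rewrite mulrCA normrM ler_wpM2l// coordM_sqnorm.
Qed.

Lemma first_order_mevalrV p : 0 <= B -> first_order_expansion (mevalrV p).
Proof.
move=> B0; rewrite (_ : mevalrV p = fun z => \sum_(e <- msupp p)
    (\prod_i z 0 i ^+ e i) * mcoeff e p); last first.
  by apply/funext => z; rewrite /mevalrV mevalE; under eq_bigr do rewrite mulrC.
elim: (msupp p) => [|e s IH].
  by under eq_fun do rewrite big_nil; exact: first_order_cst.
under eq_fun do rewrite big_cons; apply: first_orderD => //.
elim: (index_enum _) => [|i t IHt].
  by under eq_fun do rewrite big_nil; exact: first_order_cst.
under eq_fun do rewrite big_cons -mulrA.
elim: (e i) => [|k IHk]; first by under eq_fun do rewrite mul1r.
by under eq_fun do rewrite exprS -mulrA; exact: first_order_coordM.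
Qed.

Definition mshift (i : 'I_m) : mpoly m R := mpolyX R (mnm1 i) - mpolyC m (a 0 i).

Lemma mshiftE i z : mevalrV (mshift i) z = (z - a) 0 i.
Proof. by rewrite /mshift mevalrVB mevalrVX mevalrVC !mxE. Qed.

Lemma mdeg_mshift i : mdeg_le 1 (mshift i).
Proof. by apply: mdeg_leB; [exact: mdeg_leX|exact: mdeg_leC]. Qed.

Definition msqnorm : mpoly m R := \sum_i mshift i ^+ 2.

Lemma msqnormE z : mevalrV msqnorm z = sqnorm (z - a).
Proof.
rewrite /msqnorm mevalrV_sum; apply: eq_bigr => i _.
by rewrite mevalrVXn mshiftE.
Qed.

Lemma mdeg_msqnorm : mdeg_le 2 msqnorm.
Proof. by apply: mdeg_le_sum => i _; exact/(@mdeg_leXn _ _ 1 2)/mdeg_mshift. Qed.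

End first_order.

(** * Concentration of the weight (1 - U)^(2s) where U is small *)

Section concentration.
Context {R : realType} {m : nat}.
Variables (K : set 'rV[R]_m)
  (mu : {finite_measure set (borelrV R m) -> \bar R}).
Hypothesis mK : measurable (K : set (borelrV R m)).
Hypothesis intK : mpoly_integrable K mu.
Hypothesis mint1_gt0 : 0 < mint K mu 1.
Variable U : mpoly m R.
Hypothesis U01 : forall z, K z -> 0 <= mevalrV U z <= 2^-1.

Lemma mint_onemX_gt0 k : 0 < mint K mu ((1 - U) ^+ k).
Proof.
apply: (@lt_le_trans _ _ (mint K mu (2^-1 ^+ k *: 1))).
  by rewrite mintZ// mulr_gt0// exprn_gt0.
apply: ler_mint => // z Kz; rewrite mevalrVZ mevalrVXn mevalrVB !mevalrV1 mulr1.
have /andP[U0 U1] := U01 Kz; rewrite lerXn2r ?nnegrE//; lra.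
Qed.

(* Pointwise s U (1 - U)^s <= (1 - U^2)^s <= 1, by Bernoulli's inequality. *)
Lemma mint_onemX_le s C : (0 < s)%N ->
  mint K mu ((1 - U) ^+ s) <= C * mint K mu ((1 - U) ^+ (s * 2)) ->
  mint K mu (U * (1 - U) ^+ (s * 2)) <=
    C / s%:R * mint K mu ((1 - U) ^+ (s * 2)).
Proof.
move=> s0 HC; have sR : (0 : R) < s%:R by rewrite ltr0n.
rewrite mulrAC ler_pdivlMr// mulrC; apply: le_trans HC.
rewrite -mintZ//; apply: ler_mint => // z Kz.
rewrite mevalrVZ mevalrVM !mevalrVXn mevalrVB mevalrV1.
have /andP[U0 U1] := U01 Kz; set u := mevalrV U z in U0 U1 *.
have u1 : 0 <= 1 - u by lra.
rewrite muln2 -addnn exprD mulrA mulrA ler_piMl ?exprn_ge0//.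
have Bern : 1 + s%:R * u <= (1 + u) ^+ s.
  elim: s {s0 sR} => [|s IH]; first by rewrite mul0r addr0 expr0.
  rewrite exprS; apply: (@le_trans _ _ ((1 + u) * (1 + s%:R * u))).
    rewrite -natr1; have : 0 <= u * (s%:R * u) by rewrite !mulr_ge0.
    lra.
  by rewrite ler_wpM2l//; lra.
apply: (@le_trans _ _ ((1 + u) ^+ s * (1 - u) ^+ s)).
  by rewrite mulrA ler_wpM2r ?exprn_ge0//; lra.
rewrite -exprMn exprn_ile1//.
- by rewrite mulr_ge0//; lra.
- have := sqr_ge0 u; rewrite expr2; lra.
Qed.

End concentration.

Section lebesgue_on.
Context {R : realType} {m : nat}.
Variables (K : set 'rV[R]_m)
  (mu : {finite_measure set (borelrV R m) -> \bar R}).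
Hypothesis mK : measurable (K : set (borelrV R m)).
Hypothesis Kmu : lebesgue_on K mu.

Lemma integral_lebesgue_on (f : borelrV R m -> \bar R) :
  (\int[mu]_(z in (K : set (borelrV R m))) f z =
   \int[lebesgue_rV m]_(z in (K : set (borelrV R m))) f z)%E.
Proof.
apply: eq_measure_integral => A mA AK.
by rewrite -[LHS]/(mu A) Kmu// setIidl.
Qed.

Lemma mint_lebesgue_on p : mpoly_integrable K mu ->
  ((mint K mu p)%:E = \int[lebesgue_rV m]_z
     (((EFin \o mevalrV p) : borelrV R m -> \bar R) \_ K) z)%E.
Proof.
by move=> iK; rewrite -integral_mevalrV// integral_lebesgue_on integral_mkcond.
Qed.

End lebesgue_on.

(** * Convex bodies *)

Section convex_bodies.
Context {R : realType} {m : nat}.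
Variables (K : set 'rV[R]_m)
  (mu : {finite_measure set (borelrV R m) -> \bar R}).
Hypothesis mK : measurable (K : set (borelrV R m)).
Hypothesis intK : mpoly_integrable K mu.
Hypothesis mint1_gt0 : 0 < mint K mu 1.
Hypothesis convK : convex_set (K : set (convex_lmodType 'rV[R]_m)).
Hypothesis Kmu : lebesgue_on K mu.

Lemma convex_segment (t : R) z w : 0 <= t <= 1 -> K z -> K w ->
  K (w + t *: (z - w)).
Proof.
move=> /andP[t0 t1] Kz Kw.
have := @convK z w (Itv01 t0 t1) (mem_set Kz) (mem_set Kw); rewrite inE.
congr K; rewrite /conv/=; apply/rowP => i.
by rewrite !mxE /unstable.onem; ring.

Qed.

(* Dilation by 1/2 towards a maps K into itself and at least halves U. *)
Lemma mint_onemX_half U a s :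
  K a -> (forall z, K z -> 0 <= mevalrV U z <= 2^-1) ->
  (forall z, K z -> mevalrV U (a + 2^-1 *: (z - a)) <= mevalrV U z / 2) ->
  mint K mu ((1 - U) ^+ s) <= 2 ^+ m * mint K mu ((1 - U) ^+ (s * 2)).
Proof.
move=> Ka U01 Uhalf.
pose F k : borelrV R m -> \bar R := (EFin \o mevalrV ((1 - U) ^+ k)) \_ K.
have F0 k z : (0 <= F k z)%E.
  rewrite /F patchE; case: ifPn => // /[!inE] Kz.
  rewrite /= lee_fin mevalrVXn mevalrVB mevalrV1 exprn_ge0//.
  by have /andP[_ ?] := U01 z Kz; lra.
have mF k : measurable_fun setT (F k).
  apply/(measurable_restrictT _ mK)/measurable_EFinP.
  exact: measurable_mevalrV.
have half0 : 0 < 2^-1 :> R by [].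
have := @ge0_integral_rV_affine R m 2^-1 (2^-1 *: a) (F (s * 2)%N) half0
  (mF _) (F0 _).
have VE k : (mint K mu ((1 - U) ^+ k))%:E = (\int[lebesgue_rV m]_z F k z)%E.
  exact: (mint_lebesgue_on mK Kmu _ intK).
move=> FE; rewrite -ler_pdivrMl ?exprn_gt0// -exprVn -lee_fin EFinM !VE FE.
rewrite lee_pmul2l ?lte_fin ?exprn_gt0//.
apply: ge0_le_integral => //.
  exact: (measurableT_comp (mF _) (measurable_rV_affine _ _)).
move=> z _; rewrite {1}/F patchE; case: ifPn => [/[!inE] Kz|_]; last exact: F0.
have zE : 2^-1 *: (z : 'rV[R]_m) + 2^-1 *: a = a + 2^-1 *: (z - a) :> 'rV[R]_m.
  rewrite scalerBr addrCA; congr (_ + _).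
  by apply/rowP => i; rewrite !mxE; field.
rewrite /F zE patchE mem_set; last by apply: convex_segment => //; apply/andP; split; lra.
rewrite /= lee_fin !mevalrVXn !mevalrVB !mevalrV1 mulnC exprM.
have /andP[u0 u1] := U01 z Kz; have := Uhalf z Kz.
set u := mevalrV U z in u0 u1 *; set v := mevalrV U _ => vu.
rewrite lerXn2r ?nnegrE ?sqr_ge0//; first by lra.
(* Halving [u] is paid for by doubling the exponent: (1 - u/2)^2 >= 1 - u. *)
have : (1 - u / 2) ^+ 2 <= (1 - v) ^+ 2.
  by rewrite lerXn2r// ?nnegrE; lra.
by apply: le_trans; have := sqr_ge0 u; rewrite !expr2; lra.
Qed.

Lemma gap_convex_le B G M a : (forall z, K z -> forall i, `|z 0 i| <= B) ->
  (forall z, K z -> mevalrV G z <= M) -> K a -> mevalrV G a = M ->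
  exists C, forall r, (1 < r)%N -> gap K mu (mevalrV G) M r <= C / r%:R.
Proof.
move=> KB GM Ka Ga.
have Kya z : K z -> forall i, `|(z - a) 0 i| <= B + B.
  move=> Kz i; rewrite !mxE (le_trans (ler_normB _ _))//.
  by rewrite lerD// KB.
have B0 : 0 <= B + B \/ m = 0%N.
  case: (posnP m) => [->|m0]; [by right|left].
  exact: le_trans (normr_ge0 _) (Kya a Ka (Ordinal m0)).
have {}B0 : 0 <= `|B + B| by [].
have {}Kya z : K z -> forall i, `|(z - a) 0 i| <= `|B + B|.
  by move=> Kz i; rewrite (le_trans (Kya z Kz i))// ler_norm.
have [l [C C0 HC]] := first_order_mevalrV a G B0.
pose Q : mpoly m R := C *: msqnorm a - \sum_i l i *: mshift a i.
have QE z : mevalrV Q z = C * sqnorm (z - a) - \sum_i l i * (z - a) 0 i.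
  rewrite mevalrVB mevalrVZ msqnormE mevalrV_sum; congr (_ - _).
  by apply: eq_bigr => i _; rewrite mevalrVZ mshiftE.
(* At a maximum no direction pointing into [K] is ascending; the segment from [a] to [z] stays in
   [K] by convexity. *)
have l_le0 z : K z -> \sum_i l i * (z - a) 0 i <= 0.
  move=> Kz; rewrite leNgt; apply/negP; set w := \sum_i _ => w0.
  pose X := C * sqnorm (z - a).
  have X0 : 0 <= X by rewrite mulr_ge0// sqnorm_ge0.
  (* At most 1, yet small enough for the gain [t * w] to exceed the error [t ^+ 2 * X]. *)
  pose t := w / (w + X).
  have wX : 0 < w + X by rewrite ltr_pwDl.
  have t0 : 0 < t by rewrite divr_gt0.
  have t1 : t <= 1 by rewrite ler_pdivrMr// mul1r lerDl.
  have t01 : 0 <= t <= 1 by rewrite (ltW t0).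
  have := GM _ (convex_segment t01 Kz Ka).
  have := HC (t *: (z - a)); rewrite Ga.
  rewrite (_ : \sum_i _ = t * w); last first.
    by rewrite mulr_sumr; apply: eq_bigr => i _; rewrite mxE mulrCA.
  rewrite (_ : C * sqnorm _ = t ^+ 2 * X); last first.
    rewrite /X mulrCA; congr (_ * _); rewrite /sqnorm mulr_sumr.
    by apply: eq_bigr => i _; rewrite mxE exprMn.
  set g := mevalrV G _ => gE gM.
  have : `|g - M - t * w| <= t ^+ 2 * X.
    apply: gE => i; rewrite mxE normrM ger0_norm ?(ltW t0)//.
    by rewrite (le_trans _ (Kya z Kz i))// ler_piMl.
  rewrite ler_norml => /andP[gl _].
  have : t * w <= t ^+ 2 * X by lra.
  rewrite expr2 -mulrA ler_pM2l//; apply/negP; rewrite -ltNge.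
  by rewrite /t mulrAC ltr_pdivrMr// mulrDr ltrDr mulr_gt0.
have Q0 z : K z -> 0 <= mevalrV Q z.
  move=> Kz; rewrite QE; have := l_le0 z Kz.
  have : 0 <= C * sqnorm (z - a) by rewrite mulr_ge0// sqnorm_ge0.
  by lra.
have GQ z : K z -> M - mevalrV G z <= mevalrV Q z.
  move=> Kz; have := HC (z - a) (Kya z Kz); rewrite (addrC a) subrK Ga QE.
  by rewrite ler_norml => /andP[] *; lra.
have [D' QD'] := mevalrV_bounded B Q.
pose D := `|D'| + 1; have D0 : 0 < D by rewrite ltr_pwDr.
have QD z : K z -> mevalrV Q z <= D.
  move=> Kz; apply: le_trans (ler_norm _) (le_trans (QD' z (KB z Kz)) _).
  by apply: le_trans (ler_norm _) _; rewrite lerDl.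
pose U : mpoly m R := (2 * D)^-1 *: Q.
have UE z : mevalrV U z = mevalrV Q z / (2 * D) by rewrite mevalrVZ mulrC.
have U01 z : K z -> 0 <= mevalrV U z <= 2^-1.
  move=> Kz; rewrite UE divr_ge0 ?Q0 ?mulr_ge0 ?(ltW D0)//=.
  by rewrite ler_pdivrMr ?mulr_gt0// mulKf ?QD.
(* The dilation divides the quadratic part of [Q] by 4 and the linear part by 2. *)
have Uhalf z : K z -> mevalrV U (a + 2^-1 *: (z - a)) <= mevalrV U z / 2.
  move=> Kz; rewrite !UE mulrAC ler_wpM2r ?invr_ge0 ?mulr_ge0 ?(ltW D0)//.
  rewrite !QE (addrC a) addrK.
  rewrite (_ : sqnorm _ = 4^-1 * sqnorm (z - a)); last first.
    rewrite /sqnorm mulr_sumr; apply: eq_bigr => i _; rewrite mxE exprMn.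
    by congr (_ * _); field.
  rewrite (_ : \sum_i _ = 2^-1 * \sum_i l i * (z - a) 0 i); last first.
    by rewrite mulr_sumr; apply: eq_bigr => i _; rewrite [in LHS]mxE mulrCA.
  have : 0 <= C * sqnorm (z - a) by rewrite mulr_ge0// sqnorm_ge0.
  by lra.
(* [2 * D] undoes the normalisation of [Q], [2 ^+ m] is the Jacobian of the dilation, and 4 comes
   from r <= 4s. As [U] has degree 2, s = r/2 keeps (1 - U)^s within degree [r]. *)
exists (2 * D * 2 ^+ m * 4) => r r1.
pose s := (r %/ 2)%N.
have s0 : (0 < s)%N by rewrite divn_gt0.
have [rs rs2] := divn2_bounds r1.
have Hd := mint_onemX_half s Ka U01 Uhalf.
have HU := mint_onemX_le mK intK U01 s0 Hd.
have h0 := mint_onemX_gt0 mK intK mint1_gt0 U01 (s * 2).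
apply: (@le_trans _ _ (2 * D * (2 ^+ m / s%:R))); last first.
  rewrite -!mulrA !ler_wpM2l ?(ltW D0)// ?exprn_ge0//.
  rewrite ler_pdivlMr ?ltr0n ?(ltnW r1)// mulrC ler_pdivrMr ?ltr0n//.
  by rewrite -natrM ler_nat.
apply: gap_le GM _ h0 _ => //.
  rewrite exprM; apply: sos_sqr; apply: (mdeg_leW rs2).
  apply: mdeg_leXn; apply: mdeg_leB; first exact: mdeg_le1.
  apply/mdeg_leZ/mdeg_leB; first exact/mdeg_leZ/mdeg_msqnorm.
  by apply: mdeg_le_sum => i _; apply/mdeg_leZ/(mdeg_leW _ (mdeg_mshift _ _)).
apply: le_trans (_ : 2 * D * mint K mu (U * (1 - U) ^+ (s * 2)) <= _); last first.
  by rewrite -[leRHS]mulrA ler_wpM2l// mulr_ge0// ltW.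
rewrite -mintZ//; apply: ler_mint => // z Kz.
rewrite mevalrVZ !mevalrVM mevalrVB mevalrVC mulrA ler_wpM2r//.
  rewrite mevalrVXn mevalrVB mevalrV1 exprn_ge0//.
  by have /andP[_ ?] := U01 z Kz; lra.
by rewrite UE mulrCA divff ?mulr1 ?GQ// gt_eqF// mulr_gt0.
Qed.

End convex_bodies.

(** * Cubes inside the interior cones *)

Section interior_cone_condition.
Context {R : realType} {m : nat}.
Hypothesis m_gt0 : (0 < m)%N.
Implicit Types (u v w : 'rV[R]_m).

Lemma dotrVE u v : dotrV u v = \sum_i u 0 i * v 0 i.
Proof. by rewrite /dotrV mxE; apply: eq_bigr => i _; rewrite mxE. Qed.

Lemma dotrVV u : dotrV u u = sqnorm u.
Proof. by rewrite dotrVE; apply: eq_bigr => i _; rewrite expr2. Qed.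

(** At height [t] on its axis a cone with vertex [a] contains a cube of side proportional to [t].
    Thus [K] has volume of order at least t^m within distance 2t of [a], with product sets that are
    easy to measure. *)
Lemma interior_cone_boxes (K : set 'rV[R]_m) a : interior_cone K -> K a ->
  exists xi : 'rV[R]_m, exists c t0 : R, [/\ 0 < c, 0 < t0 &
    forall t v, 0 < t <= t0 -> (forall i, `|v 0 i| <= c * t) ->
      K (a + (t *: xi + v)) /\ sqnorm (t *: xi + v) <= 4 * t ^+ 2].
Proof.
move=> [theta [rho [/andP[th0 th1] rho0 Kcone]]] Ka.
have [xi xi1 {}Kcone] := Kcone a Ka.
pose k := cos theta.
have k0 : 0 < k by apply: cos_gt0_pihalf; rewrite th1 andbT (lt_trans _ th0)// oppr_lt0 divr_gt0 ?pi_gt0.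
have k1 : k < 1.
  rewrite /k -[ltRHS]cos0 ltr_cos ?in_itv/= ?lexx ?pi_ge0// (ltW th0).
  by apply: le_trans (ltW th1) _; rewrite ler_pdivrMr// ler_peMr ?pi_ge0// ler1n.
(* Chosen so that k (1 + eta) <= 1 - eta: a vector within [eta * t] of [t *: xi] has length at most
   t (1 + eta) and component at least t (1 - eta) along [xi], so it lies in the cone. *)
pose eta := (1 - k) / 2.
have mR : (1 : R) <= m%:R by rewrite ler1n.
have m0 : (0 : R) < m%:R by rewrite ltr0n.
(* Division by [m] bounds the sum of the [|v 0 i|], and so the Euclidean norm of [v], by [eta * t];
   [rho / 2] leaves room for the length t (1 + eta) <= 2t. *)
exists xi, (eta / m%:R), (rho / 2); split.
- by rewrite divr_gt0// divr_gt0// subr_gt0.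
- by rewrite divr_gt0.
move=> t v /andP[t0 tr] vc.
have xis : sqnorm xi = 1.
  have := xi1; rewrite /enorm dotrVV => /(congr1 (fun x => x ^+ 2)).
  by rewrite sqr_sqrtr ?sqnorm_ge0// expr1n.
have eta0 : 0 < eta by rewrite divr_gt0// subr_gt0.
have et0 : 0 <= eta * t by rewrite mulr_ge0// ltW.
have sumv : \sum_i `|v 0 i| <= eta * t.
  apply: (@le_trans _ _ (\sum_(i < m) eta / m%:R * t)).
    by apply: ler_sum => i _; exact: vc.
  rewrite sumr_const card_ord -[_ *+ m]mulr_natr.
  by rewrite -mulrA (mulrC t) mulrA divfK ?gt_eqF.
have xiv : `|\sum_i v 0 i * xi 0 i| <= eta * t.
  apply: le_trans sumv; apply: le_trans (ler_norm_sum _ _ _) _.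
  apply: ler_sum => i _; rewrite normrM ler_piMr//.
  rewrite -(@ler_pXn2r _ 2)// ?nnegrE// expr1n real_normK ?num_real//.
  by rewrite -xis coord_sqnorm.
have vv : sqnorm v <= (eta * t) ^+ 2.
  apply: (@le_trans _ _ ((\sum_i `|v 0 i|) ^+ 2)); last first.
    by rewrite lerXn2r ?nnegrE// sumr_ge0.
  rewrite /sqnorm expr2 mulr_suml ler_sum// => i _.
  rewrite -real_normK ?num_real// expr2 ler_wpM2l// (bigD1 i)//= lerDl.
  by rewrite sumr_ge0.
set w := t *: xi + v.
have wE : sqnorm w = t ^+ 2 + 2 * t * (\sum_i v 0 i * xi 0 i) + sqnorm v.
  have -> : t ^+ 2 = t ^+ 2 * sqnorm xi by rewrite xis mulr1.
  rewrite /sqnorm !mulr_sumr -!big_split/=.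
  by apply: eq_bigr => i _; rewrite !mxE; ring.
have eta12 : eta < 2^-1 by rewrite /eta; lra.
have xiv' : t * `|\sum_i v 0 i * xi 0 i| <= t * (eta * t).
  by rewrite ler_pM2l.
set X := \sum_i v 0 i * xi 0 i in xiv xiv' wE *.
move: xiv; rewrite ler_norml => /andP[X1 X2].
have tX1 : t * - (eta * t) <= t * X by rewrite ler_pM2l.
have tX2 : t * X <= t * (eta * t) by rewrite ler_pM2l.
have w_le : sqnorm w <= (t * (1 + eta)) ^+ 2.
  rewrite wE (_ : (t * (1 + eta)) ^+ 2 =
    t ^+ 2 + 2 * (t * (eta * t)) + (eta * t) ^+ 2); last by ring.
  rewrite -mulrA; lra.
have w_gt0 : 0 < sqnorm w.
  rewrite wE; have := sqnorm_ge0 v.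
  have : 0 < t ^+ 2 * (1 - 2 * eta) by rewrite mulr_gt0 ?exprn_gt0// subr_gt0; lra.
  rewrite (_ : t ^+ 2 * _ = t ^+ 2 + 2 * (t * - (eta * t))); last by ring.
  rewrite -mulrA; lra.
have w4 : sqnorm w <= 4 * t ^+ 2.
  apply: le_trans w_le _; rewrite (_ : 4 * _ = (t * 2) ^+ 2); last by ring.
  rewrite lerXn2r ?nnegrE ?mulr_ge0 ?(ltW t0)//; [lra|].
  by rewrite ler_pM2l//; lra.
split => //.
pose l := enorm w.
have l0 : 0 < l by rewrite /l /enorm dotrVV sqrtr_gt0.
have l2 : l ^+ 2 = sqnorm w by rewrite /l /enorm dotrVV sqr_sqrtr// sqnorm_ge0.
have l_le : l <= t * (1 + eta).
  have p0 : 0 <= t * (1 + eta) by rewrite mulr_ge0 ?(ltW t0)//; lra.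
  by rewrite -(@ler_pXn2r _ 2)// ?nnegrE ?(ltW l0)// l2.
have wxi : \sum_i w 0 i * xi 0 i = t + X.
  transitivity (t * sqnorm xi + X); last by rewrite xis mulr1.
  rewrite /sqnorm mulr_sumr -big_split/=; apply: eq_bigr => i _.
  by rewrite !mxE; ring.
rewrite (_ : w = l *: (l^-1 *: w)); last first.
  by rewrite scalerA divff ?scale1r// gt_eqF.
apply: Kcone.
- rewrite /enorm dotrVV (_ : sqnorm _ = 1) ?sqrtr1// /sqnorm.
  under eq_bigr do rewrite mxE exprMn.
  by rewrite -mulr_sumr -/(sqnorm w) -l2 -exprMn mulVf ?expr1n// gt_eqF.
- rewrite dotrVE; under eq_bigr do rewrite mxE -mulrA.
  rewrite -mulr_sumr wxi -/k mulrC ler_pdivlMr//.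
  apply: (@le_trans _ _ (k * (t * (1 + eta)))); first by rewrite ler_pM2l.
  apply: (@le_trans _ _ (t * (1 - eta))); last by lra.
  rewrite mulrCA ler_pM2l// /eta.
  have : 0 <= (1 - k) * (1 - k) by rewrite mulr_ge0// subr_ge0 ltW.
  lra.
- rewrite (ltW l0)/= (le_trans l_le)//.
  apply: (@le_trans _ _ (t * 2)); first by rewrite ler_pM2l//; lra.
  by rewrite -ler_pdivlMr.
Qed.

End interior_cone_condition.

(** * Integrals of (1 - U)^s with U proportional to the squared distance to a *)

Section cone_gap.
Context {R : realType} {m : nat}.
Hypothesis m_gt0 : (0 < m)%N.
Variables (K : set 'rV[R]_m)
  (mu : {finite_measure set (borelrV R m) -> \bar R}).
Hypothesis mK : measurable (K : set (borelrV R m)).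
Hypothesis intK : mpoly_integrable K mu.
Hypothesis mint1_gt0 : 0 < mint K mu 1.
Hypothesis Kmu : lebesgue_on K mu.
Variables (a : 'rV[R]_m) (D : R).
Hypothesis D0 : 0 < D.
Let U : mpoly m R := D^-1 *: msqnorm a.
Hypothesis U01 : forall z, K z -> 0 <= mevalrV U z <= 2^-1.

Let UE z : mevalrV U z = sqnorm (z - a) / D.
Proof. by rewrite mevalrVZ msqnormE mulrC. Qed.

(** Since 1 - u <= exp (- u), the integrand is below a Gaussian, which is integrated over the whole
    space as a product over the coordinates. *)
Lemma mint_onemX_upper s : (0 < s)%N ->
  mint K mu ((1 - U) ^+ s) <=
  (Num.sqrt pi * Num.sqrt D) ^+ m / Num.sqrt s%:R ^+ m.
Proof.
move=> s0; have sR : 0 < Num.sqrt s%:R :> R by rewrite sqrtr_gt0 ltr0n.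
have DR : 0 < Num.sqrt D by rewrite sqrtr_gt0.
pose c := Num.sqrt s%:R / Num.sqrt D.
have c0 : 0 < c by rewrite divr_gt0.
have c2 : c ^+ 2 = s%:R / D by rewrite exprMn exprVn !sqr_sqrtr// ltW.
pose g (i : 'I_m) : measurableTypeR R -> R :=
  fun t => gauss_fun (c * t + - (c * a 0 i)).
have mg i : measurable_fun setT (g i).
  have mh : measurable_fun setT (fun t : measurableTypeR R =>
      (c * t + - (c * a 0 i) : measurableTypeR R)).
    by apply: measurable_funD => //; exact: measurable_funM.
  exact: measurableT_comp (@measurable_gauss_fun R) mh.
have g0 i t : 0 <= g i t by exact: gauss_fun_ge0.
have Ig i : (\int[@lebesgue_measure R]_t (g i t)%:E =
    (Num.sqrt pi / c)%:E)%E.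
  have := @ge0_integral_affine R c (- (c * a 0 i)) (EFin \o gauss_fun) c0.
  rewrite integralT_gauss /= => /(_ _ _)/esym E.
  have {}E : (c%:E * \int[lebesgue_measure]_t (g i t)%:E = (Num.sqrt pi)%:E)%E.
    apply: E => [|t]; last by rewrite lee_fin gauss_fun_ge0.
    by apply/measurable_EFinP; exact: measurable_gauss_fun.
  rewrite mulrC EFinM -E muleA -EFinM mulVf ?mul1e// gt_eqF//.
rewrite -lee_fin (mint_lebesgue_on mK Kmu _ intK).
apply: (@le_trans _ _ (\int[lebesgue_rV m]_z
    (\prod_i g i ((z : 'rV[R]_m) 0 i))%:E)%E).
  apply: ge0_le_integral => //.
  - move=> z _; rewrite patchE; case: ifPn => // /[!inE] Kz.
    rewrite /= lee_fin mevalrVXn mevalrVB mevalrV1 exprn_ge0//.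
    by have /andP[_ ?] := U01 Kz; lra.
  - apply/(measurable_restrictT _ mK)/measurable_EFinP.
    exact: measurable_mevalrV.
  - by apply/measurable_EFinP; exact: measurable_prod_coord_rV.
  move=> z _; rewrite patchE; case: ifPn => [/[!inE] Kz|_]; last first.
    by rewrite lee_fin prodr_ge0.
  rewrite /= lee_fin mevalrVXn mevalrVB mevalrV1.
  have -> : \prod_i g i ((z : 'rV[R]_m) 0 i) = expR (- mevalrV U z) ^+ s.
    rewrite -expRM_natl UE /g /gauss_fun -expR_sum; congr expR.
    rewrite sumrN mulrN; congr (- _).
    rewrite (_ : s%:R * _ = c ^+ 2 * sqnorm (z - a)); last first.
      by rewrite c2 mulrA mulrAC.
    rewrite /sqnorm mulr_sumr.
    by apply: eq_bigr => i _; rewrite !mxE; ring.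
  have /andP[U0 U1] := U01 Kz.
  rewrite lerXn2r ?nnegrE ?expR_ge0//; first by lra.
  exact: expR_ge1Dx.
rewrite ge0_integral_prod_rV//; under eq_bigr do rewrite Ig.
rewrite prodEFin lee_fin prodr_const card_ord /c.
by rewrite invf_div mulrA exprMn exprVn.
Qed.

(** On the cube at height [t] one has s U <= 4 t^2 s / D <= 1/4, so Bernoulli's inequality keeps (1
    - U)^(2s) above 1/2; the rest of [K] is discarded. *)
Lemma mint_onemX_lower (xi : 'rV[R]_m) (c t : R) s : (0 < s)%N -> 0 < c -> 0 < t ->
  t ^+ 2 * 16 <= D / s%:R ->
  (forall v : 'rV[R]_m, (forall i, `|v 0 i| <= c * t) ->
    K (a + (t *: xi + v)) /\ sqnorm (t *: xi + v) <= 4 * t ^+ 2) ->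
  2^-1 * (2 * (c * t)) ^+ m <= mint K mu ((1 - U) ^+ (s * 2)).
Proof.
move=> s0 c0 t0 tD Kbox; have ct0 : 0 < c * t by exact: mulr_gt0.
have sR : (0 : R) < s%:R by rewrite ltr0n.
pose b := a + t *: xi.
pose I (i : 'I_m) : set (measurableTypeR R) :=
  `[b 0 i - c * t, b 0 i + c * t]%classic.
pose A := [set z : borelrV R m | forall i, I i ((z : 'rV[R]_m) 0 i)].
have AE z : A z -> exists2 v : 'rV[R]_m, forall i, `|v 0 i| <= c * t &
    z = a + (t *: xi + v).
  move=> Az; exists (z - b); last by rewrite addrA -/b addrC subrK.
  move=> i; have := Az i; rewrite /I/= in_itv/= !mxE => /andP[z1 z2].
  by rewrite ler_norml; apply/andP; split; lra.
have AK : A `<=` K by move=> z /AE[v vc ->]; exact: (Kbox v vc).1.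
have Ahalf z : A z -> 2^-1 <= mevalrV ((1 - U) ^+ (s * 2)) z.
  move=> Az; have := U01 (AK z Az); move: Az => /AE[v vc zE] /andP[U0 U1].
  have := (Kbox v vc).2; rewrite (_ : t *: xi + v = z - a); last first.
    by rewrite zE [RHS]addrC addKr.
  rewrite mevalrVXn mevalrVB mevalrV1 => Nz.
  have Us : mevalrV U z * s%:R <= 4^-1.
    rewrite UE mulrAC ler_pdivrMr//.
    have : sqnorm (z - a) * s%:R <= 4 * t ^+ 2 * s%:R by rewrite ler_pM2r.
    by move: tD; rewrite ler_pdivlMr// => *; lra.
  set u := mevalrV U z in U0 U1 Us *.
  have Bern k : 1 - k%:R * u <= (1 - u) ^+ k.
    elim: k => [|k IH]; first by rewrite mul0r subr0 expr0.
    rewrite exprS; apply: (@le_trans _ _ ((1 - u) * (1 - k%:R * u))).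
      rewrite -natr1; have : 0 <= u * (k%:R * u) by rewrite !mulr_ge0.
      lra.
    by rewrite ler_wpM2l//; lra.
  by apply: le_trans (Bern (s * 2)%N); rewrite natrM; lra.
have mI i : measurable (I i) by exact: measurable_itv.
have mA : measurable A.
  have -> : A = \bigcap_(i in [set: 'I_m])
      (fun z : borelrV R m => (z : 'rV[R]_m) 0 i) @^-1` I i.
    by apply/seteqP; split => z /= zI i; [move=> _|]; exact: zI.
  apply: fin_bigcap_measurable => [|i _]; first exact: finite_finset.
  rewrite -[X in measurable X]setTI.
  apply: measurable_fun_rV_continuous => //; last exact: mI.
  by move=> ?; exact: coord_continuous.
rewrite -lee_fin (mint_lebesgue_on mK Kmu _ intK).
apply: (@le_trans _ _ (\int[lebesgue_rV m]_z (2^-1 * \1_A z)%:E)%E).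
  under eq_integral do rewrite EFinM.
  rewrite ge0_integralZl//=; last exact/measurable_EFinP.
  rewrite integral_indic// setIT EFinM lee_wpmul2l ?lee_fin//.
  rewrite le_eqVlt; apply/orP; left; apply/eqP/esym.
  apply: (etrans (lebesgue_rV_box mI)).
  rewrite (eq_bigr (fun=> (2 * (c * t))%:E)) => [|i _]; last first.
    rewrite /I lebesgue_measure_itv/= lte_fin ltrD2l gtrN// -EFinB.
    by congr EFin; ring.
  by rewrite prodEFin prodr_const card_ord.
apply: ge0_le_integral => //; last 2 first.
- apply/(measurable_restrictT _ mK)/measurable_EFinP.
  exact: measurable_mevalrV.
- move=> z _; rewrite patchE indicE.
  have [Az|Az] := pselect (A z).
    by rewrite !mem_set ?mulr1 ?lee_fin ?Ahalf//; exact: AK.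
  rewrite memNset// mulr0; case: ifPn => // /[!inE] Kz.
  rewrite /= lee_fin mevalrVXn mevalrVB mevalrV1 exprn_ge0//.
  by have /andP[_ ?] := U01 Kz; lra.
- by apply/measurable_EFinP; apply: measurable_funM.
Qed.

End cone_gap.

(** With y = z - a and q = sqrt s, the linear term is at most |l|^2 / q + q |y|^2. The mean of |y|^2
    under [h] is of order 1/s, so both terms are of order 1 / sqrt s; this [q] balances them. *)
Lemma gap_cone_le (R : realType) m (K : set 'rV[R]_m)
    (mu : {finite_measure set (borelrV R m) -> \bar R}) B G M a :
  (0 < m)%N -> measurable (K : set (borelrV R m)) -> mpoly_integrable K mu ->
  0 < mint K mu 1 -> interior_cone K -> lebesgue_on K mu ->
  (forall z, K z -> forall i, `|z 0 i| <= B) ->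
  (forall z, K z -> mevalrV G z <= M) -> K a -> mevalrV G a = M ->
  exists C, forall r, (1 < r)%N -> gap K mu (mevalrV G) M r <= C / Num.sqrt r%:R.
Proof.
move=> m0 mK intK int1 Kcone Kmu KB GM Ka Ga.
have [xi [c [t0 [c0 t00 Kbox]]]] := interior_cone_boxes m0 Kcone Ka.
have Kya z : K z -> forall i, `|(z - a) 0 i| <= B + B.
  move=> Kz i; rewrite !mxE (le_trans (ler_normB _ _))//.
  by rewrite lerD// KB.
have B0 : 0 <= B + B by exact: le_trans (normr_ge0 _) (Kya a Ka (Ordinal m0)).
have [l [C C0 HC]] := first_order_mevalrV a G B0.
have [D' ND'] := mevalrV_bounded B (msqnorm a).
pose D := 2 * (`|D'| + 1).
have D0 : 0 < D by rewrite mulr_gt0// ltr_pwDr.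
pose U : mpoly m R := D^-1 *: msqnorm a.
have U01 z : K z -> 0 <= mevalrV U z <= 2^-1.
  move=> Kz; have := ND' z (KB z Kz); rewrite mevalrVZ msqnormE => ND.
  have N0 := sqnorm_ge0 (z - a).
  rewrite mulr_ge0 ?invr_ge0 ?(ltW D0)//= ler_pdivrMl// /D mulrAC mulfV// mul1r.
  by rewrite (le_trans (ler_norm _))// (le_trans ND)// (le_trans (ler_norm _))// lerDl.
(* The cube is taken at height [t1 / q]: the bound [t0] keeps it in the cone, the other two give 16
   t1^2 <= D. Its volume then has the same order s^(-m/2) as the Gaussian integral. *)
pose t1 := Num.min t0 (Num.min 1 (D / 16)).
have t10 : 0 < t1 by rewrite !lt_min t00 ltr01 divr_gt0.
have t1D : t1 ^+ 2 * 16 <= D.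
  rewrite -ler_pdivlMr// expr2; apply: (@le_trans _ _ (1 * t1)).
    by rewrite ler_pM2r// !ge_min lexx orbT.
  by rewrite mul1r !ge_min lexx !orbT.
pose A : R := (Num.sqrt pi * Num.sqrt D) ^+ m.
pose b : R := 2^-1 * (2 * (c * t1)) ^+ m.
have b0 : 0 < b by rewrite mulr_gt0// exprn_gt0// !mulr_gt0.
pose L : R := \sum_i l i ^+ 2.
have L0 : 0 <= L by apply: sumr_ge0 => i _; exact: sqr_ge0.
have A0 : 0 <= A by rewrite exprn_ge0// mulr_ge0 ?sqrtr_ge0.
exists (2 * (L + (1 + C) * D * (A / b))) => r r1.
pose s := (r %/ 2)%N; have s0 : (0 < s)%N by rewrite divn_gt0.
have [rs rs2] := divn2_bounds r1.
have rsR : r%:R <= 4 * s%:R :> R by rewrite -natrM ler_nat.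
have sR : (1 : R) <= s%:R by rewrite ler1n.
pose q := Num.sqrt s%:R : R.
have q2 : q ^+ 2 = s%:R by rewrite sqr_sqrtr// ler0n.
have q1 : 1 <= q by rewrite -sqrtr1 ler_sqrt.
have q0 : 0 < q by exact: lt_le_trans q1.
have Hd : mint K mu ((1 - U) ^+ s) <= A / b * mint K mu ((1 - U) ^+ (s * 2)).
  have H1 := mint_onemX_upper mK intK Kmu D0 U01 s0.
  have H2 : b / q ^+ m <= mint K mu ((1 - U) ^+ (s * 2)).
    have tq0 : 0 < t1 / q by rewrite divr_gt0.
    have tqt : t1 / q <= t0.
      rewrite ler_pdivrMr//; apply: (@le_trans _ _ (t0 * 1)).
        by rewrite mulr1 !ge_min lexx.
      by rewrite ler_pM2l.
    rewrite (_ : b / q ^+ m = 2^-1 * (2 * (c * (t1 / q))) ^+ m); last first.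
      by rewrite /b -mulrA -exprVn -exprMn -!mulrA.
    apply: (mint_onemX_lower mK intK Kmu D0 U01 s0 c0 tq0).
      rewrite exprMn exprVn q2 mulrAC ler_pM2r ?invr_gt0//.
      by rewrite ltr0n.
    by move=> v vc; apply: Kbox => //; rewrite tq0.
  apply: le_trans H1 _; rewrite -/A -/q.
  apply: (@le_trans _ _ (A / b * (b / q ^+ m))).
    by rewrite mulrA divfK// gt_eqF.
  by rewrite ler_wpM2l// divr_ge0// ltW.
have HU := mint_onemX_le mK intK U01 s0 Hd.
have h0 := mint_onemX_gt0 mK intK int1 U01 (s * 2).
set h := (1 - U) ^+ (s * 2) in HU h0 *.
apply: (@le_trans _ _ ((L + (1 + C) * D * (A / b)) / q)); last first.
  rewrite [2 * _]mulrC -[leRHS]mulrA ler_wpM2l//.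
    by rewrite addr_ge0// !mulr_ge0 ?invr_ge0 ?(ltW b0) ?(ltW D0)//; lra.
  rewrite ler_pdivlMr ?sqrtr_gt0 ?ltr0n ?(ltnW r1)// mulrC ler_pdivrMr//.
  rewrite (_ : 2 * q = Num.sqrt (4 * s%:R)); last first.
    by rewrite sqrtrM// (_ : 4 = 2 ^+ 2 :> R) ?sqrtr_sqr ?ger0_norm//; ring.
  by rewrite ler_sqrt// mulr_ge0.
have hz0 z : K z -> 0 <= mevalrV h z.
  move=> Kz; rewrite mevalrVXn mevalrVB mevalrV1 exprn_ge0//.
  by have /andP[_ ?] := U01 z Kz; lra.
have hr : sos r h.
  rewrite /h exprM; apply: sos_sqr; apply: (mdeg_leW rs2).
  apply: mdeg_leXn; apply: mdeg_leB; first exact: mdeg_le1.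
  exact/mdeg_leZ/mdeg_msqnorm.
apply: (gap_le mK intK int1 GM hr h0).
apply: (@le_trans _ _ (L / q * mint K mu h +
    (q + C) * D * mint K mu (U * h))).
  rewrite -mintZ// -mintZ// -mintD//; apply: ler_mint => // z Kz.
  rewrite mevalrVD !mevalrVZ !mevalrVM mevalrVB mevalrVC mulrA -mulrDl.
  rewrite ler_wpM2r ?hz0// mevalrVZ msqnormE.
  have := HC (z - a) (Kya z Kz); rewrite (addrC a) subrK Ga ler_norml.
  move=> /andP[Hl _].
  rewrite mulrA mulfK ?gt_eqF// mulrDl.
  suff : - \sum_i l i * (z - a) 0 i <= L / q + q * sqnorm (z - a) by lra.
  rewrite /L /sqnorm mulr_suml mulr_sumr -big_split -sumrN ler_sum//= => i _.
  set x := l i; set y := (z - a) 0 i.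
  (* Completing the square: - x y <= x^2 / (4q) + q y^2. *)
  have : 0 <= (x + 2 * q * y) ^+ 2 / q by rewrite divr_ge0 ?sqr_ge0 ?ltW.
  have -> : (x + 2 * q * y) ^+ 2 / q = x ^+ 2 / q + 4 * x * y + 4 * (q * y ^+ 2).
    by field; rewrite gt_eqF.
  have : 0 <= x ^+ 2 / q by rewrite divr_ge0 ?sqr_ge0 ?ltW.
  by lra.
have qC : 0 <= (q + C) * D by rewrite mulr_ge0 ?addr_ge0 ?(ltW q0) ?(ltW D0).
apply: (@le_trans _ _ (L / q * mint K mu h +
    (q + C) * D * (A / b / s%:R * mint K mu h))).
  by rewrite lerD2l ler_wpM2l.
rewrite [(q + C) * D * _]mulrA -mulrDl ler_pM2r// [leRHS]mulrDl lerD2l -q2 expr2.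
have -> : (q + C) * D * (A / b / (q * q)) = (q + C) / q * (D * (A / b) / q).
  have aux (x y u w : R) : x * y * (u / (w * w)) = x / w * (y * u / w).
    by rewrite invfM; ring.
  exact: aux.
have -> : (1 + C) * D * (A / b) / q = (1 + C) * (D * (A / b) / q) by ring.
rewrite ler_wpM2r//; first by rewrite !mulr_ge0 ?invr_ge0 ?(ltW b0) ?(ltW D0) ?(ltW q0).
by rewrite ler_pdivrMr// mulrDl mul1r lerD2l ler_peMr.
Qed.

(** * Moment growth condition *)

Section exponential_series.
Context {R : realType}.
Implicit Types (x y : R) (n : nat).

Lemma cvg_series_cos_coeff x : series (cos_coeff x) n @[n --> \oo] --> cos x.
Proof. by rewrite unlock; exact: is_cvg_series_cos_coeff. Qed.

Lemma cvg_series_exp_coeff x : series (exp_coeff x) n @[n --> \oo] --> expR x.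
Proof. exact: is_cvg_series_exp_coeff. Qed.

Lemma series_cos_coeff_le x n : `|series (cos_coeff x) n| <= expR `|x|.
Proof.
apply: (@le_trans _ _ (series (exp_coeff `|x|) n)).
  rewrite /series/= (le_trans (ler_norm_sum _ _ _))// ler_sum// => k _.
  rewrite /cos_coeff/exp_coeff/= !normrM normfV !normr_nat !normrX normrN normr1.
  rewrite expr1n mulr1 ler_wpM2r ?invr_ge0// ler_piMl ?exprn_ge0//.
  by case: odd.
have nd : nondecreasing_seq (series (exp_coeff `|x|)).
  apply/nondecreasing_seqP => k; rewrite /series/= big_nat_recr//= lerDl.
  exact: exp_coeff_ge0.
have := nondecreasing_cvgn_le nd (is_cvg_series_exp_coeff _) n.
exact.
Qed.

Lemma expR_norm_le x : expR `|x| <= expR x + expR (- x).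
Proof.
by have [x0|x0] := ger0P x; rewrite ?lerDl ?lerDr expR_ge0.
Qed.

Lemma sin_sqr_ge x : x ^+ 2 <= 1 -> x ^+ 2 * (1 - x ^+ 2) <= sin x ^+ 2.
Proof.
move=> x1; wlog x0 : x x1 / 0 <= x => [H|].
  have [x0|/ltW x0] := leP 0 x; first exact: H.
  rewrite -(sqrrN x) -(sqrrN (sin x)) -sinN; apply: H; first by rewrite sqrrN.
  by rewrite oppr_ge0.
have [c] : exists2 c, c \in `[0, x] & sin x - sin 0 = cos c * (x - 0).
  apply: MVT_segment => //.
  exact/continuous_subspaceT/continuous_sin.
rewrite in_itv/= sin0 !subr0 => /andP[c0 cx] ->; rewrite exprMn mulrC.
rewrite ler_wpM2r ?sqr_ge0//.
have cc : c ^+ 2 <= x ^+ 2 by rewrite lerXn2r.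
have := onem_cos_le c => ?.
apply: (@le_trans _ _ ((1 - x ^+ 2 / 2) ^+ 2)).
  by rewrite [leRHS](_ : _ = 1 - x ^+ 2 + (x ^+ 2 / 2) ^+ 2) ?lerDl ?sqr_ge0//; field.
by rewrite lerXn2r ?nnegrE//; lra.
Qed.

(* Squeeze: with s = sin^2 (y / sqrt n), the value (1 - s)^n lies between
   exp (- n s / (1 - s)) and exp (- n s), and n s --> y^2. *)
Lemma cvg_cos_pow_gauss y :
  cos (y / Num.sqrt n.+1%:R) ^+ (2 * n.+1) @[n --> \oo] --> expR (- y ^+ 2).
Proof.
pose X n : R := y ^+ 2 / n.+1%:R.
have X0 n : 0 <= X n by rewrite divr_ge0 ?sqr_ge0.
have cvgX : X n @[n --> \oo] --> 0.
  rewrite -[X in _ --> X](mulr0 (y ^+ 2)).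
  by apply: cvgM; [exact: cvg_cst|exact: cvg_harmonic].
have nX n : n.+1%:R * X n = y ^+ 2 by rewrite /X mulrC divfK// pnatr_eq0.
apply: (@squeeze_cvgr _ _ _ _ (fun n => expR (- (y ^+ 2 / (1 - X n))))
  (fun n => expR (- (y ^+ 2 * (1 - X n))))).
- near=> n.
  have X1 : X n < 2^-1.
    by near: n; apply: (cvgr_lt _ cvgX).
  set x := y / Num.sqrt n.+1%:R.
  have xX : x ^+ 2 = X n by rewrite exprMn exprVn sqr_sqrtr.
  have n0 : (0 : R) < n.+1%:R by rewrite ltr0n.
  rewrite exprM cos2sin2; set s := sin x ^+ 2.
  have s0 : 0 <= s by exact: sqr_ge0.
  have sX : s <= X n.
    rewrite -xX /s -(real_normK (num_real (sin x))) -(real_normK (num_real x)).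
    by rewrite lerXn2r ?nnegrE// norm_sin_le.
  have sX' : X n * (1 - X n) <= s by rewrite -xX; apply: sin_sqr_ge; rewrite xX; lra.
  apply/andP; split.
    apply: (@le_trans _ _ (expR (- (s / (1 - s))) ^+ n.+1)).
      rewrite -expRM_natl ler_expR mulrN lerN2 -(nX n) -mulrA ler_pM2l//.
      rewrite ler_pM ?invr_ge0//; first by lra.
      by rewrite lef_pV2 ?posrE; lra.
    rewrite lerXn2r ?nnegrE ?expR_ge0//; first by lra.
    have s1 : 0 < 1 - s by lra.
    rewrite expRN invf_ple ?posrE ?expR_gt0//.
    apply: le_trans (expR_ge1Dx _).
    by rewrite [leRHS](_ : _ = (1 - s)^-1)//; field; rewrite gt_eqF.
  apply: (@le_trans _ _ (expR (- s) ^+ n.+1)).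
    by rewrite lerXn2r ?nnegrE ?expR_ge0 ?expR_ge1Dx//; lra.
  by rewrite -expRM_natl ler_expR mulrN lerN2 -{1}(nX n) -mulrA ler_pM2l.
- apply: continuous_cvg; first exact: continuous_expR.
  apply: cvgN; rewrite -[X in _ --> X]mulr1; apply: cvgM; first exact: cvg_cst.
  rewrite -[X in _ --> X]invr1; apply: cvgV; first exact: oner_neq0.
  by rewrite -[X in _ --> X]subr0; apply: cvgB => //; exact: cvg_cst.
- apply: continuous_cvg; first exact: continuous_expR.
  apply: cvgN; rewrite -[X in _ --> X]mulr1; apply: cvgM; first exact: cvg_cst.
  by rewrite -[X in _ --> X]subr0; apply: cvgB => //; exact: cvg_cst.
Unshelve. all: by end_near. Qed.

End exponential_series.

Section integrable_EFin.
Context d (T : measurableType d) (R : realType).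
Variables (mu : {measure set T -> \bar R}) (D : set T).
Hypothesis mD : measurable D.
Implicit Types f g : T -> R.

Lemma integrable_EFinD f g :
  mu.-integrable D (EFin \o f) -> mu.-integrable D (EFin \o g) ->
  mu.-integrable D (EFin \o (fun x => f x + g x)).
Proof. by move=> fi gi; exact: (integrableD mD fi gi). Qed.

Lemma integrable_EFinZ c f : mu.-integrable D (EFin \o f) ->
  mu.-integrable D (EFin \o (fun x => c * f x)).
Proof. by move=> fi; exact: (integrableZl mD c fi). Qed.

Lemma integrable_EFin_sum I (s : seq I) (P : pred I) (F : I -> T -> R) :
  (forall i, mu.-integrable D (EFin \o F i)) ->
  mu.-integrable D (EFin \o (fun x => \sum_(i <- s | P i) F i x)).
Proof.
move=> Fi; elim: s => [|i s IH].
  under eq_fun do rewrite big_nil.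
  exact: (integrable0 mu D).
apply: (@eq_integrable _ _ _ mu D mD (EFin \o (fun x =>
    (if P i then F i x else 0) + \sum_(i <- s | P i) F i x))).
  by move=> x _ /=; rewrite big_cons; case: ifP => // _; rewrite add0r.
apply: integrable_EFinD => //; case: (P i) => //.
exact: (integrable0 mu D).
Qed.

Lemma le_integrable_EFin f g : measurable_fun D f ->
  (forall x, D x -> `|f x| <= g x) -> mu.-integrable D (EFin \o g) ->
  mu.-integrable D (EFin \o f).
Proof.
move=> mf fg gi; apply: (le_integrable mD _ _ gi); first exact/measurable_EFinP.
by move=> x Dx /=; rewrite lee_fin (le_trans (fg x Dx))// ler_norm.
Qed.

End integrable_EFin.

(** * Integrability of polynomials and exponentials *)

Section moments.
Context {R : realType} {m : nat}.
Hypothesis m_gt0 : (0 < m)%N.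
Variables (K : set 'rV[R]_m)
  (mu : {finite_measure set (borelrV R m) -> \bar R}).
Hypothesis mK : measurable (K : set (borelrV R m)).
Hypothesis Kmu : cond_moments K mu.
Local Notation KT := (K : set (borelrV R m)).

(** The moment condition only controls even powers of single coordinates. A monomial is dominated by
    the power of its largest coordinate, which is at most 1 or at most its own square. *)
Lemma monomial_le (e : multinom m) (z : 'rV[R]_m) :
  `|\prod_i z 0 i ^+ e i| <= 1 + \sum_i z 0 i ^+ (2 * mdeg e).
Proof.
have [j jmax] : exists j, forall i, `|z 0 i| <= `|z 0 j|.
  have := @arg_maxP _ _ 'I_m (Ordinal m_gt0) predT (fun i => `|z 0 i|) isT.
  case=> j _ jm.
  by exists j => i; exact: jm.
rewrite normr_prod; apply: (@le_trans _ _ (`|z 0 j| ^+ mdeg e)).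
  rewrite mdegE -prodrXr; apply: ler_prod => i _.
  by rewrite normrX exprn_ge0//= lerXn2r ?nnegrE.
have [j1|j1] := leP `|z 0 j| 1.
  rewrite (@le_trans _ _ 1) ?exprn_ile1// lerDl sumr_ge0// => i _.
  by rewrite exprM exprn_ge0 ?sqr_ge0.
rewrite (bigD1 j)//= addrCA (@le_trans _ _ (z 0 j ^+ (2 * mdeg e)))//.
  rewrite exprM -real_normK ?num_real// -exprM ler_eXn2l//; first by lia.
rewrite lerDl addr_ge0// sumr_ge0// => i _.
by rewrite exprM exprn_ge0 ?sqr_ge0.
Qed.

Lemma moments_integrable_pow i k :
  mu.-integrable KT (EFin \o (fun z => z 0 i ^+ (2 * k))).
Proof.
have [_ _ [M M0 HM]] := Kmu; apply/integrableP; split.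
  apply/measurable_EFinP.
  have := @measurable_mevalrV R m (mpolyX R (mnm1 i) ^+ (2 * k)) KT.
  by apply: eq_measurable_fun => z _; rewrite mevalrVXn mevalrVX.
rewrite (eq_integral (fun z : borelrV R m => ((z : 'rV[R]_m) 0 i ^+ (2 * k))%:E)).
  exact: le_lt_trans (HM i k) (ltry _).
by move=> z _; rewrite /= ger0_norm// exprM exprn_ge0// sqr_ge0.
Qed.

Lemma moments_cst_integrable (c : R) : mu.-integrable KT (EFin \o (fun=> c)).
Proof.
apply: measurable_bounded_integrable => //.
- by rewrite -ge0_fin_numE// fin_num_measure.
- by exists `|c|; split; [exact: num_real|move=> x cx z _; exact: ltW].
Qed.

Lemma moments_integrable : mpoly_integrable K mu.
Proof.
move=> p; rewrite (_ : mevalrV p = fun z => \sum_(e <- msupp p)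
    mcoeff e p * \prod_i z 0 i ^+ e i); last first.
  by apply/funext => z; rewrite /mevalrV mevalE.
apply: integrable_EFin_sum => // e; apply: integrable_EFinZ => //.
apply: (@le_integrable_EFin _ _ _ mu KT mK _
  (fun z : borelrV R m => 1 + \sum_i (z : 'rV[R]_m) 0 i ^+ (2 * mdeg e))).
- have := @measurable_mevalrV R m (mpolyX R e) KT.
  by apply: eq_measurable_fun => z _; rewrite /mevalrV mevalX.
- by move=> z _; exact: monomial_le.
apply: integrable_EFinD => //; first exact: moments_cst_integrable.
by apply: integrable_EFin_sum => // i; exact: moments_integrable_pow.
Qed.

Lemma measurable_coord_fun (h : R -> R) i : continuous h ->
  measurable_fun KT (fun z : borelrV R m => h ((z : 'rV[R]_m) 0 i)).
Proof.
move=> ch; apply: measurable_funTS; apply: measurable_fun_rV_continuous => z.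
by apply: (@continuous_comp _ _ _ (fun z : 'rV[R]_m => z 0 i) h);
  [exact: coord_continuous|exact: ch].
Qed.

(** Here the factorial growth is used. In the sum of the two exponential series the odd terms cancel
    and the term of even degree k is nonnegative with integral at most 2 M c^k, so monotone
    convergence bounds the integral by 2M / (1 - c). *)
Lemma moments_integrable_cosh i (c : R) : 0 <= c < 1 ->
  mu.-integrable KT
    (EFin \o (fun z => expR (c * z 0 i) + expR (- (c * z 0 i)))).
Proof.
move=> /andP[c0 c1]; have [_ _ [M M0 HM]] := Kmu.
have intK := moments_integrable.
pose cosh x : R := expR x + expR (- x).
have ccosh : continuous (fun t : R => cosh (c * t)).
  have cl : continuous (fun t : R => c * t).
    by move=> t; apply: cvgM; [exact: cvg_cst|exact: cvg_id].
  move=> t; apply: cvgD; apply: continuous_cvg; try exact: continuous_expR.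
    exact: cl.
  by apply: cvgN; exact: cl.
have mcosh : measurable_fun KT (fun z : borelrV R m => cosh (c * (z : 'rV[R]_m) 0 i)).
  exact: (measurable_coord_fun (h := fun t => cosh (c * t))).
pose a (k : nat) : mpoly m R :=
  (k`!%:R)^-1 *: ((c *: mpolyX R (mnm1 i)) ^+ k + (- c *: mpolyX R (mnm1 i)) ^+ k).
have aE k z : mevalrV (a k) z =
    exp_coeff (c * z 0 i) k + exp_coeff (- (c * z 0 i)) k.
  rewrite /a mevalrVZ mevalrVD !mevalrVXn !mevalrVZ !mevalrVX /exp_coeff/=.
  by rewrite mulNr mulrDr ![_^-1 * _]mulrC.
have a0 k z : 0 <= mevalrV (a k) z.
  rewrite aE /exp_coeff/= -mulrDl divr_ge0// exprNn.
  rewrite -{1}[_ ^+ k]mul1r -mulrDl -signr_odd.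
  have := odd_double_half k; case: (odd k) => kE.
    by rewrite expr1 subrr mul0r.
  rewrite expr0 mulr_ge0//.
  by rewrite -kE add0n -mul2n exprM exprn_ge0 ?sqr_ge0.
have a_le k : mint K mu (a k) <= 2 * M * c ^+ k.
  have [j kE] : exists j, k = (odd k + 2 * j)%N.
    by exists k./2; rewrite mul2n odd_double_half.
  move: kE; case ok : (odd k) => kE.
    rewrite (_ : a k = 0) ?mint0// ?mulr_ge0 ?exprn_ge0 ?(ltW M0)//.
    by rewrite /a scaleNr exprNn -signr_odd ok expr1 mulN1r subrr scaler0.
  rewrite add0n in kE.
  have -> : a k = (2 * c ^+ k / k`!%:R) *: mpolyX R (mnm1 i) ^+ k.
    rewrite /a scaleNr exprNn -signr_odd ok expr0 mul1r.
    by rewrite exprZn -scalerDl scalerA; congr (_ *: _); ring.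
  rewrite mintZ//; set I := mint _ _ _.
  rewrite (_ : _ * I = 2 * (I / k`!%:R) * c ^+ k); last by ring.
  rewrite ler_wpM2r ?exprn_ge0// ler_pM2l// ler_pdivrMr ?ltr0n ?fact_gt0// mulrC.
  have := HM i j; rewrite -kE.
  rewrite (_ : (fun z => _) = fun z => (mevalrV (mpolyX R (mnm1 i) ^+ k) z)%:E).
    by rewrite integral_mevalrV// lee_fin.
  by apply/funext => z; rewrite mevalrVXn mevalrVX.
pose f n (z : borelrV R m) : \bar R := (mevalrV (\sum_(k < n) a k) z)%:E.
have If n : (\int[mu]_(z in KT) f n z <= (2 * M / (1 - c))%:E)%E.
  rewrite integral_mevalrV// lee_fin mint_sum//.
  apply: (@le_trans _ _ (\sum_(k < n) 2 * M * c ^+ k)).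
    by apply: ler_sum => k _; exact: a_le.
  rewrite -mulr_sumr ler_wpM2l ?mulr_ge0 ?(ltW M0)// -[_^-1]mul1r.
  rewrite ler_pdivlMr ?subr_gt0//.
  have := subrX1 c n; have : 0 <= c ^+ n by exact: exprn_ge0.
  set S := \sum_(k < n) _ => cn SE.
  rewrite (_ : S * (1 - c) = - ((c - 1) * S)); last by ring.
  by rewrite -SE; lra.
have mf n : measurable_fun KT (f n).
  by apply/measurable_EFinP; exact: measurable_mevalrV.
have f0 n z : KT z -> (0 <= f n z)%E.
  by move=> _; rewrite lee_fin mevalrV_sum sumr_ge0.
have nd z : KT z -> nondecreasing_seq (f ^~ z).
  move=> _; apply/nondecreasing_seqP => n.
  by rewrite lee_fin big_ord_recr/= mevalrVD lerDl.
have flim z : KT z -> limn (f ^~ z) = (cosh (c * (z : 'rV[R]_m) 0 i))%:E.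
  move=> _; apply/cvg_lim => //; apply: cvg_EFin; first exact: nearW.
  under eq_cvg do rewrite /= mevalrV_sum.
  rewrite (_ : (fun n => _) = fun n => series (exp_coeff (c * z 0 i)) n +
      series (exp_coeff (- (c * z 0 i))) n).
    by apply: cvgD; exact: cvg_series_exp_coeff.
  apply/funext => n; rewrite /series/= !big_mkord -big_split/=.
  by apply: eq_bigr => k _; rewrite aE.
apply/integrableP; split; first exact/measurable_EFinP.
under eq_integral do rewrite /= ger0_norm ?addr_ge0 ?expR_ge0//.
apply: (@le_lt_trans _ _ (2 * M / (1 - c))%:E); last exact: ltry.
rewrite (_ : (\int[mu]_(z in KT) _)%E = (\int[mu]_(z in KT) limn (f ^~ z))%E).
  rewrite monotone_convergence//; apply: lime_le.
    apply: ereal_nondecreasing_is_cvgn => n1 n2 n12.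
    apply: ge0_le_integral => // [z Kz|z Kz]; first exact: f0.
    exact: nd.
  exact: nearW.
by apply: eq_integral => z /[!inE] Kz; rewrite flim.
Qed.

(** The polynomial factor is separated by |x y| <= x^2 + y^2; squaring the exponential doubles [c],
    hence the bound 1/2. *)
Lemma moments_integrable_exp i (c : R) p : 0 <= c < 2^-1 ->
  mu.-integrable KT (EFin \o (fun z => mevalrV p z * expR (c * `|z 0 i|))).
Proof.
move=> /andP[c0 c1].
have mexp : measurable_fun KT
    (fun z : borelrV R m => expR (c * `|(z : 'rV[R]_m) 0 i|)).
  apply: (measurable_coord_fun (h := fun t => expR (c * `|t|))) => t.
  apply: continuous_cvg; first exact: continuous_expR.
  by apply: cvgM; [exact: cvg_cst|exact: norm_continuous].
apply: (@le_integrable_EFin _ _ _ mu KT mK _ (fun z : borelrV R m =>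
    mevalrV (p ^+ 2) z + (expR ((2 * c) * (z : 'rV[R]_m) 0 i) +
       expR (- ((2 * c) * (z : 'rV[R]_m) 0 i))))).
- by apply: measurable_funM => //; exact: measurable_mevalrV.
- move=> z _; rewrite mevalrVXn normrM (ger0_norm (expR_ge0 _)).
  set x := mevalrV p z; set y := expR _.
  have y2 : y ^+ 2 <= expR ((2 * c) * (z : 'rV[R]_m) 0 i) +
       expR (- ((2 * c) * (z : 'rV[R]_m) 0 i)).
    apply: le_trans (expR_norm_le _); rewrite /y -expRM_natl ler_expR.
    by rewrite !normrM (ger0_norm c0) (ger0_norm (_ : 0 <= 2))// mulrA.
  apply: le_trans (lerD (lexx _) y2); rewrite -[x ^+ 2]real_normK ?num_real//.
  have := sqr_ge0 (`|x| - y); have : 0 <= `|x| * y by rewrite mulr_ge0 ?expR_ge0.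
  by rewrite !expr2; lra.
- apply: integrable_EFinD => //; first exact: moments_integrable.
  by apply: moments_integrable_cosh; apply/andP; split; lra.
Qed.

End moments.

(** * From nonnegativity on squares to nonnegativity at a point *)

Section moment_problem.
Context {R : realType} {m : nat}.
Hypothesis m_gt0 : (0 < m)%N.
Variables (K : set 'rV[R]_m)
  (mu : {finite_measure set (borelrV R m) -> \bar R}).
Hypothesis mK : measurable (K : set (borelrV R m)).
Hypothesis Kmu : cond_moments K mu.
Variables (W : mpoly m R) (a : 'rV[R]_m).
Hypothesis W_sos : forall p, 0 <= mint K mu (W * p ^+ 2).
Local Notation KT := (K : set (borelrV R m)).

Let intK : mpoly_integrable K mu.
Proof. exact: moments_integrable. Qed.

(** The factors [g] that may be inserted next to the polynomial without losing nonnegativity; the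
    bound by 1 lets dominated convergence ignore those already inserted. *)
Definition sqr_positive (g : borelrV R m -> R) := [/\ measurable_fun KT g,
  forall z, `|g z| <= 1 &
  forall p, (0 <= \int[mu]_(z in KT) ((mevalrV p z * g z) ^+ 2 * mevalrV W z)%:E)%E].

Lemma sqr_positive1 : sqr_positive (fun=> 1).
Proof.
split => // [z|p]; first by rewrite normr1.
have := W_sos p; rewrite -lee_fin -integral_mevalrV//.
rewrite (eq_integral (fun z : borelrV R m =>
  ((mevalrV p z * 1) ^+ 2 * mevalrV W z)%:E))// => z _.
by rewrite mevalrVM mevalrVXn mulr1 mulrC.
Qed.

Let lim_ge0 (u : nat -> \bar R) l : (forall n, 0 <= u n)%E ->
  u n @[n --> \oo] --> l -> (0 <= l)%E.
Proof.
move=> u0 ul; rewrite -(cvg_lim _ ul)//.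
by apply: lime_ge; [exact: cvgP ul|exact: nearW].
Qed.

(** If [T n] is a Taylor polynomial of the cosine, [p * T n] is again a polynomial, so the
    hypothesis on [g] applies to it. Its square costs exp (2t |z_i - a_i|), and 2t <= 1/4 is within
    the range of [moments_integrable_exp]. *)
Lemma sqr_positive_cos g i t : 0 <= t <= 8^-1 -> sqr_positive g ->
  sqr_positive (fun z => g z * cos (t * ((z : 'rV[R]_m) - a) 0 i)).
Proof.
move=> /andP[t0 t1] [mg g1 gpos].
have mcos : measurable_fun KT (fun z : borelrV R m => cos (t * ((z : 'rV[R]_m) - a) 0 i)).
  apply: (@eq_measurable_fun _ _ _ _ KT (fun z : borelrV R m =>
      cos (t * ((z : 'rV[R]_m) 0 i - a 0 i)))).
    by move=> z _; rewrite !mxE.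
  apply: (measurable_coord_fun (h := fun x => cos (t * (x - a 0 i)))) => x.
  apply: (@continuous_comp _ _ _ (fun x => t * (x - a 0 i)) cos).
    by apply: cvgM; [exact: cvg_cst|apply: cvgB; [exact: cvg_id|exact: cvg_cst]].
  exact: continuous_cos.
split => [|z|p]; first exact: measurable_funM.
  by rewrite normrM mulr_ile1// cos_max.
pose T n : mpoly m R := \sum_(k < n) cos_coeff 1 k *: (t *: mshift a i) ^+ k.
have TE n z : mevalrV (T n) z = series (cos_coeff (t * (z - a) 0 i)) n.
  rewrite /series/= big_mkord mevalrV_sum; apply: eq_bigr => k _.
  rewrite mevalrVZ mevalrVXn mevalrVZ mshiftE /cos_coeff/= expr1n mulr1.
  by rewrite mulrAC.
pose f n (z : borelrV R m) : \bar R :=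
  ((mevalrV (p * T n) z * g z) ^+ 2 * mevalrV W z)%:E.
pose F (z : borelrV R m) : \bar R :=
  ((mevalrV p z * (g z * cos (t * ((z : 'rV[R]_m) - a) 0 i))) ^+ 2 * mevalrV W z)%:E.
pose D (z : borelrV R m) : \bar R := (expR (2 * t * `|a 0 i|) *
  `|mevalrV (p ^+ 2 * W) z * expR (2 * t * `|(z : 'rV[R]_m) 0 i|)|)%:E.
have mf n : measurable_fun KT (f n).
  apply/measurable_EFinP/measurable_funM; last exact: measurable_mevalrV.
  by apply/measurable_funX/measurable_funM => //; exact: measurable_mevalrV.
have mF : measurable_fun KT F.
  apply/measurable_EFinP/measurable_funM; last exact: measurable_mevalrV.
  apply/measurable_funX/measurable_funM; first exact: measurable_mevalrV.
  exact: measurable_funM.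
have fF z : KT z -> f n z @[n --> \oo] --> F z.
  move=> _; apply: cvg_EFin; first exact: nearW.
  apply: cvgM; last exact: cvg_cst.
  have H : mevalrV (p * T n) z * g z @[n --> \oo] -->
      mevalrV p z * (g z * cos (t * ((z : 'rV[R]_m) - a) 0 i)).
    rewrite mulrCA mulrC; apply: cvgM; last exact: cvg_cst.
    under eq_cvg do rewrite mevalrVM TE.
    by apply: cvgM; [exact: cvg_cst|exact: cvg_series_cos_coeff].
  by rewrite expr2; under eq_cvg do rewrite /= expr2; exact: (cvgM H H).
have iD : mu.-integrable KT D.
  apply: integrable_EFinZ => //; apply: integrable_norm => //.
  by apply: moments_integrable_exp => //; apply/andP; split; lra.
have fD n z : KT z -> (`|f n z| <= D z)%E.
  move=> _; rewrite /f /D /= lee_fin mevalrVM TE.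
  set x := t * _; set y := mevalrV p z; set w := mevalrV W z.
  set S := series _ _; set e1 := expR _; set e2 := expR (2 * t * `|(z : 'rV[R]_m) 0 i|).
  have -> : `|(y * S * g z) ^+ 2 * w| = `|y| ^+ 2 * `|S| ^+ 2 * `|g z| ^+ 2 * `|w|.
    by rewrite -!normrX -!normrM; congr `|_|; ring.
  have -> : `|mevalrV (p ^+ 2 * W) z * e2| = `|y| ^+ 2 * `|w| * e2.
    rewrite mevalrVM mevalrVXn normrM (ger0_norm (expR_ge0 _)); congr (_ * _).
    by rewrite -normrX -normrM.
  have S2 : `|S| ^+ 2 <= e1 * e2.
    apply: (@le_trans _ _ (expR `|x| ^+ 2)).
      by rewrite lerXn2r ?nnegrE ?expR_ge0// series_cos_coeff_le.
    rewrite -expRM_natl -expRD ler_expR -mulrDr -mulrA ler_pM2l//.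
    rewrite /x normrM (ger0_norm t0) ler_wpM2l// !mxE.
    by rewrite [leRHS]addrC (le_trans (ler_normB _ _)).
  have g2 : `|g z| ^+ 2 <= 1 by rewrite exprn_ile1.
  apply: (@le_trans _ _ (`|y| ^+ 2 * (`|S| ^+ 2) * `|w|)).
    by rewrite ler_wpM2r// ler_piMr// mulr_ge0 ?exprn_ge0.
  rewrite [leRHS](_ : _ = `|y| ^+ 2 * (e1 * e2) * `|w|); last by ring.
  by rewrite ler_wpM2r// ler_wpM2l// exprn_ge0.
have := @dominated_convergence _ _ _ mu KT mK f F D mf mF
  (aeW _ fF) iD (aeW _ (fun z n => fD n z)).
move=> [_ _]; apply: lim_ge0 => n /=; exact: gpos.
Qed.

Lemma sqr_positive_prod_cos t n : 0 <= t <= 8^-1 ->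
  sqr_positive (fun z => \prod_i cos (t * ((z : 'rV[R]_m) - a) 0 i) ^+ n).
Proof.
move=> t01; elim: (index_enum _) => [|i s IH].
  by under eq_fun do rewrite big_nil; exact: sqr_positive1.
under eq_fun do rewrite big_cons mulrC.
suff H k : sqr_positive (fun z =>
    \prod_(i <- s) cos (t * ((z : 'rV[R]_m) - a) 0 i) ^+ n *
      cos (t * ((z : 'rV[R]_m) - a) 0 i) ^+ k) by exact: H.
elim: k => [|k IHk]; first by under eq_fun do rewrite expr0 mulr1.
by under eq_fun do rewrite exprSr mulrA; exact: sqr_positive_cos.
Qed.

Let integrable_bounded_mul (g : borelrV R m -> R) p : measurable_fun KT g ->
  (forall z, `|g z| <= 1) ->
  mu.-integrable KT (EFin \o (fun z => g z * mevalrV p z)).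
Proof.
move=> mg g1; have := integrable_norm (intK p).
apply: (@le_integrable_EFin _ _ _ mu KT mK _ (fun z => `|mevalrV p z|)).
  by apply: measurable_funM => //; exact: measurable_mevalrV.
by move=> z _; rewrite normrM ler_piMl.
Qed.

Let measurable_gauss (tau : R) :
  measurable_fun KT (fun z : borelrV R m => expR (- (tau ^+ 2 * sqnorm ((z : 'rV[R]_m) - a)))).
Proof.
apply: (@eq_measurable_fun _ _ _ _ KT (expR \o mevalrV (- (tau ^+ 2 *: msqnorm a)))).
  by move=> z _ /=; rewrite -scaleNr mevalrVZ msqnormE mulNr.
by apply: measurableT_comp => //; exact: measurable_mevalrV.
Qed.

Let gauss_le1 (tau : R) (z : 'rV[R]_m) :
  `|expR (- (tau ^+ 2 * sqnorm (z - a)))| <= 1.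
Proof.
rewrite ger0_norm ?expR_ge0// -expR0 ler_expR oppr_le0 mulr_ge0 ?sqr_ge0//.
exact: sqnorm_ge0.
Qed.

Lemma integral_gauss_ge0 tau : 0 <= tau ->
  (0 <= \int[mu]_(z in KT)
    (expR (- (tau ^+ 2 * sqnorm ((z : 'rV[R]_m) - a))) * mevalrV W z)%:E)%E.
Proof.
(* Shifting the sequence by [N] makes tau / sqrt (n + N + 1) <= 1/8 for every [n]. *)
move=> tau0; pose N := Num.bound ((8 * tau) ^+ 2).
have tN n : 0 <= tau / Num.sqrt (n + N).+1%:R <= 8^-1.
  have s0 : (0 : R) < Num.sqrt (n + N).+1%:R by rewrite sqrtr_gt0.
  rewrite divr_ge0 ?(ltW s0)//= ler_pdivrMr// -ler_pdivrMl ?invr_gt0// invrK.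
  rewrite -[leLHS]ger0_norm ?mulr_ge0// -sqrtr_sqr ler_sqrt//.
  have := archi_boundP (sqr_ge0 (8 * tau)); rewrite -/N => /ltW/le_trans; apply.
  by rewrite ler_nat leqW// leq_addl.
pose f n (z : borelrV R m) : \bar R :=
  ((mevalrV 1 z * \prod_i cos (tau / Num.sqrt (n + N).+1%:R *
     ((z : 'rV[R]_m) - a) 0 i) ^+ (n + N).+1) ^+ 2 * mevalrV W z)%:E.
pose F (z : borelrV R m) : \bar R :=
  (expR (- (tau ^+ 2 * sqnorm ((z : 'rV[R]_m) - a))) * mevalrV W z)%:E.
have pos n := sqr_positive_prod_cos (n + N).+1 (tN n).
have mf n : measurable_fun KT (f n).
  apply/measurable_EFinP/measurable_funM; last exact: measurable_mevalrV.
  apply/measurable_funX/measurable_funM; first exact: measurable_mevalrV.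
  by have [] := pos n.
have mF : measurable_fun KT F.
  by apply/measurable_EFinP/measurable_funM; last exact: measurable_mevalrV.
have fF z : KT z -> f n z @[n --> \oo] --> F z.
  move=> _; apply: cvg_EFin; first exact: nearW.
  apply: cvgM; last exact: cvg_cst.
  rewrite /sqnorm mulr_sumr -sumrN expR_sum.
  have H i : cos (tau / Num.sqrt (n + N).+1%:R * ((z : 'rV[R]_m) - a) 0 i)
        ^+ (2 * (n + N).+1) @[n --> \oo] -->
      expR (- (tau ^+ 2 * ((z : 'rV[R]_m) - a) 0 i ^+ 2)).
    have := @cvg_cos_pow_gauss R (tau * ((z : 'rV[R]_m) - a) 0 i).
    rewrite exprMn -(cvg_shiftn N).
    rewrite [X in X x @[x --> _] --> _](_ : _ = fun n => cos (tau /
      Num.sqrt (n + N).+1%:R * ((z : 'rV[R]_m) - a) 0 i) ^+ (2 * (n + N).+1))//.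
    by apply/funext => n /=; rewrite mulrAC.
  rewrite (_ : (fun n => _) = fun n => \prod_i
      cos (tau / Num.sqrt (n + N).+1%:R * ((z : 'rV[R]_m) - a) 0 i)
        ^+ (2 * (n + N).+1)); last first.
    apply/funext => n; rewrite mevalrV1 mul1r -prodrXl.
    by apply: eq_bigr => i _; rewrite -exprM mulnC.
  by apply: cvg_big => //; exact: mul_continuous.
have fD n z : KT z -> (`|f n z| <= (`|mevalrV W z|)%:E)%E.
  move=> _; have [_ /(_ z) p1 _] := pos n.
  rewrite /f abse_EFin lee_fin normrM mevalrV1 mul1r ler_piMl//.
  by rewrite normrX exprn_ile1.
have := @dominated_convergence _ _ _ mu KT mK f F _ mf mF
  (aeW _ fF) (integrable_norm (intK W)) (aeW _ (fun z n => fD n z)).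
move=> [_ _]; apply: lim_ge0 => n /=.
by have [_ _] := pos n; exact.
Qed.

(* Laplace's method: the Gaussian weight concentrates at a. *)
Lemma moment_positive : is_support mu K -> K a -> 0 <= mevalrV W a.
Proof.
move=> [cK muK supp] Ka; rewrite leNgt; apply/negP => Wa.
pose de := - mevalrV W a / 2.
have de0 : 0 < de by rewrite divr_gt0// oppr_gt0.
have [e e0 We] : exists2 e : R, 0 < e & forall z, sqnorm (z - a) < e ^+ 2 ->
    mevalrV W z <= - de.
  have : \forall z \near a, mevalrV W z < - de.
    by apply: (cvgr_lt _ (@continuous_mevalrV _ _ W a)); rewrite /de; lra.
  move=> /nbhs_ballP[e /= e0 He]; exists e => // z ze; apply/ltW/He.
  split=> // i j; rewrite ord1 /ball/= distrC.
  rewrite -(@ltr_pXn2r _ 2)// ?nnegrE ?(ltW e0)// real_normK ?num_real//.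
  by apply: le_lt_trans ze; have := coord_sqnorm (z - a) j; rewrite !mxE.
pose B := [set z : 'rV[R]_m | sqnorm (z - a) < (e / 2) ^+ 2].
have csq : continuous (fun z : 'rV[R]_m => sqnorm (z - a)).
  rewrite (_ : (fun z => _) = mevalrV (msqnorm a)); last first.
    by apply/funext => z; rewrite msqnormE.
  exact: continuous_mevalrV.
have oB : open B.
  rewrite (_ : B = (fun z : 'rV[R]_m => sqnorm (z - a)) @^-1` [set x | x < (e / 2) ^+ 2])//.
  by apply: open_comp => // z _; exact: csq.
have mB : measurable (B : set (borelrV R m)) by exact: sub_sigma_algebra.
have e20 : 0 < e / 2 by rewrite divr_gt0.
have muB : (0 < mu (B `&` K : set (borelrV R m)))%E.
  rewrite lt0e measure_ge0 andbT; apply/negP => /eqP B0.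
  (* Otherwise the complement of [B] would be a closed set of full measure missing the point [a] of
     the support. *)
  have : K `<=` ~` B.
    apply: supp; first exact: open_closedC.
    rewrite setCK; apply/eqP; rewrite -measure_le0.
    have mBK : measurable (B `&` ~` K : set (borelrV R m)).
      by apply: measurableI => //; exact: measurableC.
    rewrite -(setUIDK B K) setDE.
    apply: (le_trans (measureU2 _ _ _)) => //; first exact: measurableI.
    rewrite -[X in (_ <= X)%E]add0e; apply: leeD.
      by rewrite le_eqVlt; apply/orP; left; apply/eqP; exact: B0.
    rewrite -muK; apply: le_measure; rewrite ?inE//.
    exact: measurableC.
  move=> /(_ a Ka); apply; rewrite /B/= subrr.
  rewrite /sqnorm big1 ?exprn_gt0// => i _; by rewrite mxE expr0n.
pose beta := fine (mu (B `&` K : set (borelrV R m))).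
have mBK : measurable (B `&` K : set (borelrV R m)) by exact: measurableI.
have betaE : mu (B `&` K : set (borelrV R m)) = beta%:E.
  by rewrite fineK// fin_num_measure.
have beta0 : 0 < beta by rewrite -lte_fin -betaE.
pose q := fine (\int[mu]_(z in KT) `|mevalrV W z|%:E).
have qE : (\int[mu]_(z in KT) `|mevalrV W z|%:E = q%:E)%E.
  rewrite fineK//; apply: integrable_fin_num => //.
  exact: (integrable_norm (intK W)).
have q0 : 0 <= q.
  by rewrite -lee_fin -qE integral_ge0// => z _; rewrite lee_fin.
(* Beyond radius [e] the Gaussian is at most exp (- (tau e)^2), while on [B], of radius e/2, it is
   at least exp (- (tau e)^2 / 4); 3/4 is the difference of the exponents. In between W < 0, and the
   integrand is bounded by 0. *)
have key tau : 0 <= tau -> de * beta * expR (3 / 4 * (tau * e) ^+ 2) <= q.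
  move=> tau0; have /le_trans := integral_gauss_ge0 tau0.
  set E := expR (- (tau * e) ^+ 2); set E' := expR (- (tau * (e / 2)) ^+ 2).
  pose g1 (z : borelrV R m) := E * `|mevalrV W z|.
  pose g2 (z : borelrV R m) := - (de * E') * \1_(B : set (borelrV R m)) z.
  have iW : mu.-integrable KT (EFin \o (fun z => `|mevalrV W z|)).
    exact: (integrable_norm (intK W)).
  have iB : mu.-integrable KT (EFin \o (\1_(B : set (borelrV R m)) : borelrV R m -> R)).
    by apply: (integrableS measurableT) => //; exact: integrable_indic.
  have i1 : mu.-integrable KT (EFin \o g1) by exact: integrable_EFinZ.
  have i2 : mu.-integrable KT (EFin \o g2) by exact: integrable_EFinZ.
  move=> /(_ (\int[mu]_(z in KT) (g1 z + g2 z)%:E)%E) H.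
  have : (0 <= \int[mu]_(z in KT) (g1 z + g2 z)%:E)%E.
    apply: H; apply: le_integral => //.
    - exact: integrable_bounded_mul.
    - exact: integrable_EFinD.
    move=> z _; rewrite lee_fin /g1 /g2 indicE.
    have [ze|ze] := ltP (sqnorm ((z : 'rV[R]_m) - a)) (e ^+ 2); last first.
      rewrite memNset ?mulr0 ?addr0.
        apply: (@le_trans _ _ (expR (- (tau ^+ 2 * sqnorm ((z : 'rV[R]_m) - a))) *
            `|mevalrV W z|)).
          by rewrite ler_wpM2l ?expR_ge0// ler_norm.
        rewrite ler_wpM2r// ler_expR lerN2 exprMn.
        by rewrite ler_wpM2l// sqr_ge0.
      rewrite /B/=; apply/negP; rewrite -leNgt; apply: le_trans ze.
      rewrite lerXn2r ?nnegrE ?(ltW e0) ?(ltW e20)//; lra.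
    have Wz := We z ze.
    case: (boolP (z \in (B : set (borelrV R m)))) => [|_]; last first.
      rewrite mulr0 addr0 (@le_trans _ _ 0)//; last by rewrite mulr_ge0 ?expR_ge0.
      by rewrite mulr_ge0_le0 ?expR_ge0// (le_trans Wz)// oppr_le0 ltW.
    rewrite inE /B/= => zB; rewrite mulr1.
    rewrite (@le_trans _ _ (- (de * E')))//; last by rewrite lerDr mulr_ge0 ?expR_ge0.
    rewrite -lerN2 opprK -mulrN mulrC ler_pM ?expR_ge0 ?(ltW de0)//.
      rewrite ler_expR lerN2 exprMn ler_wpM2l ?sqr_ge0 ?(ltW zB)//.
    by rewrite lerNr.
  rewrite (integralD_EFin mK i1 i2).
  have -> : (\int[mu]_(z in KT) (g1 z)%:E = (E * q)%:E)%E.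
    rewrite EFinM -qE -(integralZl mK iW)//.
  have -> : (\int[mu]_(z in KT) (g2 z)%:E = (- (de * E') * beta)%:E)%E.
    by rewrite EFinM -betaE -(integral_indic mu mK mB) -(integralZl mK iB).
  rewrite -EFinD lee_fin mulNr subr_ge0 => H1.
  have EE : expR (3 / 4 * (tau * e) ^+ 2) * E = E'.
    by rewrite -expRD; congr expR; field.
  move: H1; rewrite -EE (_ : de * _ * beta =
    E * (de * beta * expR (3 / 4 * (tau * e) ^+ 2))); last by ring.
  by rewrite ler_pM2l ?expR_gt0.
have db0 : 0 < de * beta by rewrite mulr_gt0.
pose x := q / (de * beta).
have x0 : 0 <= x by rewrite divr_ge0// ltW.
(* This [tau] makes the exponent equal to [x], so that [key] reads exp x <= x. *)
have := key (Num.sqrt (4 / 3 * x) / e).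
rewrite divr_ge0 ?sqrtr_ge0 ?(ltW e0)// => /(_ isT).
rewrite divfK ?gt_eqF// sqr_sqrtr; last by rewrite mulr_ge0//; lra.
rewrite (_ : 3 / 4 * (4 / 3 * x) = x); last by field.
rewrite -ler_pdivlMl// [_^-1 * q]mulrC -/x.
by have := expR_ge1Dx x; lra.
Qed.

End moment_problem.

(** * Convergence and rates *)

Section convergence.
Context {R : realType} {m : nat}.
Hypothesis m_gt0 : (0 < m)%N.
Variables (K : set 'rV[R]_m)
  (mu : {finite_measure set (borelrV R m) -> \bar R}).
Local Notation KT := (K : set (borelrV R m)).

Lemma support_mint1_gt0 : is_support mu K -> K !=set0 ->
  measurable KT -> mpoly_integrable K mu -> 0 < mint K mu 1.
Proof.
move=> [cK muK supp] [a Ka] mK intK; rewrite -lte_fin -integral_mevalrV//.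
rewrite (eq_integral (cst 1%:E)); last by move=> z _; rewrite mevalrV1.
rewrite integral_cst// mul1e lt0e measure_ge0 andbT; apply/negP => /eqP K0.
suff : K `<=` set0 by move=> /(_ a Ka).
apply: supp; first exact: closed0.
rewrite setC0 -(setUv K); apply/eqP; rewrite -measure_le0.
apply: (le_trans (measureU2 _ _ _)) => //; first exact: measurableC.
by rewrite [X in (_ + X)%E]muK adde0 le_eqVlt; apply/orP; left; apply/eqP; exact: K0.
Qed.

Lemma exprn_le_fact_expR (x : R) k : 0 <= x -> x ^+ k <= k`!%:R * expR x.
Proof.
move=> x0; rewrite -ler_pdivrMl ?ltr0n ?fact_gt0// mulrC.
have nd : nondecreasing_seq (series (exp_coeff x)).
  by apply: nondecreasing_series => n _ _; exact: exp_coeff_ge0.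
have := nondecreasing_cvgn_le nd (is_cvg_series_exp_coeff x) k.+1.
apply: le_trans; rewrite /series/= big_nat_recr//= lerDr sumr_ge0// => i _.
exact: exp_coeff_ge0.
Qed.

(** B^(2k) <= (2k)! exp B for B >= 0. Bounded sets therefore fall under the moment condition, and
    convergence is proved only once. *)
Lemma bounded_cond_moments B : closed K -> K° !=set0 ->
  (forall z, K z -> forall i, `|z 0 i| <= B) -> cond_moments K mu.
Proof.
move=> cK K0 KB; split => //.
have mK : measurable KT by exact: closed_measurable_rV.
pose c := fine (mu KT).
have cE : mu KT = c%:E by rewrite fineK// fin_num_measure.
have c0 : 0 <= c by rewrite -lee_fin -cE.
exists (expR `|B| * c + 1) => [|i k].
  by rewrite ltr_wpDl// mulr_ge0// expR_ge0.
apply: (@le_trans _ _ (\int[mu]_(z in KT) (`|B| ^+ (2 * k))%:E)%E).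
  apply: ge0_le_integral => //.
  - by move=> z _; rewrite lee_fin exprM exprn_ge0// sqr_ge0.
  - by apply/measurable_EFinP/measurable_funX; apply: measurable_funTS;
      apply: measurable_fun_rV_continuous => ?; exact: coord_continuous.
  move=> z Kz; rewrite lee_fin -[leLHS]ger0_norm; last by rewrite exprM exprn_ge0// sqr_ge0.
  by rewrite normrX lerXn2r ?nnegrE// (le_trans (KB z Kz i))// ler_norm.
rewrite [leLHS](_ : _ = (`|B| ^+ (2 * k) * c)%:E); last first.
  by rewrite EFinM -cE; exact: integral_cst.
rewrite lee_fin mulrDr mulr1.
rewrite ler_wpDr// mulrA ler_wpM2r//.
exact: exprn_le_fact_expR.
Qed.

Section moment_limit.
Hypothesis Kmu : cond_moments K mu.
Hypothesis supp : is_support mu K.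
Let mK : measurable KT.
Proof. by apply: closed_measurable_rV; case: supp. Qed.
Let intK : mpoly_integrable K mu.
Proof. exact: moments_integrable. Qed.

Variables (G : mpoly m R) (M : R) (a : 'rV[R]_m).
Hypothesis GM : forall z, K z -> mevalrV G z <= M.
Hypothesis Ka : K a.
Hypothesis Ga : mevalrV G a = M.

Lemma sos_bound_gt L : L < M ->
  exists r, (L%:E < sos_bound K mu (mevalrV G) r)%E.
Proof.
move=> LM; apply/not_existsP => H.
have {}H r : (sos_bound K mu (mevalrV G) r <= L%:E)%E by rewrite leNgt; apply/negP.
have m1 : 0 < mint K mu 1 by apply: support_mint1_gt0 => //; exists a.
have pos r h : sos r h -> 0 < mint K mu h -> 0 <= mint K mu ((mpolyC m L - G) * h).
  move=> hr h0; rewrite mulrBl mintB// mul_mpolyC mintZ// subr_ge0 -ler_pdivrMr//.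
  by rewrite -lee_fin (le_trans (sos_bound_ge mK intK G hr h0)).
suff : 0 <= mevalrV (mpolyC m L - G) a.
  by rewrite mevalrVB mevalrVC Ga; lra.
apply: (moment_positive m_gt0 mK Kmu) => // p.
(* If p vanishes a.e., p^2 is not an admissible weight, but p^2 + e is. *)
apply/ler_addgt0Pr => e e0.
set W := mpolyC m L - G.
(* Small enough for the added term [t * mint K mu W] to be at most [e]. *)
pose t := e / (`|mint K mu W| + 1).
have t0 : 0 < t by rewrite divr_gt0// ltr_wpDl.
have sp : sos (msize p) (p ^+ 2 + t *: 1).
  by apply: sosD; [apply: sos_sqr; exact: leqnSn|apply: sosZ; [exact: ltW|exact: sos1]].
have := pos _ _ sp.
rewrite mintD// mintZ// ltr_wpDl ?mulr_gt0//; last first.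
  by apply: mint_ge0 => z _; rewrite mevalrVXn sqr_ge0.
move=> /(_ isT); rewrite -/W mulrDr mintD// -scalerAr mulr1 mintZ//.
move=> /le_trans; apply; rewrite lerD2l /t mulrAC ler_pdivrMr ?ltr_wpDl//.
rewrite ler_pM2l//; have := ler_norm (mint K mu W); lra.
Qed.

Lemma sos_bound_cvg : sos_bound K mu (mevalrV G) @ \oo --> M%:E.
Proof.
have sup := ereal_nondecreasing_cvgn (sos_bound_nondecreasing K mu G).
rewrite (_ : M%:E = ereal_sup (range (sos_bound K mu (mevalrV G))))//.
apply/eqP; rewrite eq_le; apply/andP; split; last first.
  by apply: ge_ereal_sup => _ [r _ <-]; exact: sos_bound_le.
apply/lee_addgt0Pr => e e0.
have [|r Lr] := @sos_bound_gt (M - e); first by lra.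
rewrite -leeBlDr// -EFinB (le_trans (ltW Lr))//.
by apply: ereal_sup_ubound; exists r.
Qed.

End moment_limit.

End convergence.

Lemma mdeg_le_param (R : realType) n m d
    (f : bmultinom m d.+1 -> 'rV[R]_n -> R) x : mdeg_le d (mpoly_param f x).
Proof.
apply: mdeg_le_sum => b _; apply: mdeg_leZ.
by rewrite /mdeg_le msizeX; exact: bmdeg.
Qed.

Section rates.
Context {R : realType}.
Implicit Types (g u : nat -> R^o).

Lemma eqO_eventually g u C N : (forall r, (N <= r)%N -> 0 <= g r) ->
  (forall r, (N <= r)%N -> g r <= C * u r) -> g =O_\oo u.
Proof.
move=> g0 gu; apply/eqO_exP; exists (`|C| + 1); first by rewrite ltr_wpDl.
exists N => // r /= Nr; rewrite ger0_norm ?g0// (le_trans (gu r Nr))//.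
rewrite (le_trans (ler_norm _))// normrM ler_wpM2r//; lra.
Qed.

End rates.

Theorem theorem2 (R : realType) (n m d : nat) (m_gt0 : (0 < m)%N) :
  (forall (K : set 'rV[R]_m)
      (mu : {finite_measure set (borelrV R m) -> \bar R})
      (f : bmultinom m d.+1 -> 'rV[R]_n -> R) (x : 'rV[R]_n) (M : R),
    closed K -> K° !=set0 -> is_support mu K ->
    is_max_on K (param_poly f x) M ->
    cond_moments K mu \/ cond_compact K mu \/ cond_cone K mu \/
      cond_convex K mu \/ cond_chebyshev K mu ->
    sos_bound K mu (param_poly f x) @ \oo --> M%:E /\
    ((limn (sos_bound K mu (param_poly f x)) <= 0)%E <-> M <= 0) /\
    (cond_moments K mu \/ cond_compact K mu ->
      gap K mu (param_poly f x) M =o_\oo (fun r : nat => 1 : R^o)) /\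
    (cond_cone K mu ->
      gap K mu (param_poly f x) M
        =O_\oo (fun r : nat => (Num.sqrt r%:R)^-1 : R^o)) /\
    (cond_convex K mu ->
      gap K mu (param_poly f x) M =O_\oo (fun r : nat => r%:R^-1 : R^o)) /\
    (cond_chebyshev K mu ->
      gap K mu (param_poly f x) M
        =O_\oo (fun r : nat => (r%:R ^+ 2)^-1 : R^o)))
  /\
  (forall (K : set 'rV[R]_m)
      (mu : {finite_measure set (borelrV R m) -> \bar R}),
    (0 < d)%N -> cond_chebyshev K mu ->
    exists (f : bmultinom m d.+1 -> 'rV[R]_n -> R) (x : 'rV[R]_n) (M : R),
      is_max_on K (param_poly f x) M /\
      gap K mu (param_poly f x) M
        =Theta_\oo (fun r : nat => (r%:R ^+ 2)^-1 : R^o)).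

Proof.
split=> [K mu f x M cK K0 supp|K mu d0 Kmu].
  rewrite param_polyE; set G := mpoly_param f x.
  move=> [[a Ka Ga] GM] cond.
  have mK : measurable (K : set (borelrV R m)) by exact: closed_measurable_rV.
  have Kmom : cond_moments K mu.
    have cmom : compact K -> cond_moments K mu.
      by move=> /compact_coord_bounded[B _ KB]; exact: bounded_cond_moments KB.
    case: cond => [//|[[//]|[[]|[[]|]]]].
    - by move=> /cmom.
    - by move=> /cmom.
    - by move=> [/cmom].
    - move=> Kc; apply: (@bounded_cond_moments _ _ _ _ 1) => // z Kz i.
      exact: (chebyshev_coord_bound Kc).
  have intK := moments_integrable m_gt0 mK Kmom.
  have m1 : 0 < mint K mu 1 by apply: support_mint1_gt0 => //; exists a.
  have scvg : sos_bound K mu (mevalrV G) @ \oo --> M%:E.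
    exact: (sos_bound_cvg m_gt0 Kmom supp GM Ka Ga).
  have g0 r : 0 <= gap K mu (mevalrV G) M r by exact: gap_ge0.
  split=> //; split; first by rewrite (cvg_lim _ scvg)// lee_fin.
  split; [|split; [|split]].
  - move=> _; apply/eqoP => e e0.
    have Me : M - e < M by rewrite ltrBlDr ltrDl.
    have [r0 r0L] := sos_bound_gt m_gt0 Kmom supp Ka Ga Me.
    exists r0 => // r /= rr0; rewrite normr1 mulr1 ger0_norm//.
    have fin := sos_bound_fin_num mK intK m1 r GM.
    rewrite /gap fineB//= lerBlDr -lerBlDl -lee_fin fineK//.
    exact: le_trans (ltW r0L) (sos_bound_nondecreasing _ _ _ rr0).
  - move=> [/compact_coord_bounded[B B0 KB] coneK lebK].
    have [C CP] := gap_cone_le m_gt0 mK intK m1 coneK lebK KB GM Ka Ga.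
    by apply: (@eqO_eventually _ _ _ C 2).
  - move=> [[/compact_coord_bounded[B B0 KB] convK _] lebK].
    (* The bound starts at r = 2, where the exponent s = r/2 becomes positive; the cone case is
       alike. *)
    have [C CP] := gap_convex_le mK intK m1 convK lebK KB GM Ka Ga.
    by apply: (@eqO_eventually _ _ _ C 2).
  - move=> Kc.
    have Gd : mdeg_le d G by exact: mdeg_le_param.
    have [C CP] := gap_chebyshev_le Kc m_gt0 Gd GM Ka Ga.
    apply: (@eqO_eventually _ _ _ C (m * d.+1).+1) => // r mr.
    by apply: CP; [exact: ltnW|exact: leq_ltn_trans mr].
pose i0 := Ordinal m_gt0.
have bP : (mdeg (mnm1 i0 : multinom m) < d.+1)%N by rewrite mdeg1 ltnS.
pose b0 : bmultinom m d.+1 := BMultinom bP.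
pose f (b : bmultinom m d.+1) (x : 'rV[R]_n) : R := (b == b0)%:R.
pose G := mpolyX R (mnm1 i0).
have fG x : param_poly f x = mevalrV G.
  rewrite param_polyE /mpoly_param (bigD1 b0)//= /f eqxx scale1r big1 ?addr0//.
  by move=> b /negbTE->; rewrite scale0r.
exists f, 0, 1; rewrite fG.
have GM z : K z -> mevalrV G z <= 1.
  move=> Kz; rewrite mevalrVX.
  by have := chebyshev_coord_bound Kmu Kz i0; rewrite ler_norml => /andP[].
have Ka : K (const_mx 1).
  by rewrite Kmu.1 => /= i; rewrite mxE lexx andbT; lra.
have Ga : mevalrV G (const_mx 1) = 1 by rewrite mevalrVX mxE.
split; first by split => //; exists (const_mx 1).
have mK := chebyshev_measurable Kmu.
have intK := chebyshev_integrable Kmu.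
have m1 := mint1_chebyshev_gt0 Kmu.
have g0 r : 0 <= gap K mu (mevalrV G) 1 r by exact: gap_ge0.
rewrite eqThetaE bigThetaE; split.
  have Gd : mdeg_le 1 G by exact: mdeg_leX.
  have [C CP] := gap_chebyshev_le Kmu m_gt0 Gd GM Ka Ga.
  apply: (@eqO_eventually _ _ _ C (m * 2).+1) => // r mr.
  by apply: CP; [exact: ltnW|exact: leq_ltn_trans mr].
rewrite eqOmegaO; apply: (@eqO_eventually _ _ _ 4 1) => // r r0.
rewrite -ler_pdivrMl// -invfM; exact: gap_chebyshev_ge.
Qed.
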